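(* Let $d\in\{2,3\}$, let $\Omega\subset\mathbb{R}^d$ be a bounded Lipschitz polytope, and let $s\in[3,4]$. Let $\nu,\kappa\in C^{0,1}(\mathbb{R})$ satisfy $\nu_-\le\nu(r)\le\nu_+$ and $\kappa_-\le\kappa(r)\le\kappa_+$ for all $r\in\mathbb{R}$, with positive constants $\nu_\pm,\kappa_\pm$. Let $\mathbf{f}\in\mathbf{H}^{-1}(\Omega)$ and $g\in H^{-1}(\Omega)$. Then, for every mesh $\mathscr{T}_h\in\mathbb{T}$, there is at least one solution $(\mathbf{u}_h,\mathsf{p}_h,T_h)\in\mathbf{X}_h\times M_h\times Y_h$ of the discrete coupled problem. Moreover, $$\|\nabla\mathbf{u}_h\|_{\mathbf{L}^2(\Omega)}\le\nu_-^{-1}\|\mathbf{f}\|_{\mathbf{H}^{-1}(\Omega)},\qquad\|\mathsf{p}_h\|_{L^2(\Omega)}\le\tilde\beta^{-1}\Lambda(\mathbf{f})\|\mathbf{f}\|_{\mathbf{H}^{-1}(\Omega)},\qquad\|\nabla T_h\|_{\mathbf{L}^2(\Omega)}\le\kappa_-^{-1}\|g\|_{H^{-1}(\Omega)}.$$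
   Context: Bold letters denote $\mathbb{R}^d$-valued functions and their spaces; $|\cdot|$ is the Euclidean norm. $L_0^2(\Omega)$ is the space of $L^2(\Omega)$ functions with zero mean. $H^{-1}(\Omega)$ and $\mathbf{H}^{-1}(\Omega)$ are the duals of $H_0^1(\Omega)$ and $\mathbf{H}_0^1(\Omega)$, with dual norms taken with respect to the norm $\|\nabla\cdot\|_{L^2(\Omega)}$. Meshes and spaces. $\mathbb{T}=\{\mathscr{T}_h\}_{h>0}$ is a shape-regular family of conforming partitions of $\bar\Omega$ into closed simplices $K$, refinements of an initial mesh $\mathscr{T}_0$, with $h=\max_K\mathrm{diam}(K)$. The pair $(\mathbf{X}_h,M_h)$ is one of: (1) Taylor--Hood: $\mathbf{X}_h=\{\mathbf{v}_h\in\mathbf{C}(\bar\Omega):\mathbf{v}_h|_K\in[\mathbb{P}_2(K)]^d\ \forall K\in\mathscr{T}_h\}\cap\mathbf{H}_0^1(\Omega)$, $M_h=\{\mathsf{q}_h\in L_0^2(\Omega)\cap C(\bar\Omega):\mathsf{q}_h|_K\in\mathbb{P}_1(K)\ \forall K\in\mathscr{T}_h\}$; (2) mini element: $\mathbf{X}_h=\{\mathbf{v}_h\in\mathbf{C}(\bar\Omega):\mathbf{v}_h|_K\in[\mathbb{P}_1(K)\oplus\mathbb{B}(K)]^d\ \forall K\in\mathscr{T}_h\}\cap\mathbf{H}_0^1(\Omega)$, with $\mathbb{B}(K)$ the span of a local bubble function on $K$, and the same $M_h$. It satisfies the uniform discrete inf-sup condition: with some $\tilde\beta>0$ independent of $h$,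 $\inf_{\mathsf{q}_h\in M_h\setminus\{0\}}\sup_{\mathbf{v}_h\in\mathbf{X}_h\setminus\{0\}}\frac{\int_\Omega\mathsf{q}_h\,\mathrm{div}\,\mathbf{v}_h\,\mathrm{d}x}{\|\nabla\mathbf{v}_h\|_{\mathbf{L}^2(\Omega)}\|\mathsf{q}_h\|_{L^2(\Omega)}}\ge\tilde\beta$. Further, $Y_h=\{S_h\in C(\bar\Omega):S_h|_K\in\mathbb{P}_{\mathfrak{r}}(K)\ \forall K\in\mathscr{T}_h\}\cap H_0^1(\Omega)$ with $\mathfrak{r}=2$ in case (1) and $\mathfrak{r}=1$ in case (2). Discrete coupled problem. Let $a_N(\mathbf{u};\mathbf{v},\mathbf{w})=\int_\Omega(\mathbf{u}\cdot\nabla)\mathbf{v}\cdot\mathbf{w}\,\mathrm{d}x$, $a_{SN}(\mathbf{u};\mathbf{v},\mathbf{w})=\frac12[a_N(\mathbf{u};\mathbf{v},\mathbf{w})-a_N(\mathbf{u};\mathbf{w},\mathbf{v})]$, $a_{ST}(\mathbf{v};T,S)=\frac12\int_\Omega((\mathbf{v}\cdot\nabla T)S-(\mathbf{v}\cdot\nabla S)T)\,\mathrm{d}x$. Find $(\mathbf{u}_h,\mathsf{p}_h,T_h)\in\mathbf{X}_h\times M_h\times Y_h$ such that for all $(\mathbf{v}_h,\mathsf{q}_h,S_h)\in\mathbf{X}_h\times M_h\times Y_h$ $$\int_\Omega(\nu(T_h)\nabla\mathbf{u}_h\cdot\nabla\mathbf{v}_h+\mathbf{u}_h\cdot\mathbf{v}_h)\,\mathrm{d}x+a_{SN}(\mathbf{u}_h;\mathbf{u}_h,\mathbf{v}_h)+\int_\Omega|\mathbf{u}_h|^{s-2}\mathbf{u}_h\cdot\mathbf{v}_h\,\mathrm{d}x-\int_\Omega\mathsf{p}_h\,\mathrm{div}\,\mathbf{v}_h\,\mathrm{d}x=\langle\mathbf{f},\mathbf{v}_h\rangle,$$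 $$\int_\Omega\mathsf{q}_h\,\mathrm{div}\,\mathbf{u}_h\,\mathrm{d}x=0,\qquad\int_\Omega\kappa(T_h)\nabla T_h\cdot\nabla S_h\,\mathrm{d}x+a_{ST}(\mathbf{u}_h;T_h,S_h)=\langle g,S_h\rangle.$$ Constants. $\mathcal{C}_N>0$ is a constant such that $|a_N(\mathbf{u};\mathbf{v},\mathbf{w})|\le\mathcal{C}_N\|\nabla\mathbf{u}\|_{\mathbf{L}^2(\Omega)}\|\nabla\mathbf{v}\|_{\mathbf{L}^2(\Omega)}\|\nabla\mathbf{w}\|_{\mathbf{L}^2(\Omega)}$ on $[\mathbf{H}_0^1(\Omega)]^3$. $\mathcal{C}_{p\hookrightarrow2}$ is the best constant in $\|\mathbf{v}\|_{\mathbf{L}^p(\Omega)}\le\mathcal{C}_{p\hookrightarrow2}\|\nabla\mathbf{v}\|_{\mathbf{L}^2(\Omega)}$, $\mathbf{v}\in\mathbf{H}_0^1(\Omega)$. Finally, $$\Lambda(\mathbf{f}):=1+\nu_+\nu_-^{-1}+\mathcal{C}_N\nu_-^{-2}\|\mathbf{f}\|_{\mathbf{H}^{-1}(\Omega)}+\mathcal{C}_{2\hookrightarrow2}^2\nu_-^{-1}+\mathcal{C}_{s\hookrightarrow2}^s\nu_-^{1-s}\|\mathbf{f}\|_{\mathbf{H}^{-1}(\Omega)}^{s-2}.$$ *)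

(* Defs.v *)
From HB Require Import structures.
From mathcomp Require Import all_boot all_order all_algebra.
From mathcomp Require Import all_classical all_reals all_analysis.

Set Implicit Arguments.
Unset Strict Implicit.
Unset Printing Implicit Defensive.

Import Order.TTheory GRing.Theory Num.Theory.
Import numFieldNormedType.Exports.

Local Open Scope classical_set_scope.
Local Open Scope ring_scope.

Definition measure_rV_display : measure_display -> measure_display.
Proof. exact. Qed.

Section measurable_rV.
Context {R : realType} (n : nat).

Let coors : 'I_n -> 'rV[R]_n -> measurableTypeR R := fun i x => x ord0 i.

Let rV_set0 : g_sigma_preimage coors set0.
Proof. exact: sigma_algebra0. Qed.

Let rV_setC A : g_sigma_preimage coors A -> g_sigma_preimage coors (~` A).
Proof. exact: sigma_algebraC. Qed.

Let rV_bigcup (F : _^nat) : (forall i, g_sigma_preimage coors (F i)) ->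
  g_sigma_preimage coors (\bigcup_i (F i)).
Proof. exact: sigma_algebra_bigcup. Qed.

(* The product sigma-algebra, that is, the Borel sets of R^n. *)
HB.instance Definition _ := @isMeasurable.Build
  (measure_rV_display default_measure_display)
  'rV[R]_n (g_sigma_preimage coors) rV_set0 rV_setC rV_bigcup.

End measurable_rV.

Lemma measurable_coord (R : realType) n (i : 'I_n) :
  measurable_fun [set: 'rV[R]_n] (fun x => x ord0 i : measurableTypeR R).
Proof.
move=> _ Y mY; rewrite setTI; apply: sub_sigma_algebra => /=.
rewrite -bigcup_seq/=; exists i => /=; first by rewrite mem_index_enum.
by exists Y => //; rewrite setTI.
Qed.

Lemma measurable_fun_rVP d (T : measurableType d) (R : realType) n
    (f : T -> 'rV[R]_n) :
  measurable_fun [set: T] f <->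
  forall i, measurable_fun [set: T] (fun t => f t ord0 i : measurableTypeR R).
Proof.
split=> [mf i|mf].
  exact: (measurableT_comp (measurable_coord i) mf).
move=> _ A mA; rewrite setTI.
suff /(_ A mA) : (measurable : set (set 'rV[R]_n)) `<=`
    [set B | measurable (f @^-1` B)] by [].
apply: smallest_sub.
  split=> /=; first by rewrite preimage_set0; exact: measurable0.
    by move=> B mB; rewrite setTD preimage_setC; exact: measurableC.
  by move=> F mF; rewrite preimage_bigcup; exact: bigcup_measurable.
rewrite -bigcup_seq; apply: bigcup_sub => i _ B [C mC <-] /=.
by rewrite setTI -[X in measurable X]setTI; exact: mf.
Qed.

Section lebesgue_rV.
Context {R : realType}.

Definition cons_rV n (p : measurableTypeR R * 'rV[R]_n) : 'rV[R]_n.+1 :=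
  \row_i oapp (p.2 ord0) (p.1 : R) (unlift ord0 i).

Lemma measurable_cons_rV n : measurable_fun setT (@cons_rV n).
Proof.
apply/measurable_fun_rVP => i; rewrite /cons_rV.
case: (unliftP ord0 i) => [j|] ->.
  under eq_fun do rewrite mxE liftK /=.
  exact: (measurableT_comp (measurable_coord j) measurable_snd).
under eq_fun do rewrite mxE unlift_none /=.
exact: measurable_fst.
Qed.

Definition uncons_rV n (x : 'rV[R]_n.+1) : measurableTypeR R * 'rV[R]_n :=
  (x ord0 ord0, \row_j x ord0 (lift ord0 j)).

Lemma cons_rVK n : cancel (@cons_rV n) (@uncons_rV n).
Proof.
move=> [x y]; rewrite /uncons_rV /cons_rV /=.
congr pair; first by rewrite mxE unlift_none.
by apply/rowP => j; rewrite !mxE liftK.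
Qed.

Lemma measurable_uncons_rV n : measurable_fun setT (@uncons_rV n).
Proof.
apply: measurable_fun_pair; first exact: measurable_coord.
apply/measurable_fun_rVP => j; under eq_fun do rewrite mxE.
exact: measurable_coord.
Qed.

Section step.
Variables (n : nat) (m : {sigma_finite_measure set 'rV[R]_n -> \bar R}).

Definition lebesgue_rV_step : set 'rV[R]_n.+1 -> \bar R :=
  pushforward (lebesgue_measure \x m)%E (@cons_rV n).

Let mc := @measurable_cons_rV n.

Let step0 : lebesgue_rV_step set0 = 0%E.
Proof. by rewrite /lebesgue_rV_step /pushforward preimage_set0 measure0. Qed.

Let step_ge0 A : (0 <= lebesgue_rV_step A)%E.
Proof. exact: measure_ge0. Qed.

Let step_sigma_additive : semi_sigma_additive lebesgue_rV_step.
Proof.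
move=> F mF tF mUF; rewrite /lebesgue_rV_step /pushforward preimage_bigcup.
apply: measure_semi_sigma_additive.
- by move=> k; rewrite -[X in measurable X]setTI; exact: mc.
- apply/trivIsetP => /= i j _ _ ij; rewrite -preimage_setI.
  by move/trivIsetP : tF => /(_ _ _ _ _ ij) ->//; rewrite preimage_set0.
- by rewrite -preimage_bigcup -[X in measurable X]setTI; exact: mc.
Qed.

HB.instance Definition _ := isMeasure.Build _ _ _
  lebesgue_rV_step step0 step_ge0 step_sigma_additive.

Let step_sigma_finite : sigma_finite setT lebesgue_rV_step.
Proof.
have /sigma_finiteP[F [TF ndF Foo]] :=
  sigma_finiteT (lebesgue_measure : {sigma_finite_measure set (measurableTypeR R) -> \bar R}).
have /sigma_finiteP[G [TG ndG Goo]] := sigma_finiteT m.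
exists (fun k => @uncons_rV n @^-1` (F k `*` G k)).
  apply/esym/seteqP; split=> // x _.
  have [i _ Fi] : (\bigcup_k F k) (uncons_rV x).1 by rewrite -TF.
  have [j _ Gj] : (\bigcup_k G k) (uncons_rV x).2 by rewrite -TG.
  exists (maxn i j) => //; split.
    by move/subsetPset: (ndF _ _ (leq_maxl i j)); apply.
  by move/subsetPset: (ndG _ _ (leq_maxr i j)); apply.
move=> k; have [mFk Fkoo] := Foo k; have [mGk Gkoo] := Goo k; split.
  rewrite -[X in measurable X]setTI; apply: measurable_uncons_rV => //.
  exact: measurableX.
rewrite /lebesgue_rV_step /pushforward -comp_preimage.
have -> : @uncons_rV n \o @cons_rV n = id by exact/funext/cons_rVK.
by rewrite preimage_id product_measure1E// lte_mul_pinfty// ge0_fin_numE.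
Qed.

HB.instance Definition _ := Measure_isSigmaFinite.Build _ _ _
  lebesgue_rV_step step_sigma_finite.

End step.

(* R^0 is one point, of mass 1, and R^(n+1) is R x R^n. *)
Fixpoint lebesgue_rV (n : nat) : {sigma_finite_measure set 'rV[R]_n -> \bar R} :=
  match n with
  | 0 => \d_(0 : 'rV[R]_0)
  | k.+1 => lebesgue_rV_step (lebesgue_rV k)
  end.

Lemma lebesgue_rV_box n (A : 'I_n -> set (measurableTypeR R)) :
  (forall i, measurable (A i)) ->
  lebesgue_rV n [set x : 'rV[R]_n | forall i, A i (x ord0 i)] =
  (\prod_(i < n) lebesgue_measure (A i))%E.
Proof.
elim: n A => [|n IH] A mA.
  rewrite big_ord0 /= diracE mem_set//; by case.
have mB (m : nat) (B : 'I_m -> set (measurableTypeR R)) :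
    (forall i, measurable (B i)) ->
    measurable [set x : 'rV[R]_m | forall i, B i (x ord0 i)].
  move=> mB; rewrite (_ : mkset _ =
    \bigcap_(i in [set: 'I_m]) [set x : 'rV[R]_m | B i (x ord0 i)]).
    apply: fin_bigcap_measurable => // i _.
    by rewrite -[X in measurable X]setTI; exact: measurable_coord.
  by apply/seteqP; split=> x /= h i; [move=> _|]; exact: h.
pose A' (i : 'I_n) := A (lift ord0 i).
pose B := [set y : 'rV[R]_n | forall i, A' i (y ord0 i)].
have mA' i : measurable (A' i) by exact: mA.
have mBB : measurable B by exact: mB.
have -> : lebesgue_rV n.+1 [set x : 'rV[R]_n.+1 | forall i, A i (x ord0 i)] =
    (lebesgue_measure \x lebesgue_rV n)%E (A ord0 `*` B).
  rewrite /= /lebesgue_rV_step /pushforward; congr (_ _).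
  apply/seteqP; split=> -[x y] /=; rewrite /cons_rV.
    move=> h; split; first by have := h ord0; rewrite mxE unlift_none.
    by move=> i; have := h (lift ord0 i); rewrite mxE liftK.
  move=> [h0 h] i; rewrite mxE /=.
  by case: (unliftP ord0 i) => [j|] -> //=; exact: h.
by rewrite product_measure1E// big_ord_recl -(IH A').
Qed.

End lebesgue_rV.

(* A function on Omega is represented by a total function on R^d, of which only
   the restriction to Omega (or to its closure) matters. *)

Section sobolev.
Context {R : realType} {d : nat}.
Implicit Types (Omega : set 'rV[R]_d) (u g phi : 'rV[R]_d -> R).

Definition mdot m n (A B : 'M[R]_(m, n)) : R := \sum_i \sum_j A i j * B i j.

(* Euclidean norm of vectors, Frobenius norm of matrices; the library norm on
   matrices is the max norm. *)
Definition mnorm m n (A : 'M[R]_(m, n)) : R := Num.sqrt (mdot A A).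

Definition Lp_norm Omega (p : R) u : \bar R :=
  Lnorm (lebesgue_rV d) p%:E (EFin \o (u \_ Omega)).

Definition L2_norm Omega u : R := fine (Lp_norm Omega 2 u).

Definition L2 Omega u : Prop := u \_ Omega \in Lfun (lebesgue_rV d) 2%:E.

Definition partial (i : 'I_d) u : 'rV[R]_d -> R :=
  fun x => 'D_(delta_mx 0 i) u x.

Definition smooth u : Prop :=
  forall (s : seq 'I_d) x, differentiable (foldr partial u s) x.

Definition test_function Omega phi : Prop :=
  smooth phi /\
  exists K, [/\ compact K, K `<=` Omega & forall x, ~ K x -> phi x = 0].

Definition is_weak_partial Omega (i : 'I_d) u g : Prop :=
  L2 Omega g /\
  forall phi, test_function Omega phi ->
    \int[lebesgue_rV d]_(x in Omega) (u x * partial i phi x) =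
    - \int[lebesgue_rV d]_(x in Omega) (g x * phi x).

(* An L^2 representative of the weak derivative, which is unique a.e. in
   Omega; it is only meaningful for functions that have one. *)
Definition weak_partial Omega (i : 'I_d) u : 'rV[R]_d -> R :=
  get (is_weak_partial Omega i u).

Definition H1_space Omega u : Prop :=
  L2 Omega u /\ forall i, exists g, is_weak_partial Omega i u g.

(* The closure of the test functions in H^1(Omega). *)
Definition H10 Omega u : Prop :=
  H1_space Omega u /\
  exists phi : nat -> 'rV[R]_d -> R,
    [/\ forall k, test_function Omega (phi k),
        Lp_norm Omega 2 (phi k - u) @[k --> \oo] --> 0%E &
        forall i, Lp_norm Omega 2 (partial i (phi k) - weak_partial Omega i u)
          @[k --> \oo] --> 0%E].

Definition grad Omega u (x : 'rV[R]_d) : 'rV[R]_d :=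
  \row_j weak_partial Omega j u x.

Definition grad_norm Omega u : R := L2_norm Omega (fun x => mnorm (grad Omega u x)).

Implicit Types v w : 'rV[R]_d -> 'rV[R]_d.

Definition component v (i : 'I_d) : 'rV[R]_d -> R := fun x => v x ord0 i.

Definition H10v Omega v : Prop := forall i, H10 Omega (component v i).

(* Row i is the gradient of the i-th component. *)
Definition gradv Omega v (x : 'rV[R]_d) : 'M[R]_d :=
  \matrix_(i, j) weak_partial Omega j (component v i) x.

Definition divergence Omega v (x : 'rV[R]_d) : R := \tr (gradv Omega v x).

Definition gradv_norm Omega v : R := L2_norm Omega (fun x => mnorm (gradv Omega v x)).

End sobolev.

(* V is a space of representatives and N its norm; boundedness makes f
   insensitive to the choice of the representative. *)

Section dual.
Context {R : realType} {U : lmodType R}.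
Variables (V : set U) (N : U -> R).

Definition dual_space (f : U -> R) : Prop :=
  (forall (a : R) u v, V u -> V v -> f (a *: u + v) = a * f u + f v) /\
  exists C : R, forall u, V u -> `|f u| <= C * N u.

Definition dual_norm (f : U -> R) : R :=
  sup [set `|f u| | u in [set u | V u /\ N u <= 1]].

End dual.

Section meshes.
Context {R : realType} {d : nat}.
Implicit Types (Omega K : set 'rV[R]_d).

(* Near each boundary point Omega is the strict epigraph, in the direction of a
   unit vector e, of a Lipschitz function of the component orthogonal to e. *)
Definition lipschitz_boundary Omega : Prop :=
  forall x, (closure Omega `\` Omega) x ->
  exists (e : 'rV[R]_d) (gamma : 'rV[R]_d -> R),
    [/\ mnorm e = 1, lipschitz gamma &
        \forall y \near x,
          Omega y <-> gamma (y - mdot y e *: e) < mdot y e].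

(* A d-simplex is given by its d.+1 vertices, the rows of a matrix. *)
Definition vertices := 'M[R]_(d.+1, d).

Definition affinely_independent (A : vertices) : Prop :=
  \matrix_(i < d) (row (lift ord0 i) A - row ord0 A) \in unitmx.

(* The face spanned by the vertices in I; it is empty if I is. *)
Definition face (A : vertices) (I : {set 'I_d.+1}) : set 'rV[R]_d :=
  [set x | exists t : 'rV[R]_d.+1,
    [/\ forall i, 0 <= t ord0 i, forall i, i \notin I -> t ord0 i = 0,
        \sum_i t ord0 i = 1 & x = t *m A]].

Definition simplex (A : vertices) : set 'rV[R]_d := face A [set: 'I_d.+1]%SET.

Definition barycenter (A : vertices) : 'rV[R]_d :=
  (d.+1%:R)^-1 *: \sum_i row i A.

Definition mesh := seq vertices.

Definition mesh_union (T : mesh) : set 'rV[R]_d :=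
  [set x | exists2 A, A \in T & simplex A x].

(* Polytopes need not be convex, nor connected. *)
Definition lipschitz_polytope Omega : Prop :=
  [/\ open Omega, Omega !=set0, bounded_set Omega, lipschitz_boundary Omega &
      exists T : mesh, (forall A, A \in T -> affinely_independent A) /\
        closure Omega = mesh_union T].

Definition conforming_partition Omega (T : mesh) : Prop :=
  [/\ uniq T,
      forall A, A \in T -> affinely_independent A,
      closure Omega = mesh_union T &
      forall A B, A \in T -> B \in T -> A != B ->
        (simplex A)° `&` (simplex B)° = set0 /\
        exists I J, simplex A `&` simplex B = face A I /\ face A I = face B J].

Definition refines (T T0 : mesh) : Prop :=
  forall A, A \in T -> exists2 B, B \in T0 & simplex A `<=` simplex B.

Definition diam K : R := sup [set mnorm (x - y) | x in K & y in K].

(* Diameter of the largest ball contained in K. *)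
Definition inner_diam K : R :=
  sup [set 2 * r | r in [set r : R | 0 <= r /\
    exists c, forall x, mnorm (x - c) <= r -> K x]].

Definition shape_regular (TT : set mesh) : Prop :=
  exists sigma : R, forall T A, TT T -> A \in T ->
    diam (simplex A) <= sigma * inner_diam (simplex A).

Definition mesh_family Omega (T0 : mesh) (TT : set mesh) : Prop :=
  [/\ conforming_partition Omega T0,
      forall T, TT T -> conforming_partition Omega T /\ refines T T0 &
      shape_regular TT].

End meshes.

Arguments vertices R d : clear implicits.
Arguments mesh R d : clear implicits.

Section finite_elements.
Context {R : realType} {d : nat}.
Implicit Types (Omega K : set 'rV[R]_d) (A : vertices R d) (T : mesh R d).
Implicit Types (u b q S : 'rV[R]_d -> R) (v : 'rV[R]_d -> 'rV[R]_d).

(* The exponents m range over the monomials of total degree at most k. *)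
Definition poly_on (k : nat) K u : Prop :=
  exists c : {ffun 'I_d -> 'I_k.+1} -> R, forall x, K x ->
    u x = \sum_(m : {ffun 'I_d -> 'I_k.+1} | (\sum_i m i <= k)%N)
            c m * \prod_i x ord0 i ^+ m i.

(* Bubble functions are not restricted to the usual product of the barycentric
   coordinates. *)
Definition is_bubble A b : Prop :=
  [/\ {within simplex A, continuous b}, H10 (simplex A)° b,
      forall x, simplex A x -> 0 <= b x <= 1 & b (barycenter A) = 1].

(* The mini element comes with the choice of a bubble function on each simplex. *)
Inductive fe_pair : Type :=
  | TaylorHood
  | MiniElement of (vertices R d -> 'rV[R]_d -> R).

Definition fe_pair_wf (fe : fe_pair) (TT : set (mesh R d)) : Prop :=
  match fe with
  | TaylorHood => True
  | MiniElement b => forall T A, TT T -> A \in T -> is_bubble A (b A)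
  end.

Definition velocity_local (fe : fe_pair) A u : Prop :=
  match fe with
  | TaylorHood => poly_on 2 (simplex A) u
  | MiniElement b => exists (w : 'rV[R]_d -> R) (c : R),
      poly_on 1 (simplex A) w /\ forall x, simplex A x -> u x = w x + c * b A x
  end.

Definition temperature_degree (fe : fe_pair) : nat :=
  match fe with TaylorHood => 2 | MiniElement _ => 1 end.

Definition Xh Omega (fe : fe_pair) T v : Prop :=
  [/\ {within closure Omega, continuous v},
      forall A i, A \in T -> velocity_local fe A (component v i) & H10v Omega v].

Definition Mh Omega T q : Prop :=
  [/\ L2 Omega q, \int[lebesgue_rV d]_(x in Omega) q x = 0,
      {within closure Omega, continuous q} &
      forall A, A \in T -> poly_on 1 (simplex A) q].

Definition Yh Omega (fe : fe_pair) T S : Prop :=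
  [/\ {within closure Omega, continuous S},
      forall A, A \in T -> poly_on (temperature_degree fe) (simplex A) S &
      H10 Omega S].

Definition nonzero_on (V : zmodType) K (u : 'rV[R]_d -> V) : Prop :=
  exists2 x, K x & u x != 0.

(* Elements of the discrete spaces are zero iff they vanish on the closure. *)
Definition inf_sup_constant Omega (fe : fe_pair) T : \bar R :=
  ereal_inf [set ereal_sup [set
      ((\int[lebesgue_rV d]_(x in Omega) (q x * divergence Omega v x)) /
       (gradv_norm Omega v * L2_norm Omega q))%:E
    | v in [set v | Xh Omega fe T v /\ nonzero_on (closure Omega) v]]
  | q in [set q | Mh Omega T q /\ nonzero_on (closure Omega) q]].

End finite_elements.

Arguments fe_pair R d : clear implicits.

Section coupled_problem.
Context {R : realType} {d : nat}.
Variable Omega : set 'rV[R]_d.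
Implicit Types (u v w : 'rV[R]_d -> 'rV[R]_d) (p q T S : 'rV[R]_d -> R).

Definition a_N u v w : R :=
  \int[lebesgue_rV d]_(x in Omega) mdot (u x *m (gradv Omega v x)^T) (w x).

Definition a_SN u v w : R := 2^-1 * (a_N u v w - a_N u w v).

Definition a_ST v T S : R :=
  2^-1 * \int[lebesgue_rV d]_(x in Omega)
    (mdot (v x) (grad Omega T x) * S x - mdot (v x) (grad Omega S x) * T x).

Definition discrete_solution (fe : fe_pair R d) (Th : mesh R d) (s : R)
    (nu kappa : R -> R) (f : ('rV[R]_d -> 'rV[R]_d) -> R)
    (g : ('rV[R]_d -> R) -> R) u p T : Prop :=
  [/\ Xh Omega fe Th u, Mh Omega Th p, Yh Omega fe Th T &
   forall v q S, Xh Omega fe Th v -> Mh Omega Th q -> Yh Omega fe Th S ->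
   [/\ \int[lebesgue_rV d]_(x in Omega)
         (nu (T x) * mdot (gradv Omega u x) (gradv Omega v x)
          + mdot (u x) (v x))
       + a_SN u u v
       + \int[lebesgue_rV d]_(x in Omega)
           (mnorm (u x) `^ (s - 2) * mdot (u x) (v x))
       - \int[lebesgue_rV d]_(x in Omega) (p x * divergence Omega v x) = f v,
       \int[lebesgue_rV d]_(x in Omega) (q x * divergence Omega u x) = 0 &
       \int[lebesgue_rV d]_(x in Omega)
         (kappa (T x) * mdot (grad Omega T x) (grad Omega S x))
       + a_ST u T S = g S]].

Definition convection_bound (C : R) : Prop :=
  forall u v w, H10v Omega u -> H10v Omega v -> H10v Omega w ->
    `|a_N u v w| <=
    C * gradv_norm Omega u * gradv_norm Omega v * gradv_norm Omega w.

(* The inequality holds in the extended reals, so it contains the fact that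
   v is in L^r. *)
Definition embedding_bound (r C : R) : Prop :=
  forall v, H10v Omega v ->
    (Lp_norm Omega r (fun x => mnorm (v x)) <= (C * gradv_norm Omega v)%:E)%E.

Definition best_embedding_constant (r C : R) : Prop :=
  embedding_bound r C /\ forall C', embedding_bound r C' -> C <= C'.

Definition Lambda (s num nup C_N C_2 C_s normf : R) : R :=
  1 + nup * num^-1 + C_N * num ^- 2 * normf + C_2 ^+ 2 * num^-1
  + C_s `^ s * num `^ (1 - s) * normf `^ (s - 2).

End coupled_problem.

(* Main.v *)
Require Import Defs.
From mathcomp Require Import all_boot all_order all_algebra.
From mathcomp Require Import all_classical all_reals all_analysis.
From mathcomp Require Import measurable_realfun ring lra.

Set Implicit Arguments.
Unset Strict Implicit.
Unset Printing Implicit Defensive.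

Import Order.TTheory GRing.Theory Num.Theory.
Import numFieldNormedType.Exports.

Local Open Scope classical_set_scope.
Local Open Scope ring_scope.

(** The discrete spaces are finite-dimensional, so a solution is a common zero of
finitely many continuous functions of finitely many coefficients; a sign
condition on a sphere produces it.

_Existence._  Test the momentum equation only with the velocities of X_h that
satisfy the discrete divergence constraint: the pressure disappears, and what
remains is a residual in (u, T), tested with pairs (v, S).  Tested with (u, T)
itself, this residual is at least
  num |grad u|^2 + kappam |grad T|^2 - f u - g T,
because the convective forms a_SN and a_ST are skew-symmetric by construction,
whatever the divergence of u, and the zeroth order and power terms are
nonnegative.  Hence it is nonnegative on a large sphere, and it vanishes
somewhere by [acute_angle_zero], a form of the Brouwer fixed point theorem,
transported to a space with a possibly degenerate inner product by [galerkin].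
The pressure is then recovered by linear algebra: the residual of the momentum
equation is a functional on X_h that vanishes on the kernel of the divergence
constraint, so that some p in M_h represents it ([lagrange_multiplier]).

_Bounds._  The same energy identity, for any solution, bounds grad u and grad T
([velocity_bound], [temperature_bound]).  For the pressure, the momentum equation
expresses the integral of p div v as the sum of the other terms, each of which is
at most a constant times |grad v| ([velocity_form_bound]: Cauchy-Schwarz, the
convection bound, Hoelder and the embeddings); the inf-sup condition turns this
into a bound of p, and once the bound of grad u is inserted the constants add up
to Lambda f |f| ([velocity_constant_bound]).

_Brouwer._  The fixed point theorem is used in the form of the Poincare-Miranda
theorem.  Its discrete version, on a subdivided cube, is proved with cochains
mod 2: the n-fold cup product of the coboundaries of the n colourings has
integral one over the cube, by the Stokes formula and induction on n, so that
some cell of the grid sees both colours of each colouring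
([discrete_poincare_miranda]).

_Analysis._  Functions are representatives, and the weak gradient is a chosen
one, hence linear only almost everywhere.  This rests on the uniqueness of weak
derivatives, that is, on the fundamental lemma of the calculus of variations
([fundamental_lemma]), for which products of functions exp (- 1 / t) of the
coordinates are the test functions.  The bilinear forms are then linear on sets of
representatives, with null vectors, and this is the setting of the abstract part.
The residual depends continuously on the coefficients by dominated convergence
([continuous_Rintegral]). *)

(** * Balls and cubes of row vectors *)

Section coordinates.
Context {R : realType} {d : nat}.
Implicit Types x y : 'rV[R]_d.

Lemma rV_ball x y e : 0 < e -> (forall j, `|x ord0 j - y ord0 j| < e) -> ball x e y.
Proof.
move=> e0 xy; rewrite -ball_normE /=; change (mx_norm (x - y) < e).
rewrite mx_normrE; apply: bigmax_lt => // -[k l] _ /=.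
by rewrite ord1 mxE [(- y) _ _]mxE.
Qed.

Lemma le_coord x i : `|x ord0 i| <= `|x|.
Proof.
change (`|x ord0 i| <= mx_norm x); rewrite mx_normrE.
exact: (@le_bigmax _ _ _ 0 (fun ij : 'I_1 * 'I_d => `|x ij.1 ij.2|) (ord0, i)).
Qed.

Lemma rV_cube_compact (a b : 'I_d -> R) :
  compact [set x : 'rV[R]_d | forall i, a i <= x ord0 i <= b i].
Proof.
have -> : [set x : 'rV[R]_d | forall i, a i <= x ord0 i <= b i] =
    [set x | forall i, `[a i, b i]%classic (x ord0 i)].
  by apply/seteqP; split=> x /= h i; have := h i; rewrite in_itv.
by apply: (@rV_compact _ _ (fun i => `[a i, b i]%classic)) => i; exact: segment_compact.
Qed.

End coordinates.

(** * Mod 2 cochains and the discrete Poincare-Miranda theorem *)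

Section cochains.
Variable V : Type.
Implicit Types (w : seq V -> bool) (s : seq V).

(** A cochain mod 2 is a boolean function of ordered simplices, given by the
sequence of their vertices.  The recursion is on the first vertex: either it is
the one that is dropped, or it is kept and another one is dropped. *)
Fixpoint coboundary w s : bool :=
  if s is v :: s' then w s' (+) coboundary (fun t => w (v :: t)) s' else false.

(** The prism operator of singular homology, for two maps a and b of vertices: the
sum of w over the simplices a v_0, .., a v_i, b v_i, .., b v_k. *)
Fixpoint prism (a b : V -> V) w s : bool :=
  if s is v :: s' then
    w (a v :: map b (v :: s')) (+) prism a b (fun t => w (a v :: t)) s'
  else false.

Lemma eq_coboundary w w' s : w =1 w' -> coboundary w s = coboundary w' s.
Proof.
elim: s w w' => //= v s IH w w' e; rewrite e; congr addb.
by apply: IH => t; rewrite e.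
Qed.

Lemma coboundaryD w w' s :
  coboundary (fun t => w t (+) w' t) s = coboundary w s (+) coboundary w' s.
Proof.
elim: s w w' => //= v s IH w w'.
by rewrite (IH (fun t => w (v :: t)) (fun t => w' (v :: t))) addbACA.
Qed.

Lemma prismD a b w w' s :
  prism a b (fun t => w t (+) w' t) s = prism a b w s (+) prism a b w' s.
Proof.
elim: s w w' => //= v s IH w w'.
by rewrite (IH (fun t => w (a v :: t)) (fun t => w' (a v :: t))) addbACA.
Qed.

Lemma eq_prism a b w w' s : w =1 w' -> prism a b w s = prism a b w' s.
Proof.
elim: s w w' => //= v s IH w w' e; rewrite e; congr addb.
by apply: IH => t; rewrite e.
Qed.

Lemma coboundary_map (a : V -> V) w s :
  coboundary (fun t => w (map a t)) s = coboundary w (map a s).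
Proof.
elim: s w => //= v s IH w; congr addb.
by rewrite (IH (fun t => w (a v :: t))).
Qed.

(** The prism operator is a chain homotopy from a to b: in the boundary of the
prism the inner faces cancel in pairs, which leaves the two ends and the prism
over the boundary. *)
Lemma prism_coboundary a b w s :
  prism a b (coboundary w) s =
  coboundary (prism a b w) s (+) (w (map a s) (+) w (map b s)).
Proof.
elim: s w => /= [|v s IH] w; first by rewrite addbb.
rewrite prismD IH coboundaryD.
rewrite (coboundary_map b (fun t => w (a v :: b v :: t))).
set A := w (map b s); set B := coboundary _ (map b s).
set C := coboundary (prism _ _ _) s.
by move: (w _) (w _) (prism a b w s) (w _) A B C; do 7 case.
Qed.

(** The prism operator is local: it only evaluates w on vertices of the form a u
and b u. *)
Lemma prism_eq0 a b (Q : pred V) w s : (forall t, all Q t -> w t = false) ->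
  all (fun u => Q (a u) && Q (b u)) s -> prism a b w s = false.
Proof.
elim: s w => //= v s IH w w0 /andP[/andP[Qa Qb] Qs].
rewrite w0 ?IH//= ?Qa ?Qb ?all_map.
  by move=> t Qt; rewrite w0//= Qa.
by apply: sub_all Qs => u /andP[].
Qed.

Lemma coboundary0 s : coboundary (fun=> false) s = false.
Proof. by elim: s. Qed.

Lemma coboundaryK w s : coboundary (coboundary w) s = false.
Proof.
elim: s w => //= v s IH w.
by rewrite coboundaryD IH addbF addbb.
Qed.

Lemma coboundary_andb c w s :
  coboundary (fun t => c && w t) s = c && coboundary w s.
Proof. by case: c => //=; rewrite coboundary0. Qed.

Section cup.
Variable chi : nat -> V -> bool.

(** The cup product of the coboundaries of chi (n-1), .., chi 0, seen as 0-cochains: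
the product of the differences of chi along the edges of the simplex. *)
Fixpoint cup n s : bool :=
  match n, s with
  | 0, _ => size s == 1%N
  | m.+1, v :: (u :: _) as s' => (chi m v (+) chi m u) && cup m s'
  | _, _ => false
  end.

Definition cup_primitive n s : bool :=
  if s is v :: _ then chi n v && cup n s else false.

(** By the Leibniz rule a product of coboundaries is a cocycle, and replacing the
first factor by its primitive chi n gives a primitive of the product. *)
Lemma coboundary_cup n s :
  coboundary (cup n) s = false /\ coboundary (cup_primitive n) s = cup n.+1 s.
Proof.
have prim m t : coboundary (cup m) t = false ->
    coboundary (cup_primitive m) t = cup m.+1 t.
  case: t => [|v t] //= dc; rewrite coboundary_andb.
  have -> : coboundary (fun r => cup m (v :: r)) t = cup m t.
    by move: dc; case: (cup m t) (coboundary _ t) => -[].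
  case: t {dc} => [|u t] /=; last by rewrite -andb_addl addbC.
  by case: m => [|m]; rewrite andbF.
suff closed m t : coboundary (cup m) t = false by split; [|apply: prim].
elim: m t => [|m IH] t.
  case: t => [|a [|b [|c t]]]//=.
  by rewrite (eq_coboundary (w' := fun=> false)) ?coboundary0.
have : coboundary (coboundary (cup_primitive m)) t = false by exact: coboundaryK.
by rewrite (eq_coboundary (w' := cup m.+1))// => r; exact: prim.
Qed.

End cup.

Lemma cup_map chi (a : V -> V) n s :
  cup chi n (map a s) = cup (fun j v => chi j (a v)) n s.
Proof.
elim: n s => [|n IH] s /=; first by rewrite size_map.
by case: s => [|v [|u s]]//=; rewrite -(IH (u :: s)).
Qed.

Lemma cup_const chi n s j c : (j < n)%N -> all (fun v => chi j v == c) s ->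
  cup chi n s = false.
Proof.
elim: n s => // n IH [|v [|u s]]//=.
rewrite ltnS leq_eqVlt => /predU1P[->|jn] /andP[/eqP cv].
  by move=> /andP[/eqP ->]; rewrite cv addbb.
by move=> h; rewrite (IH (u :: s) jn h) andbF.
Qed.

End cochains.

Section grid.
Variable p : nat.
Implicit Types (v : nat -> nat) (s : seq (nat -> nat)) (w : seq (nat -> nat) -> bool).

Definition set_coord n k v : nat -> nat := fun i => if i == n then k else v i.

(** The integral of an n-cochain over the cube of side p in dimension n: the n-fold
prism over the unit segments of the axes triangulates each unit cube by its n!
monotone paths. *)
Fixpoint grid_sum n w : bool :=
  if n is m.+1 then
    \big[addb/false]_(k < p) grid_sum m (prism (set_coord m k) (set_coord m k.+1) w)
  else w [:: fun=> 0%N].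

Lemma eq_grid_sum n w w' : w =1 w' -> grid_sum n w = grid_sum n w'.
Proof.
elim: n w w' => /= [|n IH] w w' e; first by rewrite e.
by apply: eq_bigr => k _; apply: IH => s; exact: eq_prism.
Qed.

Lemma grid_sumD n w w' :
  grid_sum n (fun s => w s (+) w' s) = grid_sum n w (+) grid_sum n w'.
Proof.
elim: n w w' => //= n IH w w'.
rewrite -big_split /=; apply: eq_bigr => k _; rewrite -IH.
by apply: eq_grid_sum => s; exact: prismD.
Qed.

(** The Stokes formula in the direction of the last axis: the contributions of the
consecutive slabs telescope to those of the two opposite faces. *)
Lemma grid_sum_coboundaryS n w :
  grid_sum n.+1 (coboundary w) =
  \big[addb/false]_(k < p) grid_sum n
     (coboundary (prism (set_coord n k) (set_coord n k.+1) w)) (+)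
  (grid_sum n (fun s => w (map (set_coord n 0) s)) (+)
   grid_sum n (fun s => w (map (set_coord n p) s))).
Proof.
pose f k := grid_sum n (fun s => w (map (set_coord n k) s)).
have tel m : \big[addb/false]_(k < m) (f k (+) f k.+1) = f 0%N (+) f m.
  elim: m => [|m IH]; first by rewrite big_ord0 addbb.
  by rewrite big_ord_recr /= IH -addbA addKb.
rewrite /= -[X in _ (+) X](tel p) -big_split; apply: eq_bigr => k _.
rewrite /f /= -grid_sumD -grid_sumD; apply: eq_grid_sum => s; exact: prism_coboundary.
Qed.

(** Each simplex of the triangulation lies in one cell of the grid, here the cell
of lowest corner c. *)
Lemma grid_sum_eq0 n w :
  (forall c t, (forall i, (i < n)%N -> (c i < p)%N) ->
     all (fun v => all (fun i => c i <= v i <= (c i).+1)%N (iota 0 n)) t ->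
     w t = false) ->
  grid_sum n w = false.
Proof.
elim: n w => [|n IH] w w0 /=; first by apply: (w0 (fun=> 0%N)).
rewrite big1// => k _; apply: IH => c t cp tc.
pose c' := set_coord n k c.
apply: (@prism_eq0 _ _ _
  (fun v => all (fun i => c' i <= v i <= (c' i).+1)%N (iota 0 n.+1))).
  move=> r; apply: w0 => i; rewrite /c' /set_coord.
  by rewrite ltnS leq_eqVlt => /predU1P[->|ni]; rewrite ?eqxx ?(ltn_eqF ni)// cp.
apply: sub_all tc => u uc; rewrite -addn1 iotaD !all_cat /= /c' /set_coord eqxx.
rewrite !leqnn !leqnSn /= !andbT.
have e m i : i \in iota 0 n -> set_coord n m u i = u i /\ c' i = c i.
  by rewrite mem_iota /c' /set_coord => /andP[_ /= i_n]; rewrite !(ltn_eqF i_n).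
apply/andP; split; apply/allP => i i_n; have /allP/(_ i i_n) := uc.
  by have := e k i i_n; rewrite /c' /set_coord => -[-> ->].
by have := e k.+1 i i_n; rewrite /c' /set_coord => -[-> ->].
Qed.

(** The full Stokes formula, for a cochain that vanishes on the boundary of the
cube. *)
Lemma grid_sum_coboundary_eq0 n w : w [::] = false ->
  (forall s j k, (j < n)%N -> k = 0%N \/ k = p -> all (fun v => v j == k) s ->
     w s = false) ->
  grid_sum n (coboundary w) = false.
Proof.
elim: n w => [|n IH] w w0 side; first by rewrite /= w0.
rewrite grid_sum_coboundaryS.
rewrite (@eq_grid_sum n _ (fun=> false)); last first.
  move=> s; apply: (side _ n 0%N) => //; first by left.
  by rewrite all_map; apply/allP => v _ /=; rewrite /set_coord eqxx.
rewrite [grid_sum n (fun s => w (map (set_coord n p) s))](@eq_grid_sum n _ (fun=> false)); last first.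
  move=> s; apply: (side _ n p) => //; first by right.
  by rewrite all_map; apply/allP => v _ /=; rewrite /set_coord eqxx.
rewrite addbb addbF big1// => k _; apply: IH => // s j m jn m0p sm.
apply: (@prism_eq0 _ _ _ (fun v => v j == m)).
  by move=> t; apply: side => //; exact: ltnW.
by rewrite /set_coord (ltn_eqF jn); apply: sub_all sm => u /= ->.
Qed.

(** By the Stokes formula for the primitive with first factor chi n, only the two
faces orthogonal to axis n contribute: on the others some chi j is constant.  On
the lower one chi n is zero, and on the upper one it is one, which leaves the cup
product in dimension n. *)
Lemma grid_sum_cup n (chi : nat -> (nat -> nat) -> bool) :
  (forall j v, (j < n)%N -> v j = 0%N -> chi j v = false) ->
  (forall j v, (j < n)%N -> v j = p -> chi j v = true) ->
  grid_sum n (cup chi n) = true.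
Proof.
elim: n chi => // n IH chi chi0 chip.
rewrite -(@eq_grid_sum n.+1 (coboundary (cup_primitive chi n))); last first.
  by move=> s; have [] := coboundary_cup chi n s.
rewrite grid_sum_coboundaryS big1 => [|k _]; last first.
  apply: grid_sum_coboundary_eq0 => // s j m jn m0p sm.
  apply: (@prism_eq0 _ _ _ (fun v => v j == m)) => [[|v t] // tm|]; last first.
    by rewrite /set_coord (ltn_eqF jn); apply: sub_all sm => u /= ->.
  have [c chic] : exists c, forall u, u j = m -> chi j u = c.
    have jn' : (j < n.+1)%N by exact: ltnW.
    case: m0p => ->; first by exists false => u; exact: chi0.
    by exists true => u; exact: chip.
  rewrite /cup_primitive (@cup_const _ chi _ _ j c)// ?andbF//.
  by apply: sub_all tm => u /eqP um; rewrite chic.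
rewrite (@eq_grid_sum n _ (fun=> false)); last first.
  by case=> // v s /=; rewrite chi0// /set_coord eqxx.
rewrite grid_sum_eq0// !addFb -[RHS](IH (fun j v => chi j (set_coord n p v))).
- apply: eq_grid_sum => s; rewrite -cup_map; case: s => [|v s]; last first.
    by rewrite /= chip// /set_coord eqxx.
  by case: (n).
- move=> j v jn v0; apply: chi0; first exact: ltnW.
  by rewrite /set_coord (ltn_eqF jn).
- move=> j v jn v0; apply: chip; first exact: ltnW.
  by rewrite /set_coord (ltn_eqF jn).
Qed.

Lemma cup_neq (chi : nat -> (nat -> nat) -> bool) n s (Q : pred (nat -> nat)) :
  cup chi n s -> all Q s -> forall j, (j < n)%N -> exists a b,
    [/\ Q a, Q b, chi j a = false & chi j b = true].
Proof.
elim: n s => // n IH [|v [|u s]]//= /andP[vu us] /and3P[Qv Qu Qs] j.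
rewrite ltnS leq_eqVlt => /predU1P[->|jn]; last by apply: (IH (u :: s)) => //=; rewrite Qu.
by move: vu; case E: (chi n v); case F: (chi n u) => // _; [exists u, v|exists v, u].
Qed.

(** The integral of the cup product is one, so it is nonzero on a simplex of some
cell; along that simplex every chi j takes both values. *)
Theorem discrete_poincare_miranda n (chi : nat -> (nat -> nat) -> bool) :
  (forall j v, (j < n)%N -> v j = 0%N -> chi j v = false) ->
  (forall j v, (j < n)%N -> v j = p -> chi j v = true) ->
  exists2 c : nat -> nat, forall i, (i < n)%N -> (c i < p)%N &
    forall j, (j < n)%N -> exists a b : nat -> nat,
    [/\ forall i, (i < n)%N -> (c i <= a i <= (c i).+1)%N,
        forall i, (i < n)%N -> (c i <= b i <= (c i).+1)%N,
        chi j a = false & chi j b = true].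
Proof.
move=> chi0 chip; apply: contrapT => nex.
have := grid_sum_cup chi0 chip; rewrite grid_sum_eq0// => c t cp ct.
apply/negbTE/negP => wt; apply: nex; exists c => // j jn.
have [a [b [Qa Qb chia chib]]] := cup_neq wt ct jn.
by exists a, b; split=> // i i_n; [move/allP: Qa|move/allP: Qb];
   apply; rewrite mem_iota.
Qed.

End grid.

(** * The Poincare-Miranda theorem and the acute angle lemma *)

Section poincare_miranda.
Variable R : realType.

(** Colour the points of a grid of mesh 2 r / (m + 1) by the sign of the components
of f, forcing the colour on the faces.  The cells in which all components change
sign accumulate somewhere by compactness, and there f is zero by continuity. *)
Lemma poincare_miranda n (f : 'rV[R]_n -> 'rV[R]_n) (r : R) : 0 < r ->
  continuous f ->
  (forall (x : 'rV[R]_n) i, (forall j, `|x ord0 j| <= r) -> x ord0 i = - r -> f x ord0 i <= 0) ->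
  (forall (x : 'rV[R]_n) i, (forall j, `|x ord0 j| <= r) -> x ord0 i = r -> 0 <= f x ord0 i) ->
  exists2 x : 'rV[R]_n, forall j, `|x ord0 j| <= r & f x = 0.
Proof.
case: n f => [|n] f r0 cf fN fp.
  by exists 0; [case|apply/rowP; case].
pose pt m (v : nat -> nat) : 'rV[R]_n.+1 :=
  \row_i (- r + 2 * r * ((v i)%:R / m.+1%:R)).
have pt_cube m v : (forall i, (i < n.+1)%N -> (v i <= m.+1)%N) ->
    forall j, `|pt m v ord0 j| <= r.
  move=> vm j; rewrite mxE.
  have q0 : 0 <= (v j)%:R / m.+1%:R :> R by rewrite divr_ge0.
  have q1 : (v j)%:R / m.+1%:R <= 1 :> R.
    by rewrite ler_pdivrMr// mul1r ler_nat vm.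
  move: (_ / _) q0 q1 => q q0 q1.
  have rq0 : 0 <= r * q by rewrite mulr_ge0// ltW.
  have rq1 : r * q <= r by rewrite ler_piMr// ltW.
  by rewrite ler_norml -mulrA; apply/andP; split; lra.
(* The two comparisons force the colours on the faces, where the sign of f is
   known only up to zero. *)
pose chi m j v := (v j != 0%N) && ((v j == m.+1) || (0 < f (pt m v) ord0 (inord j))).
have grid m : exists2 c : nat -> nat, forall i, (i < n.+1)%N -> (c i < m.+1)%N &
    forall j, (j < n.+1)%N -> exists a b : nat -> nat,
    [/\ forall i, (i < n.+1)%N -> (c i <= a i <= (c i).+1)%N,
        forall i, (i < n.+1)%N -> (c i <= b i <= (c i).+1)%N,
        chi m j a = false & chi m j b = true].
  by apply: discrete_poincare_miranda => j v _ vj; rewrite /chi vj ?eqxx.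
have /choice [c cP] : forall m, exists c : nat -> nat,
   (forall i, (i < n.+1)%N -> (c i < m.+1)%N) /\
    forall j : 'I_n.+1, exists a b : 'rV[R]_n.+1,
    [/\ forall i, `|a ord0 i - pt m c ord0 i| <= 2 * r / m.+1%:R,
        forall i, `|b ord0 i - pt m c ord0 i| <= 2 * r / m.+1%:R,
        f a ord0 j <= 0 & 0 <= f b ord0 j].
  move=> m; have [c cm cP] := grid m; exists c; split=> // j.
  have [a [b [ca cb]]] := cP j (ltn_ord j).
  have close (v : nat -> nat) : (forall i, (i < n.+1)%N -> (c i <= v i <= (c i).+1)%N) ->
      forall i, `|pt m v ord0 i - pt m c ord0 i| <= 2 * r / m.+1%:R.
    move=> cv i; rewrite !mxE opprD addrACA subrr add0r -mulrBr -mulrBl.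
    have /andP[cv1 cv2] := cv i (ltn_ord i).
    rewrite normrM [`|2 * r|]ger0_norm; last by lra.
    rewrite ler_pM2l; last by lra.
    rewrite normrM [X in _ * X]ger0_norm// ler_piMl// -natrB//.
    by rewrite normr_nat lern1 leq_subLR addn1.
  have incube (v : nat -> nat) : (forall i, (i < n.+1)%N -> (c i <= v i <= (c i).+1)%N) ->
      forall i, `|pt m v ord0 i| <= r.
    by move=> cv; apply: pt_cube => i i_n; have /andP[_ /leq_trans] := cv i i_n; apply; exact: cm.
  rewrite /chi inord_val => ha hb; exists (pt m a), (pt m b); split.
  - exact: close.
  - exact: close.
  - have [a0|a0] := eqVneq (a j) 0%N.
      by apply: fN; [exact: incube|rewrite mxE a0 mul0r mulr0 addr0].
    by move: ha; rewrite a0 /= => /negbT; rewrite negb_or -leNgt => /andP[].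
  - move: hb => /andP[_ /orP[/eqP bm|/ltW//]].
    apply: fp; first exact: incube.
    by rewrite mxE bm divff// mulr1; ring.
have cpt := @rV_cube_compact R n.+1 (fun=> - r) (fun=> r).
pose x_ m := pt m (c m).
have xcube m j : `|x_ m ord0 j| <= r.
  by apply: pt_cube => i i_n; apply: ltnW; have [+ _] := cP m; apply.
have PF : ProperFilter (x_ @ \oo) by exact: fmap_proper_filter.
have [|x [xK xcl]] := cpt _ PF.
  by exists 0%N => // m _ i /=; rewrite -ler_norml.
have xr j : `|x ord0 j| <= r by have := xK j; rewrite /= -ler_norml.
exists x => //; apply/rowP => i; rewrite mxE; apply: contrapT => /eqP fxi0.
have fi : (fun y => f y ord0 i) @ x --> f x ord0 i.
  apply: (@continuous_comp _ _ _ f (fun y : 'rV_n.+1 => y ord0 i)); first exact: cf.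
  exact: coord_continuous.
have fx0 : 0 < `|f x ord0 i| by rewrite normr_gt0.
have /nbhs_ballP[e /= e0 xe] :
    \forall y \near x, `|f x ord0 i - f y ord0 i| < `|f x ord0 i|.
  by move/cvgrPdist_lt : fi; apply.
have mlim : \forall m \near \oo, 2 * r / m.+1%:R < e / 2.
  near=> m; rewrite ltr_pdivrMr// -ltr_pdivrMl; last by lra.
  rewrite (le_lt_trans (ler_norm _))//.
  apply: lt_le_trans (_ : m%:R <= _); last by rewrite ler_nat.
  by near: m; exact: nbhs_infty_gtr.
have [_ [[m /= me <-] xm]] :
    (x_ @` [set m | 2 * r / m.+1%:R < e / 2]) `&` ball x (e / 2) !=set0.
  apply: xcl; last by apply: nbhsx_ballx; rewrite divr_gt0.
  by apply: filterS mlim => m me; exists m.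
have [_ /(_ i)[a [b [am bm fa fb]]]] := cP m.
have near_ (y : 'rV_n.+1) :
    (forall k, `|y ord0 k - x_ m ord0 k| <= 2 * r / m.+1%:R) -> ball x e y.
  move=> ym; rewrite (splitr e); apply: ball_triangle xm _.
  apply: rV_ball => [|k]; first by rewrite divr_gt0.
  by rewrite distrC; exact: le_lt_trans (ym k) me.
have := xe _ (near_ _ am); have := xe _ (near_ _ bm); rewrite /= !ltr_distl.
by case: (ltrgt0P (f x ord0 i)) fxi0 => // _ _ /andP[? ?] /andP[? ?]; lra.
Unshelve. all: by end_near. Qed.

End poincare_miranda.

Lemma cvg_sum (R : realType) (V : normedModType R) (I : Type) (T : Type)
    (F : set_system T) {FF : Filter F} (r : seq I) (P : pred I)
    (f : I -> T -> V) (l : I -> V) :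
  (forall i, P i -> f i x @[x --> F] --> l i) ->
  (\sum_(i <- r | P i) f i x) @[x --> F] --> \sum_(i <- r | P i) l i.
Proof. by move=> fl; apply: cvg_big => //; exact: add_continuous. Qed.

Section acute_angle.
Variable R : realType.

Lemma mdotC m n (A B : 'M[R]_(m, n)) : mdot A B = mdot B A.
Proof. by apply: eq_bigr => i _; apply: eq_bigr => j _; rewrite mulrC. Qed.

Lemma mdotDl m n (A B C : 'M[R]_(m, n)) : mdot (A + B) C = mdot A C + mdot B C.
Proof.
rewrite /mdot -big_split; apply: eq_bigr => i _; rewrite -big_split.
by apply: eq_bigr => j _; rewrite mxE mulrDl.
Qed.

Lemma mdotZl m n a (A B : 'M[R]_(m, n)) : mdot (a *: A) B = a * mdot A B.
Proof.
rewrite /mdot mulr_sumr; apply: eq_bigr => i _; rewrite mulr_sumr.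
by apply: eq_bigr => j _; rewrite mxE mulrA.
Qed.

Lemma mdotDr m n (A B C : 'M[R]_(m, n)) : mdot C (A + B) = mdot C A + mdot C B.
Proof. by rewrite mdotC mdotDl !(mdotC C). Qed.

Lemma mdotZr m n a (A B : 'M[R]_(m, n)) : mdot A (a *: B) = a * mdot A B.
Proof. by rewrite mdotC mdotZl mdotC. Qed.

Lemma mdot_ge0 m n (A : 'M[R]_(m, n)) : 0 <= mdot A A.
Proof. by apply: sumr_ge0 => i _; apply: sumr_ge0 => j _; rewrite -expr2 sqr_ge0. Qed.

Lemma mdot_eq0 m n (A : 'M[R]_(m, n)) : mdot A A = 0 -> A = 0.
Proof.
move=> A0; apply/matrixP => i j; rewrite mxE; apply/eqP; rewrite -sqrf_eq0 expr2.
have h k : 0 <= \sum_j A k j * A k j.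
  by apply: sumr_ge0 => l _; rewrite -expr2 sqr_ge0.
move/eqP: A0; rewrite psumr_eq0// => /allP/(_ i (mem_index_enum _))/=.
rewrite psumr_eq0; last by move=> l _; rewrite -expr2 sqr_ge0.
by move=> /allP/(_ j (mem_index_enum _)).
Qed.

Lemma mnorm_ge0 m n (A : 'M[R]_(m, n)) : 0 <= mnorm A.
Proof. exact: sqrtr_ge0. Qed.

Lemma sqr_mnorm m n (A : 'M[R]_(m, n)) : mnorm A ^+ 2 = mdot A A.
Proof. by rewrite sqr_sqrtr// mdot_ge0. Qed.

Lemma mnorm_continuous m n : continuous (@mnorm R m n).
Proof.
move=> A; apply: (@continuous_comp _ _ _ (fun A => mdot A A) Num.sqrt); last first.
  exact: sqrt_continuous.
apply: (@cvg_sum _ _ _ _ (nbhs A)) => i _; apply: (@cvg_sum _ _ _ _ (nbhs A)) => j _.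
by apply: cvgM; apply: coord_continuous.
Qed.

(** If F had no zero, its normalization G, of length rho, would be continuous, and
x + G x would satisfy the sign conditions on the faces of the cube of half side
rho.  A zero of x + G x has length rho, and there F x points towards - x. *)
Theorem acute_angle_zero n (F : 'rV[R]_n -> 'rV[R]_n) (rho : R) : 0 < rho ->
  continuous F -> (forall x, mdot x x = rho ^+ 2 -> 0 <= mdot (F x) x) ->
  exists x, F x = 0.
Proof.
move=> rho0 cF Fx; apply: contrapT => nz.
have Fn0 x : 0 < mdot (F x) (F x).
  rewrite lt_neqAle mdot_ge0 andbT eq_sym; apply/negP => /eqP /mdot_eq0 F0.
  by apply: nz; exists x.
have Nn0 x : 0 < mnorm (F x) by rewrite sqrtr_gt0.
pose G x := (rho / mnorm (F x)) *: F x.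
have GG x : mdot (G x) (G x) = rho ^+ 2.
  rewrite /G mdotZl mdotZr -sqr_mnorm; field.
  by rewrite gt_eqF.
have Gr x i : `|G x ord0 i| <= rho.
  rewrite -(@ler_pXn2r _ 2)// ?nnegrE ?(ltW rho0)// real_normK ?num_real//.
  rewrite -(GG x) /mdot big_ord1 (bigD1 i)//= -expr2 lerDl.
  by apply: sumr_ge0 => j _; rewrite -expr2 sqr_ge0.
have cG : continuous G.
  move=> x; have cN : (fun y => rho / mnorm (F y)) @ x --> rho / mnorm (F x).
    have cNF : (fun y => mnorm (F y)) @ x --> mnorm (F x).
      apply: (@continuous_comp _ _ _ F (@mnorm R 1 n)); first exact: cF.
      exact: mnorm_continuous.
    have N0 : mnorm (F x) != 0 by rewrite gt_eqF.
    exact: (cvgM (@cvg_cst _ rho _ (nbhs x) _) (cvgV N0 cNF)).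
  exact: (cvgZ cN (cF x)).
have cG1 : continuous (fun x : 'rV[R]_n => x + G x : 'rV[R]_n).
  by move=> x; apply: (@cvgD _ _ _ (nbhs x) _ id G); [exact: cvg_id|exact: cG].
have [||x _ /eqP] := poincare_miranda rho0 cG1.
- move=> x i _ xi; rewrite mxE xi.
  by have := Gr x i; rewrite ler_norml => /andP[_]; lra.
- move=> x i _ xi; rewrite mxE xi.
  by have := Gr x i; rewrite ler_norml => /andP[+ _]; lra.
rewrite addr_eq0 => /eqP xG.
have xx : mdot x x = rho ^+ 2.
  by rewrite xG -scaleN1r mdotZl mdotZr !mulN1r opprK.
have := Fx x xx; rewrite [X in mdot _ X]xG -scaleN1r mdotZr mdotZr mulN1r oppr_ge0.
by rewrite leNgt mulr_gt0// divr_gt0.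
Qed.

End acute_angle.

(** * Subspaces with a degenerate inner product, and Galerkin's method *)

Section subspaces.
Variables (R : realType) (U : lmodType R).
Implicit Types (V : set U) (f : U -> R) (a : U -> U -> R).

Definition is_subspace V :=
  V 0 /\ forall (k : R) u v, V u -> V v -> V (k *: u + v).

Definition linear_on V f :=
  forall (k : R) u v, V u -> V v -> f (k *: u + v) = k * f u + f v.

(** Only on V are the forms of interest linear: elsewhere the integrals that define
them may diverge. *)
Definition semi_inner V a := [/\ forall u v, V u -> V v -> a u v = a v u,
  forall u, V u -> linear_on V (a u) & forall u, V u -> 0 <= a u u].

(** V modulo the null vectors of a has finite dimension.  A linear relation between
the coordinates phi holds between the vectors up to a null vector; the coordinates
themselves are chosen vector by vector and need not be linear. *)
Definition fin_dim V a := exists N (phi : U -> 'rV[R]_N),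
  forall n (v : 'I_n -> U) (c : 'I_n -> R), (forall i, V (v i)) ->
    \sum_i c i *: phi (v i) = 0 ->
    a (\sum_i c i *: v i) (\sum_i c i *: v i) = 0.

Lemma subspace_sum V n (v : 'I_n -> U) (c : 'I_n -> R) :
  is_subspace V -> (forall i, V (v i)) -> V (\sum_i c i *: v i).
Proof.
move=> [V0 VP] Vv; apply: (big_ind V) => //.
  by move=> x y Vx Vy; rewrite -[x]scale1r; exact: VP.
by move=> i _; rewrite -[_ *: _]addr0; exact: VP.
Qed.

Lemma subspaceB V u v : is_subspace V -> V u -> V v -> V (u - v).
Proof. by move=> [_ VP] Vu Vv; rewrite addrC -scaleN1r; exact: VP. Qed.

Lemma subspaceZ V k u : is_subspace V -> V u -> V (k *: u).
Proof. by move=> [V0 VP] Vu; rewrite -[_ *: _]addr0; exact: VP. Qed.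

Section linear_on_theory.
Variables (V : set U) (f : U -> R).
Hypotheses (sV : is_subspace V) (lf : linear_on V f).

Lemma linear_on0 : f 0 = 0.
Proof.
have [V0 _] := sV; have := lf 1 V0 V0; rewrite scale1r addr0 mul1r => /eqP.
by rewrite -subr_eq subrr eq_sym => /eqP.
Qed.

Lemma linear_onD u v : V u -> V v -> f (u + v) = f u + f v.
Proof. by move=> Vu Vv; rewrite -[u in LHS]scale1r lf// mul1r. Qed.

Lemma linear_onZ k u : V u -> f (k *: u) = k * f u.
Proof.
by move=> Vu; rewrite -[_ *: _]addr0 lf ?linear_on0 ?addr0//; have [] := sV.
Qed.

Lemma linear_onB u v : V u -> V v -> f (u - v) = f u - f v.
Proof. by move=> Vu Vv; rewrite addrC -scaleN1r lf// mulN1r addrC. Qed.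

Lemma linear_on_sum n (v : 'I_n -> U) (c : 'I_n -> R) :
  (forall i, V (v i)) -> f (\sum_i c i *: v i) = \sum_i c i * f (v i).
Proof.
elim: n v c => [|n IH] v c Vv; first by rewrite !big_ord0 linear_on0.
rewrite !big_ord_recl lf// ?IH//.
exact: subspace_sum.
Qed.

End linear_on_theory.

Section orthonormal.
Variables (V : set U) (a : U -> U -> R).
Hypotheses (sV : is_subspace V) (ia : semi_inner V a).

Definition orthonormal n (v : 'I_n -> U) :=
  (forall i, V (v i)) /\ forall i j, a (v i) (v j) = (i == j)%:R.

Lemma semi_inner_sum n (v : 'I_n -> U) c w : (forall i, V (v i)) -> V w ->
  a (\sum_i c i *: v i) w = \sum_i c i * a (v i) w.
Proof.
have [asym alin _] := ia; move=> Vv Vw.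
rewrite asym//; last exact: subspace_sum.
rewrite (linear_on_sum sV (alin w Vw))//.
by apply: eq_bigr => i _; rewrite asym.
Qed.

Lemma orthonormal_coord n (v : 'I_n -> U) c i : orthonormal v ->
  a (\sum_i c i *: v i) (v i) = c i.
Proof.
move=> [Vv ov]; rewrite semi_inner_sum// (bigD1 i)//= big1 => [|j ji].
  by rewrite ov eqxx mulr1 addr0.
by rewrite ov (negbTE ji) mulr0.
Qed.

Lemma orthonormal_sqr n (v : 'I_n -> U) c : orthonormal v ->
  a (\sum_i c i *: v i) (\sum_i c i *: v i) = \sum_i c i * c i.
Proof.
have [asym alin _] := ia.
move=> ov; have [Vv _] := ov; have Vs := subspace_sum c sV Vv.
rewrite (linear_on_sum sV (alin _ Vs))//.
by apply: eq_bigr => i _; rewrite orthonormal_coord.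
Qed.

(** The coordinates of more than N vectors satisfy a nontrivial linear relation c.
The same combination of the vectors is a null vector, whereas for an orthonormal
family its square is that of c. *)
Lemma fin_dim_orthonormal : fin_dim V a ->
  exists N, forall n (v : 'I_n -> U), orthonormal v -> (n <= N)%N.
Proof.
move=> [N [phi phiP]]; exists N => n v ov; rewrite leqNgt; apply/negP => Nn.
pose M := \matrix_(i < n) phi (v i).
have : kermx M != 0.
  rewrite kermx_eq0 /row_free neq_ltn (leq_ltn_trans _ Nn)//.
  exact: rank_leq_col.
case/rowV0Pn => c /sub_kermxP cM c0.
have [Vv _] := ov.
have := phiP n v (c ord0) Vv; rewrite orthonormal_sqr// => /(_ _)/eqP c00.
case/negP: c0; rewrite (@mdot_eq0 _ _ _ c)//.
rewrite /mdot big_ord1; apply/eqP/c00.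
by rewrite -[RHS]cM mulmx_sum_row; apply: eq_bigr => i _; rewrite rowK.
Qed.

Definition complete n (v : 'I_n -> U) := forall w, V w ->
  let z := w - \sum_i a w (v i) *: v i in a z z = 0.

(** One step of the Gram-Schmidt process. *)
Lemma orthonormal_extend n (v : 'I_n -> U) : orthonormal v -> ~ complete v ->
  exists v' : 'I_n.+1 -> U, orthonormal v'.
Proof.
have [asym alin apos] := ia.
move=> ov /existsNP[w /not_implyP[Vw]].
set z := w - _ => /eqP az.
have [Vv ovv] := ov.
have Vz : V z by apply: subspaceB => //; exact: subspace_sum.
have zv i : a z (v i) = 0.
  rewrite asym// /z (linear_onB (alin _ (Vv i)))//; last exact: subspace_sum.
  by rewrite asym// [X in _ - X]asym ?orthonormal_coord ?subrr//; exact: subspace_sum.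
have az0 : 0 < a z z by rewrite lt_neqAle eq_sym az apos.
pose u := (Num.sqrt (a z z))^-1 *: z.
have Vu : V u by exact: subspaceZ.
have uv i : a u (v i) = 0.
  by rewrite asym// /u (linear_onZ sV (alin _ _))// asym// zv mulr0.
have uu : a u u = 1.
  rewrite {2}/u (linear_onZ sV (alin _ _))// asym// (linear_onZ sV (alin _ _))//.
  rewrite mulrA -expr2 exprVn sqr_sqrtr ?apos// mulVf//.
exists (fun i => if unlift ord_max i is Some j then v j else u); split.
  by move=> i; case: unliftP => [j|] _.
move=> i j; case: unliftP => [i'|] ->; case: unliftP => [j'|] ->.
- by rewrite ovv (inj_eq (@lift_inj _ _)).
- by rewrite asym// uv eq_sym (negbTE (neq_lift _ _)).
- by rewrite uv (negbTE (neq_lift _ _)).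
- by rewrite uu eqxx.
Qed.

Lemma exists_basis : fin_dim V a ->
  exists n (v : 'I_n -> U), orthonormal v /\ complete v.
Proof.
move=> /fin_dim_orthonormal[N NP]; apply: contrapT => nex.
suff [v ov] : exists v : 'I_N.+1 -> U, orthonormal v.
  by have := NP _ _ ov; rewrite ltnn.
elim: N.+1 => [|n [v ov]].
  by exists (fun _ => 0); split; case.
apply: (orthonormal_extend ov) => cv; apply: nex.
by exists n, v.
Qed.

End orthonormal.

End subspaces.

Lemma continuous_rV (R : realType) (T : topologicalType) n (f : T -> 'rV[R]_n) :
  (forall i, continuous (fun x => f x ord0 i)) -> continuous f.
Proof.
move=> cf x A [/= P Pfx PA]; rewrite /nbhs /=.
apply: (@filterS _ (nbhs x) _ (fun y => forall i j, P i j (f y i j))).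
  by move=> y /PA.
apply: filter_forall => i; apply: filter_forall => j.
by rewrite ord1; apply: cf; rewrite -[X in nbhs (f x X j)](ord1 i) ord1; exact: Pfx.
Qed.

(** In an orthonormal basis the equation F w = 0 is that of the zeros of a continuous
map of R^n to itself, and a is the Euclidean inner product of the coordinates.
As F w kills the null vectors of a, it is determined by its values on the basis. *)
Theorem galerkin (R : realType) (U : lmodType R) (V : set U) (a F : U -> U -> R)
    (rho : R) :
  is_subspace V -> semi_inner V a -> fin_dim V a ->
  (forall w, V w -> linear_on V (F w)) ->
  (forall w z, V w -> V z -> a z z = 0 -> F w z = 0) ->
  (forall n (v : 'I_n -> U) z, (forall i, V (v i)) -> V z ->
     continuous (fun c : 'rV[R]_n => F (\sum_i c ord0 i *: v i) z : R)) ->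
  0 < rho -> (forall w, V w -> a w w = rho ^+ 2 -> 0 <= F w w) ->
  exists2 w, V w & forall z, V z -> F w z = 0.
Proof.
move=> sV ia fV lF F0 cF rho0 Fpos.
have [n [v [ov cv]]] := exists_basis sV ia fV.
have [Vv _] := ov.
pose u (c : 'rV[R]_n) := \sum_i c ord0 i *: v i.
have Vu c : V (u c) by exact: subspace_sum.
pose Phi (c : 'rV[R]_n) : 'rV[R]_n := \row_i F (u c) (v i).
have [|||c Phic] := @acute_angle_zero R n Phi rho => //.
- apply: continuous_rV => i; under eq_fun do rewrite mxE.
  exact: cF.
- move=> c cc; have : 0 <= F (u c) (u c).
    apply: Fpos => //; rewrite (orthonormal_sqr sV ia)// -cc.
    by rewrite /mdot big_ord1.
  rewrite {2}/u (linear_on_sum sV (lF _ _))// /mdot big_ord1.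
  by under [X in _ -> 0 <= X]eq_bigr do rewrite mxE mulrC.
exists (u c) => // z Vz.
have lin := lF _ (Vu c).
rewrite -[z](subrK (\sum_i a z (v i) *: v i)) (linear_onD lin); last first.
- exact: subspace_sum.
- by apply: subspaceB => //; exact: subspace_sum.
rewrite F0//; first last.
- exact: cv.
- by apply: subspaceB => //; exact: subspace_sum.
rewrite add0r (linear_on_sum sV lin)// big1// => i _.
by move/rowP: Phic => /(_ i); rewrite !mxE => ->; rewrite mulr0.
Qed.

Section lagrange_multiplier.
Variables (R : realType) (U W : lmodType R) (X : set U) (M : set W).
Variables (a : U -> U -> R) (m : W -> W -> R) (b : W -> U -> R) (L : U -> R).

(** With B the matrix of b in orthonormal bases of M and X, the functional L is a
combination of the rows of B iff it vanishes on the kernel of B, that is, on the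
columns of its cokernel matrix; the coefficients are the coordinates of p. *)
Theorem lagrange_multiplier : is_subspace X -> semi_inner X a -> fin_dim X a ->
  is_subspace M -> semi_inner M m -> fin_dim M m ->
  (forall q, M q -> linear_on X (b q)) ->
  (forall v, X v -> linear_on M (b ^~ v)) ->
  (forall q v, M q -> X v -> a v v = 0 -> b q v = 0) ->
  (forall q v, M q -> X v -> m q q = 0 -> b q v = 0) ->
  linear_on X L -> (forall v, X v -> a v v = 0 -> L v = 0) ->
  (forall v, X v -> (forall q, M q -> b q v = 0) -> L v = 0) ->
  exists2 p, M p & forall v, X v -> L v = b p v.
Proof.
move=> sX ia fX sM im fM lX lM ba bm lL La Lker.
have [k [x [ox cx]]] := exists_basis sX ia fX.
have [l [q [oq cq]]] := exists_basis sM im fM.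
have [[Xx _] [Mq _]] := (ox, oq).
pose B := \matrix_(j < l, i < k) b (q j) (x i).
pose ell : 'rV[R]_k := \row_i L (x i).
have decX f v : linear_on X f -> (forall v, X v -> a v v = 0 -> f v = 0) ->
    X v -> f v = \sum_i a v (x i) * f (x i).
  move=> lf f0 Xv; have Xs := subspace_sum (fun i => a v (x i)) sX Xx.
  rewrite -[v in LHS](subrK (\sum_i a v (x i) *: x i)) (linear_onD lf)//; last first.
    exact: subspaceB.
  rewrite f0 ?add0r; [|exact: subspaceB|exact: cx].
  exact: (linear_on_sum sX lf).
have decM f p : linear_on M f -> (forall v, M v -> m v v = 0 -> f v = 0) ->
    M p -> f p = \sum_i m p (q i) * f (q i).
  move=> lf f0 Mp; have Ms := subspace_sum (fun i => m p (q i)) sM Mq.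
  rewrite -[p in LHS](subrK (\sum_i m p (q i) *: q i)) (linear_onD lf)//; last first.
    exact: subspaceB.
  rewrite f0 ?add0r; [|exact: subspaceB|exact: cq].
  exact: (linear_on_sum sM lf).
have : (ell <= B)%MS.
  rewrite submxE; apply/eqP/rowP => j; rewrite !mxE.
  pose c i := cokermx B i j; pose v := \sum_i c i *: x i.
  have Xv : X v by exact: subspace_sum.
  transitivity (L v).
    rewrite /v (linear_on_sum sX lL)//.
    by apply: eq_bigr => i _; rewrite mxE mulrC.
  apply: Lker => // p Mp.
  rewrite (decM (b ^~ v)) ?big1//; [move=> i _|exact: lM|]; last first.
    by move=> r Mr r0; exact: bm.
  rewrite /v (linear_on_sum sX (lX _ (Mq i)))//.
  have -> : \sum_k0 c k0 * b (q i) (x k0) = (B *m cokermx B) i j.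
    by rewrite mxE; apply: eq_bigr => i' _; rewrite mxE mulrC.
  by rewrite mulmx_coker mxE mulr0.
case/submxP => D ellD.
pose p := \sum_j D ord0 j *: q j.
have Mp : M p by exact: subspace_sum.
exists p => // v Xv; rewrite (decX L)// (decX (b p))//; [|exact: lX|]; last first.
  by move=> w Xw; exact: ba.
apply: eq_bigr => i _; congr (_ * _).
rewrite /p (linear_on_sum sM (lM _ (Xx i)))//.
have /rowP/(_ i) := ellD; rewrite !mxE => ->.
by apply: eq_bigr => j _; rewrite mxE.
Qed.

End lagrange_multiplier.

(** * Boxes and the Borel sets of R^d *)

Section boxes.
Context {R : realType} {d : nat}.
Implicit Types (x y a b : 'rV[R]_d) (Omega A : set 'rV[R]_d).

Definition obox a b : set 'rV[R]_d := [set x | forall i, a ord0 i < x ord0 i < b ord0 i].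
Definition cbox a b : set 'rV[R]_d := [set x | forall i, a ord0 i <= x ord0 i <= b ord0 i].

Lemma measurable_rect (A : 'I_d -> set (measurableTypeR R)) :
  (forall i, measurable (A i)) ->
  measurable [set x : 'rV[R]_d | forall i, A i (x ord0 i)].
Proof.
move=> mA; rewrite (_ : mkset _ =
  \bigcap_(i in [set: 'I_d]) [set x : 'rV[R]_d | A i (x ord0 i)]).
  apply: fin_bigcap_measurable => // i _.
  by rewrite -[X in measurable X]setTI; exact: measurable_coord.
by apply/seteqP; split=> x /= h i; [move=> _|]; exact: h.
Qed.

Lemma measurable_obox a b : measurable (obox a b).
Proof.
rewrite (_ : obox a b = [set x : 'rV[R]_d | forall i,
    `]a ord0 i, b ord0 i[%classic (x ord0 i)]).
  by apply: (@measurable_rect (fun i => `]a ord0 i, b ord0 i[%classic)) => i; exact: measurable_itv.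
by apply/seteqP; split=> x /= h i; have := h i; rewrite in_itv.
Qed.

Lemma lebesgue_rV_obox a b : (forall i, a ord0 i <= b ord0 i) ->
  lebesgue_rV d (obox a b) = (\prod_i (b ord0 i - a ord0 i))%:E.
Proof.
move=> ab; rewrite (_ : obox a b = [set x : 'rV[R]_d | forall i,
    `]a ord0 i, b ord0 i[%classic (x ord0 i)]); last first.
  by apply/seteqP; split=> x /= h i; have := h i; rewrite in_itv.
rewrite (@lebesgue_rV_box _ _ (fun i => `]a ord0 i, b ord0 i[%classic)).
  rewrite -prodEFin; apply: eq_bigr => i _.
  by rewrite lebesgue_measure_itv /= lte_fin lt_neqAle ab andbT; case: eqVneq => // ->;
     rewrite subrr.
by move=> i; exact: measurable_itv.
Qed.

Lemma bounded_obox A : bounded_set A -> exists a b, A `<=` obox a b.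
Proof.
case=> M [Mr MA]; exists (const_mx (- (M + 1))), (const_mx (M + 1)) => x Ax i.
rewrite !mxE -ltr_norml.
have xM : `|x| <= M + 2^-1 by apply: MA => //; rewrite ltrDl invr_gt0.
apply: (@le_lt_trans _ _ (M + 2^-1)); last by rewrite ltrD2l invf_lt1 ?ltr1n.
exact: le_trans (le_coord x i) xM.
Qed.

Hypothesis d0 : (0 < d)%N.

(** The boxes with rational corners whose closure lies in Omega cover it.  They are
indexed by their codes as pairs of rational vectors; an index that codes no such
box gets reversed corners, which makes both its boxes empty as d > 0. *)
Lemma open_countable_boxes Omega : open Omega ->
  exists a b : nat -> 'rV[R]_d, (forall k, cbox (a k) (b k) `<=` Omega) /\
    Omega = \bigcup_k obox (a k) (b k).
Proof.
move=> oO.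
pose ra (q : 'rV[rat]_d) : 'rV[R]_d := map_mx ratr q.
pose good k (q : 'rV[rat]_d * 'rV[rat]_d) :=
  unpickle k = Some q /\ cbox (ra q.1) (ra q.2) `<=` Omega.
pose ab k := if pselect (exists q, good k q) is left h then
  (ra (projT1 (cid h)).1, ra (projT1 (cid h)).2) else (const_mx 1, const_mx 0).
exists (fun k => (ab k).1), (fun k => (ab k).2).
have cab k : cbox (ab k).1 (ab k).2 `<=` Omega.
  rewrite /ab; case: pselect => [h|_] /=; first by case: (cid h) => /= q [].
  move=> x /(_ (Ordinal d0)); rewrite !mxE => /andP[x1 x0].
  by have := le_trans x1 x0; rewrite ler10.
split=> //; apply/seteqP; split; last first.
  move=> x [k _ xk]; apply: (cab k) => i.
  by have /andP[/ltW -> /ltW ->] := xk i.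
move=> x Ox; have /nbhs_ballP[e /= e0 xe] : nbhs x Omega by exact: open_nbhs_nbhs.
have lo i : exists q : rat, x ord0 i - e / 2 < ratr q < x ord0 i.
  have [|q] := @rat_in_itvoo R (x ord0 i - e / 2) (x ord0 i).
    by rewrite gtrBl divr_gt0.
  by rewrite in_itv; exists q.
have hi i : exists q : rat, x ord0 i < ratr q < x ord0 i + e / 2.
  have [|q] := @rat_in_itvoo R (x ord0 i) (x ord0 i + e / 2).
    by rewrite ltrDl divr_gt0.
  by rewrite in_itv; exists q.
have [ql qlP] := choice lo; have [qh qhP] := choice hi.
pose q : 'rV[rat]_d * 'rV[rat]_d := (\row_i ql i, \row_i qh i).
have gq : good (pickle q) q.
  split; first exact: pickleK.
  move=> y yq; apply: xe; apply: rV_ball => // i.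
  have := yq i; rewrite !mxE /= => /andP[].
  have /andP[? ?] := qlP i; have /andP[? ?] := qhP i.
  by rewrite ltr_distl => ? ?; apply/andP; split; lra.
exists (pickle q) => //; rewrite /ab; case: pselect => [h|[]]; last by exists q.
case: (cid h) => /= q' [+ _]; rewrite pickleK => -[<-] i.
rewrite !mxE /=.
by have /andP[_ ->] := qlP i; have /andP[-> _] := qhP i.
Qed.

Lemma open_measurable_rV Omega : open Omega -> measurable Omega.
Proof.
move=> /open_countable_boxes[a [b [_ ->]]].
by apply: bigcupT_measurable => k; exact: measurable_obox.
Qed.

Lemma continuous_measurable_rV (f : 'rV[R]_d -> R) : continuous f ->
  measurable_fun [set: 'rV[R]_d] (f : _ -> measurableTypeR R).
Proof.
move=> cf; apply: (measurability _ (measurable_realfun.RGenOInfty.measurableE R)).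
move=> _ [_ [x ->] <-]; rewrite setTI; apply: open_measurable_rV.
by apply: open_comp => // y _; exact: cf.
Qed.

(** Unlike the preimages under single coordinates, these orthants are stable under
intersection, as Dynkin's theorem requires. *)
Lemma measurable_rV_halfspaces : (@measurable _ 'rV[R]_d) =
  <<s [set A | exists a, A = [set x : 'rV[R]_d | forall i, a ord0 i < x ord0 i]] >>.
Proof.
apply/seteqP; split; last first.
  apply: smallest_sub; first exact: sigma_algebra_measurable.
  move=> _ [a ->].
  rewrite (_ : mkset _ = [set x : 'rV[R]_d | forall i, `]a ord0 i, +oo[%classic (x ord0 i)]).
    by apply: (@measurable_rect (fun i => `]a ord0 i, +oo[%classic)) => i; exact: measurable_itv.
  by apply/seteqP; split=> x /= h i; have := h i; rewrite in_itv/= andbT.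
set G := [set A | _].
apply: smallest_sub; first exact: smallest_sigma_algebra.
rewrite -bigcup_seq; apply: bigcup_sub => i _ _ [B mB <-]; rewrite setTI.
pose S := [set B : set (measurableTypeR R) | <<s G >> ((fun x : 'rV[R]_d => x ord0 i) @^-1` B)].
suff : (measurable : set (set (measurableTypeR R))) `<=` S by exact.
have -> : (measurable : set (set (measurableTypeR R))) =
    <<s (@measurable_realfun.RGenOInfty.G R) >>.
  exact: measurable_realfun.RGenOInfty.measurableE.
have [sG0 sGC sGU] := smallest_sigma_algebra setT G.
apply: smallest_sub.
  split=> [|C SC|F SF]; rewrite /S /=.
  - by rewrite preimage_set0.
  - by rewrite setTD preimage_setC -setTD; exact: sGC.
  - by rewrite preimage_bigcup; exact: sGU.
move=> _ [c ->]; rewrite /S /=.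
(* A half space is the increasing union of the orthants with corner c in
   direction i and - n in the others. *)
pose a n : 'rV[R]_d := \row_j (if j == i then c else - n%:R).
rewrite (_ : _ @^-1` _ = \bigcup_n [set x : 'rV[R]_d | forall j, a n ord0 j < x ord0 j]).
  by apply: sGU => n; apply: sub_sigma_algebra; exists (a n).
apply/seteqP; split=> x /=; rewrite in_itv/= andbT; last first.
  by case=> n _ /(_ i); rewrite mxE eqxx.
move=> cx; pose M := \sum_j `|x ord0 j|.
exists (Num.truncn M).+1 => // j; rewrite mxE; case: eqP => [->//|_].
rewrite ltrNl (le_lt_trans _ (truncnS_gt _))// /M (bigD1 j)//= (le_trans (ler_norm _))//.
by rewrite normrN lerDl sumr_ge0.
Qed.

End boxes.

(** * Smooth functions with compact support *)

Section bump.
Variable R : realType.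
Implicit Types (p : {poly R}) (t : R).

(** Allowing a polynomial factor makes the family stable under derivation. *)
Definition bump p t : R := if 0 < t then p.[t^-1] * expR (- t^-1) else 0.

(** At y = 1 / t, the exponential exp y dominates y^(n+2) / (n+2)!, where n bounds
the degree of p; two powers of t are left. *)
Lemma bump_sqr_le p : exists C, forall t, 0 < t -> t <= 1 -> `|bump p t| <= C * t ^+ 2.
Proof.
pose n := size p; pose A := \sum_(i < n) `|p`_i|.
exists (A * (n.+2)`!%:R) => t t0 t1; rewrite /bump t0 -[t in leRHS]invrK.
have y1 : 1 <= t^-1 by rewrite invf_ge1.
move: (t^-1) y1 => y y1; have y0 : 0 < y by exact: lt_le_trans y1.
have A0 : 0 <= A by exact: sumr_ge0.
have py : `|p.[y]| <= A * y ^+ n.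
  rewrite horner_coef (le_trans (ler_norm_sum _ _ _))// /A mulr_suml.
  apply: ler_sum => i _; rewrite normrM ler_wpM2l// normrX gtr0_norm//.
  by rewrite ler_weXn2l// ltnW.
have ey : expR (- y) <= (n.+2)`!%:R / y ^+ n.+2.
  rewrite expRN -[leRHS]invrK lef_pV2 ?posrE ?expR_gt0//; last first.
    by rewrite invr_gt0 divr_gt0 ?exprn_gt0// ltr0n fact_gt0.
  rewrite invf_div (le_trans _ (expR_ge1Dxn n.+1 (ltW y0)))//.
  by rewrite lerDr.
rewrite normrM [`|expR _|]ger0_norm ?expR_ge0//.
apply: (le_trans (ler_pM (normr_ge0 _) (expR_ge0 _) py ey)).
rewrite exprVn le_eqVlt; apply/orP; left; apply/eqP.
by rewrite !exprS; field; rewrite expf_neq0 ?gt_eqF.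
Qed.

(** For t > 0 this is the rule for p (1/t) exp (- 1/t); at 0 the quadratic bound
makes the difference quotients tend to 0. *)
Lemma is_derive_bump p t : is_derive t 1 (bump p) (bump ('X^2 * (p - p^`())) t).
Proof.
have [t0|t0|->] := ltrgt0P t.
- rewrite {2}/bump t0.
  have tn0 : t != 0 by rewrite gt_eqF.
  pose h (s : R) := p.[s^-1] * expR (- s^-1).
  apply: (@near_eq_is_derive _ _ _ h).
    near=> s; rewrite /bump ifT//; near: s; exact: lt_nbhsr.
  have dV : is_derive t 1 (fun s : R => s^-1) (- t ^- 2 *: (1 : R)).
    exact: is_deriveV.
  have dp : is_derive t 1 (horner p \o (fun s : R => s^-1)) (p^`().[t^-1] * (- t ^- 2 *: 1)).
    exact: is_derive1_comp.
  have dN : is_derive t 1 (fun s : R => - s^-1) (- (- t ^- 2 *: (1 : R))).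
    exact: is_deriveN.
  have de : is_derive t 1 (expR \o (fun s : R => - s^-1)) (expR (- t^-1) * (- (- t ^- 2 *: 1))).
    exact: is_derive1_comp.
  have dh := is_deriveM dp de.
  apply: is_derive_eq dh _.
  rewrite /= !hornerE /GRing.scale /= exprVn.
  by ring.
- rewrite {2}/bump ifN; last by rewrite -leNgt ltW.
  apply: (@near_eq_is_derive _ _ _ (cst 0)).
  near=> s; rewrite /bump ifN// -leNgt ltW//; near: s; exact: lt_nbhsl.
- rewrite {2}/bump ltxx; have [C CP] := bump_sqr_le p.
  have C0 : 0 <= C by have := CP 1 ltr01 (lexx _); rewrite expr1n mulr1; exact: le_trans.
  have lim0 : h^-1 *: ((bump p \o shift 0) (h *: 1) - bump p 0) @[h --> 0^'] --> (0 : R).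
    apply/cvgrPdist_le => /= e e0.
    near=> h; rewrite sub0r normrN [_%:A]mulr1 addr0 {2}/bump ltxx subr0.
    have [h0|h0] := ltP 0 h; last by rewrite /bump ltNge h0 /= scaler0 normr0 ltW.
    have hV : 0 <= h^-1 by rewrite invr_ge0 ltW.
    rewrite /GRing.scale/= normrM [`|h^-1|]ger0_norm//.
    have h1 : h <= 1.
      rewrite (le_trans (ler_norm _))//; near: h.
      by apply: dnbhs0_le.
    have bh := CP h h0 h1.
    rewrite (le_trans (ler_wpM2l hV bh))//.
    have hn0 : h != 0 by rewrite gt_eqF.
    rewrite (_ : h^-1 * _ = C * h); last by field.
    apply: (@le_trans _ _ ((C + 1) * h)); first by rewrite ler_wpM2r ?lerDl// ltW.
    rewrite mulrC -ler_pdivlMr; last by rewrite ltr_wpDl.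
    rewrite (le_trans (ler_norm _))//; near: h.
    by apply: dnbhs0_le; rewrite divr_gt0// ltr_wpDl.
  apply: DeriveDef; first by apply/cvg_ex; exists 0.
  exact: cvg_lim lim0.
Unshelve. all: by end_near. Qed.

End bump.

Section smooth_algebra.
Variables (R : realType) (d : nat).
Implicit Types (f g : 'rV[R]_d -> R).

(** The algebra generated by the bumps of the coordinates; being closed under
   partial derivatives, it consists of smooth functions. *)
Inductive bump_algebra : ('rV[R]_d -> R) -> Prop :=
  | bump_algebra_cst c : bump_algebra (fun=> c)
  | bump_algebra_bump p (c a : R) j :
      bump_algebra (fun x => bump p (c * x ord0 j + a))
  | bump_algebraD f g : bump_algebra f -> bump_algebra g ->
      bump_algebra (fun x => f x + g x)
  | bump_algebraM f g : bump_algebra f -> bump_algebra g ->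
      bump_algebra (fun x => f x * g x).

Lemma bump_algebra_differentiable f : bump_algebra f -> forall x, differentiable f x.
Proof.
elim=> [c|p c a j|{}f g _ df _ dg|{}f g _ df _ dg] x.
- exact: differentiable_cst.
- apply: (@differentiable_comp _ _ _ _ (fun x : 'rV[R]_d => c * x ord0 j + a) (bump p)).
    apply: differentiableD; last exact: differentiable_cst.
    by apply: differentiableM; [exact: differentiable_cst|exact: differentiable_coord].
  by apply/derivable1_diffP; have [] := is_derive_bump p (c * x ord0 j + a).
- exact: differentiableD.
- exact: differentiableM.
Qed.

Lemma derive_line f x (v : 'rV[R]_d) :
  'D_v f x = 'D_(1 : R) (fun h : R => f (h *: v + x)) 0.
Proof.
rewrite /derive; set g1 := fun h => h^-1 *: _; set g2 := fun h => h^-1 *: _.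
suff -> : g1 = g2 by [].
by rewrite funeqE /g1 /g2 => h /=; rewrite addr0 scale0r add0r [_%:A]mulr1.
Qed.

Lemma bump_algebra_partial f i : bump_algebra f -> bump_algebra (partial i f).
Proof.
elim=> [c|p c a j|{}f g bf IHf bg IHg|{}f g bf IHf bg IHg].
- rewrite (_ : partial i _ = fun=> 0); first exact: bump_algebra_cst.
  by apply/funext => x; rewrite /partial derive_cst.
- pose q := 'X^2 * (p - p^`()).
  rewrite (_ : partial i _ = fun x => c * (j == i)%:R * bump q (c * x ord0 j + a)).
    by apply: bump_algebraM; [exact: bump_algebra_cst|exact: bump_algebra_bump].
  apply/funext => x; rewrite /partial derive_line.
  pose k : R := c * (j == i)%:R; pose b := c * x ord0 j + a.
  rewrite (_ : (fun h : R => _) = bump p \o (fun h => h * k + b)); last first.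
    by apply/funext => h; rewrite /= !mxE eqxx /= /k /b; congr bump; ring.
  have da : is_derive (0 : R) 1 (fun h : R => h * k + b) k.
    have dk := is_deriveM (is_derive_id (0 : R) 1) (is_derive_cst k (0 : R) 1).
    have db := is_deriveD dk (is_derive_cst b (0 : R) 1).
    apply: (is_derive_eq db).
    by rewrite /= scaler0 add0r addr0 /GRing.scale /= mulr1.
  have db : is_derive (0 * k + b) 1 (bump p) (bump q b).
    by rewrite mul0r add0r; exact: is_derive_bump.
  have [_ ->] := @is_derive1_comp R (bump p) (fun h : R => h * k + b) 0 _ _ db da.
  by rewrite mulrC.
- rewrite (_ : partial i _ = fun x => partial i f x + partial i g x).
    exact: bump_algebraD.
  apply/funext => x; rewrite /partial -deriveD//.
    by apply: diff_derivable; exact: bump_algebra_differentiable.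
  by apply: diff_derivable; exact: bump_algebra_differentiable.
- rewrite (_ : partial i _ = fun x => f x * partial i g x + g x * partial i f x).
    by apply: bump_algebraD; exact: bump_algebraM.
  apply/funext => x; rewrite /partial deriveM//.
    by apply: diff_derivable; exact: bump_algebra_differentiable.
  by apply: diff_derivable; exact: bump_algebra_differentiable.
Qed.

Lemma bump_algebra_smooth f : bump_algebra f -> smooth f.
Proof.
move=> bf s; apply: bump_algebra_differentiable.
by elim: s => //= i s IH; exact: bump_algebra_partial.
Qed.

Lemma bump_algebra_prod (I : Type) (r : seq I) (F : I -> 'rV[R]_d -> R) :
  (forall i, bump_algebra (F i)) -> bump_algebra (fun x => \prod_(i <- r) F i x).
Proof.
move=> bF; elim: r => [|i r IH].
  by under eq_fun do rewrite big_nil; exact: bump_algebra_cst.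
by under eq_fun do rewrite big_cons; exact: bump_algebraM.
Qed.

End smooth_algebra.

(** * The fundamental lemma of the calculus of variations *)

Section fundamental_lemma.
Variables (R : realType) (d : nat).
Hypothesis d0 : (0 < d)%N.
Let mu := @lebesgue_rV R d.
Implicit Types (Omega : set 'rV[R]_d) (a b x : 'rV[R]_d) (W : 'rV[R]_d -> R).

(** The factor m + 1 makes each profile sharper, so that these functions converge to
the indicator of the box as m grows. *)
Definition box_bump a b (m : nat) x : R :=
  \prod_(i < d) (bump 1 (m.+1%:R * x ord0 i + (- m.+1%:R * a ord0 i)) *
                 bump 1 (- m.+1%:R * x ord0 i + m.+1%:R * b ord0 i)).

Lemma bump1_ge0 (t : R) : 0 <= bump 1 t <= 1.
Proof.
rewrite /bump; case: ifPn => t0; last by rewrite lexx ler01.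
by rewrite hornerC mul1r expR_ge0 expR_le1 oppr_le0 invr_ge0 ltW.
Qed.

Lemma cvg_bump1 (t : R) : bump 1 (m.+1%:R * t) @[m --> \oo] --> ((0 < t)%R%:R : R).
Proof.
have [t0|t0] := ltP 0 t; last first.
  rewrite (_ : (fun m : nat => _) = cst 0); first exact: cvg_cst.
  by apply/funext => m; rewrite /bump pmulr_rgt0// ltNge t0.
rewrite (_ : (fun m : nat => _) = fun m : nat => expR (- (t^-1 * m.+1%:R^-1))).
  rewrite /= -[X in _ --> X]expR0.
  apply: continuous_cvg; first exact: continuous_expR.
  rewrite -[X in _ --> X]oppr0; apply: cvgN.
  rewrite -[X in _ --> X](mulr0 t^-1); apply: cvgM; first exact: cvg_cst.
  exact: cvg_harmonic.
by apply/funext => m; rewrite /bump pmulr_rgt0// t0 hornerC mul1r invfM mulrC.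
Qed.

Lemma box_bump_cvg a b x :
  box_bump a b m x @[m --> \oo] --> (\1_(obox a b) x : R).
Proof.
rewrite (_ : \1_(obox a b) x =
    \prod_(i < d) ((0 < x ord0 i - a ord0 i)%R%:R * (0 < b ord0 i - x ord0 i)%R%:R)).
  apply: cvg_big => //; first exact: mul_continuous.
  move=> i _; apply: cvgM.
    rewrite [X in X @ _ --> _](_ : _ = fun m : nat => bump 1 (m.+1%:R * (x ord0 i - a ord0 i))).
      exact: cvg_bump1.
    by apply/funext => m; congr bump; ring.
  rewrite [X in X @ _ --> _](_ : _ = fun m : nat => bump 1 (m.+1%:R * (b ord0 i - x ord0 i))).
    exact: cvg_bump1.
  by apply/funext => m; congr bump; ring.
rewrite indicE; have [xab|xab] := boolP (x \in obox a b).
  rewrite big1// => i _; move: xab; rewrite inE => /(_ i).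
  by rewrite !subr_gt0 => /andP[-> ->]; rewrite mulr1.
move: xab; rewrite notin_setE /= => /existsNP[i xi].
rewrite (bigD1 i)//= !subr_gt0.
by move/negP: xi; rewrite negb_and => /orP[]/negbTE ->; rewrite ?mul0r ?mulr0 ?mul0r.
Qed.

Lemma box_bump_ge0 a b m x : 0 <= box_bump a b m x <= 1.
Proof.
apply/andP; split.
  apply: prodr_ge0 => i _; apply: mulr_ge0.
    by case/andP: (bump1_ge0 (m.+1%:R * x ord0 i + (- m.+1%:R * a ord0 i))).
  by case/andP: (bump1_ge0 (- m.+1%:R * x ord0 i + m.+1%:R * b ord0 i)).
apply: prodr_ile1 => i _.
have /andP[p0 p1] := bump1_ge0 (m.+1%:R * x ord0 i + (- m.+1%:R * a ord0 i)).
have /andP[q0 q1] := bump1_ge0 (- m.+1%:R * x ord0 i + m.+1%:R * b ord0 i).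
by rewrite mulr_ge0//= mulr_ile1.
Qed.

Lemma compact_cbox a b : compact (cbox a b).
Proof. exact: rV_cube_compact. Qed.

Lemma box_bump_test a b m Omega : cbox a b `<=` Omega ->
  test_function Omega (box_bump a b m).
Proof.
move=> abO; split.
  apply: bump_algebra_smooth; apply: bump_algebra_prod => i.
  by apply: bump_algebraM; exact: bump_algebra_bump.
exists (cbox a b); split=> //; first exact: compact_cbox.
move=> x /existsNP[i /negP]; rewrite negb_and -!ltNge /box_bump (bigD1 i)//= => xi.
suff -> : bump 1 (m.+1%:R * x ord0 i + (- m.+1%:R * a ord0 i)) *
          bump 1 (- m.+1%:R * x ord0 i + m.+1%:R * b ord0 i) = 0 by rewrite mul0r.
case/orP: xi => xi; [rewrite {1}/bump ifN ?mul0r//|rewrite [X in _ * X]/bump ifN ?mulr0//].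
  by rewrite -leNgt mulNr -mulrBr pmulr_rle0// subr_le0 ltW.
by rewrite -leNgt mulNr addrC -mulrBr pmulr_rle0// subr_le0 ltW.
Qed.

Lemma box_bump_measurable a b m D : measurable_fun D (box_bump a b m : _ -> measurableTypeR R).
Proof.
apply: measurable_funTS; apply: continuous_measurable_rV => // x.
apply: differentiable_continuous; apply: bump_algebra_differentiable.
apply: bump_algebra_prod => i.
by apply: bump_algebraM; exact: bump_algebra_bump.
Qed.

(** The indicator of a box is the bounded pointwise limit of test functions. *)
Lemma box_integral_eq0 Omega W a b : open Omega ->
  mu.-integrable Omega (EFin \o W) ->
  (forall phi, test_function Omega phi -> \int[mu]_(x in Omega) (W x * phi x) = 0) ->
  cbox a b `<=` Omega -> (\int[mu]_(x in obox a b) (W x)%:E)%E = 0%E.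
Proof.
move=> oO iW W0 abO.
have mO : measurable Omega by exact: open_measurable_rV.
have /measurable_EFinP mW := measurable_int _ iW.
have oabO : obox a b `<=` Omega.
  by move=> x xab; apply: abO => i; have /andP[/ltW -> /ltW ->] := xab i.
pose f_ m x := (W x * box_bump a b m x)%:E.
pose f x := (W x * \1_(obox a b) x)%:E.
have mf m : measurable_fun Omega (f_ m).
  apply/measurable_EFinP; apply: measurable_funM => //.
  exact: box_bump_measurable.
have bnd m x : (`|f_ m x| <= (`|W x|)%:E)%E.
  rewrite /f_ lee_fin normrM ler_piMr//.
  by have /andP[? ?] := box_bump_ge0 a b m x; rewrite ger0_norm.
have [] := @dominated_convergence _ _ _ mu Omega mO f_ f (fun x => (`|W x|)%:E) mf.
- apply/measurable_EFinP; apply: measurable_funM => //.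
  by apply: measurable_indic; exact: measurable_obox.
- apply: aeW => x _; apply: cvg_EFin; first exact: nearW.
  by apply: cvgM; [exact: cvg_cst|exact: box_bump_cvg].
- rewrite (_ : (fun x => _) = abse \o (EFin \o W)) ?integrable_abse//.
- by apply: aeW => x m _; exact: bnd.
move=> fi _ cv.
have z m : (\int[mu]_(x in Omega) f_ m x)%E = 0%E.
  have ifm : mu.-integrable Omega (f_ m).
    apply: (le_integrable mO (mf m) _ iW) => x _; exact: bnd.
  rewrite -(fineK (integrable_fin_num mO ifm)).
  by have := W0 _ (box_bump_test m abO); rewrite /Rintegral => ->.
have e : (\int[mu]_(x in Omega) f x)%E = 0%E.
  apply: (cvg_unique (@ereal_hausdorff R) cv).
  rewrite (_ : [sequence _]_n = cst 0%E); first exact: cvg_cst.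
  by apply/funext => m; exact: z.
rewrite -[RHS]e -[obox a b](setIidr oabO) integral_mkcondr.
apply: eq_integral => x _; rewrite /f patchE indicE.
by case: ifPn => _; rewrite ?mulr1 ?mulr0.
Qed.

(** Dynkin's theorem, from the traces on the box of the orthants, which are boxes
again. *)
Lemma subset_box_integral_eq0 Omega W a b (E : set 'rV[R]_d) : open Omega ->
  mu.-integrable Omega (EFin \o W) ->
  (forall phi, test_function Omega phi -> \int[mu]_(x in Omega) (W x * phi x) = 0) ->
  cbox a b `<=` Omega -> measurable E ->
  (\int[mu]_(x in obox a b `&` E) (W x)%:E)%E = 0%E.
Proof.
move=> oO iW W0 abO mE.
have mO : measurable Omega by exact: open_measurable_rV.
have mab : measurable (obox a b) by exact: measurable_obox.
have oabO : obox a b `<=` Omega.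
  by move=> x xab; apply: abO => i; have /andP[/ltW -> /ltW ->] := xab i.
have iab : mu.-integrable (obox a b) (EFin \o W) by exact: integrableS iW.
pose H := [set E | measurable E /\ (\int[mu]_(x in obox a b `&` E) (W x)%:E)%E = 0%E].
suff : (@measurable _ 'rV[R]_d) `<=` H by move=> /(_ _ mE)[].
rewrite measurable_rV_halfspaces.
apply: (@lambda_system_subset _ _ _ setT) => //.
- move=> _ _ [u ->] [v ->]; exists (\row_i Num.max (u ord0 i) (v ord0 i)).
  apply/seteqP; split=> x /=.
    by move=> [ux vx] i; rewrite mxE gt_max ux vx.
  by move=> uvx; split=> i; have := uvx i; rewrite mxE gt_max => /andP[].
- apply/dynkin_lambda_system; split.
  + split; first exact: measurableT.
    by rewrite setIT; exact: (box_integral_eq0 oO).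
  + move=> A [mA A0]; split; first exact: measurableC.
    have mabA : measurable (obox a b `&` A) by exact: measurableI.
    have mabA' : measurable (obox a b `&` ~` A) by apply: measurableI => //; exact: measurableC.
    have := box_integral_eq0 oO iW W0 abO.
    rewrite -[X in (\int[mu]_(x in X) _)%E = _ -> _](setIT (obox a b)) -(setUv A) setIUr.
    rewrite integral_setU//=; last first.
    * by apply/disj_setPS => x [[_ Ax] [_ Ax']].
    * rewrite -setIUr setUv setIT; exact: (measurable_int _ iab).
    by rewrite A0 add0e.
  + move=> F tF HF; split; first by apply: bigcupT_measurable => k; have [] := HF k.
    rewrite setI_bigcupr (@integral_bigcup _ _ _ _ (fun k => obox a b `&` F k) (EFin \o W)).
    * by apply: eseries0 => k _ _; have [] := HF k.
    * exact: trivIset_setIl.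
    * by move=> k; apply: measurableI => //; have [] := HF k.
    * apply: (integrableS mab _ _ iab).
        by apply: bigcupT_measurable => k; apply: measurableI => //; have [] := HF k.
      by move=> x [k _ []].
- move=> _ [u ->]; split.
    rewrite measurable_rV_halfspaces; apply: sub_sigma_algebra.
    by exists u.
  pose a' : 'rV[R]_d := \row_i Num.max (a ord0 i) (u ord0 i).
  rewrite (_ : _ `&` _ = obox a' b).
    apply: (box_integral_eq0 oO) => // x xab; apply: abO => i.
    by have := xab i; rewrite mxE ge_max -andbA => /and3P[-> _ ->].
  apply/seteqP; split=> x /=.
    by move=> [xab ux] i; have := xab i; rewrite mxE gt_max ux andbT.
  by move=> xab; split=> i; have := xab i; rewrite mxE gt_max -andbA => /and3P[? ? ?] //; apply/andP.
Qed.

(** On each box of a countable cover W has zero integral over all measurable subsets,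
hence vanishes almost everywhere. *)
Theorem fundamental_lemma Omega W : open Omega ->
  mu.-integrable Omega (EFin \o W) ->
  (forall phi, test_function Omega phi -> \int[mu]_(x in Omega) (W x * phi x) = 0) ->
  {ae mu, forall x, Omega x -> W x = 0}.
Proof.
move=> oO iW W0.
have mO : measurable Omega by exact: open_measurable_rV.
have [a [b [abO OE]]] := open_countable_boxes d0 oO.
suff : {ae mu, forall x, forall k, obox (a k) (b k) x -> W x = 0}.
  apply: filterS => x xk; rewrite {1}OE => -[k _]; exact: xk.
apply/ae_foralln => k.
have oabO : obox (a k) (b k) `<=` Omega.
  by move=> x xab; apply: (abO k) => i; have /andP[/ltW -> /ltW ->] := xab i.
have mab : measurable (obox (a k) (b k)) by exact: measurable_obox.
have iab : mu.-integrable (obox (a k) (b k)) (EFin \o W) by exact: integrableS iW.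
have := @integral_ae_eq _ _ _ mu _ mab (cst 0%E) (EFin \o W) iab (measurable_cst _).
move=> /(_ _)/(filterS _); apply; first by move=> x /[apply] -[].
move=> E Eab mE; rewrite integral0 -[E](setIidr Eab).
exact: (subset_box_integral_eq0 oO).
Qed.

End fundamental_lemma.

(** * Square integrable functions on a bounded open set *)

Section cauchy_schwarz.
Variables (R : realType) (U : lmodType R) (V : set U) (a : U -> U -> R).
Hypotheses (sV : is_subspace V) (ia : semi_inner V a).

Lemma semi_innerDl w k u v : V u -> V v -> V w ->
  a (k *: u + v) w = k * a u w + a v w.
Proof.
have [asym alin _] := ia; have [_ VP] := sV; move=> Vu Vv Vw.
by rewrite asym//; [rewrite alin// !(asym w)|exact: VP].
Qed.

Lemma semi_inner_sqr k u v : V u -> V v ->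
  a (k *: u + v) (k *: u + v) = k ^+ 2 * a u u + 2 * k * a u v + a v v.
Proof.
have [asym alin _] := ia; have [_ VP] := sV; move=> Vu Vv.
rewrite semi_innerDl//; last exact: VP.
rewrite !alin// (asym v u)//; ring.
Qed.

Lemma cauchy_schwarz u v : V u -> V v ->
  `|a u v| <= Num.sqrt (a u u) * Num.sqrt (a v v).
Proof.
have [asym alin apos] := ia; have [_ VP] := sV; move=> Vu Vv.
have q k : 0 <= k ^+ 2 * a u u + 2 * k * a u v + a v v.
  by rewrite -semi_inner_sqr//; apply/apos/VP.
rewrite -sqrtrM; last exact: apos.
rewrite -sqrtr_sqr ler_wsqrtr//.
have uu := apos u Vu; have vv := apos v Vv.
(* For a null vector u the quadratic polynomial q is affine, and it is
   nonnegative everywhere only if its slope vanishes. *)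
have [u0|un0] := eqVneq (a u u) 0.
  suff -> : a u v = 0 by rewrite expr0n u0 mul0r.
  apply/eqP/negPn/negP => uv0.
  have := q (- (a v v + 1) / (2 * a u v)); rewrite u0 mulr0 add0r.
  rewrite (_ : 2 * _ * _ = - (a v v + 1)); first by lra.
  by field.
have {}uu : 0 < a u u by rewrite lt_neqAle eq_sym un0.
have := q (- a u v / a u u).
rewrite (_ : _ + _ + _ = (a u u * a v v - a u v ^+ 2) / a u u); last by field.
by rewrite pmulr_lge0 ?invr_gt0// subr_ge0.
Qed.

End cauchy_schwarz.

(** A class, for the lemmas below to find these properties of Omega by inference. *)
Class bounded_domain (R : realType) (d : nat) (Omega : set 'rV[R]_d) : Prop :=
  BoundedDomain { domain_dim : (0 < d)%N; domain_open : open Omega;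
    domain_nonempty : Omega !=set0; domain_bounded : bounded_set Omega }.

Arguments domain_dim {R d} Omega {_}.
Arguments domain_open {R d} Omega {_}.
Arguments domain_bounded {R d} Omega {_}.

Section L2.
Variables (R : realType) (d : nat) (Omega : set 'rV[R]_d).
Context {hO : bounded_domain Omega}.
Let d0 : (0 < d)%N. Proof. by case: hO. Qed.
Let oO : open Omega. Proof. by case: hO. Qed.
Let O0 : Omega !=set0. Proof. by case: hO. Qed.
Let bO : bounded_set Omega. Proof. by case: hO. Qed.
Let mu := @lebesgue_rV R d.
Implicit Types (u v w g h : 'rV[R]_d -> R).

Lemma measurable_domain : measurable Omega. Proof. exact: open_measurable_rV. Qed.
Let mO := measurable_domain.

Lemma Omega_finite : (mu Omega < +oo)%E.
Proof.
have [a [b Oab]] := bounded_obox bO.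
have ab i : a ord0 i <= b ord0 i.
  by case: O0 => x /Oab /(_ i) /andP[h1 h2]; exact/ltW/(lt_trans h1 h2).
apply: (@le_lt_trans _ _ (mu (obox a b))).
  by apply: le_measure; rewrite ?inE//; exact: measurable_obox.
by rewrite /mu lebesgue_rV_obox// ltry.
Qed.

Definition ip u v : R := \int[mu]_(x in Omega) (u x * v x).

Lemma L2P u : L2 Omega u <->
  measurable_fun Omega (u : _ -> measurableTypeR R) /\
  mu.-integrable Omega (fun x => (u x ^+ 2)%:E).
Proof.
have E : (fun x => (((u \_ Omega) x) ^+ 2)%:E) =
    ((fun x => (u x ^+ 2)%:E) \_ Omega : _ -> \bar R).
  by apply/funext => x; rewrite !patchE; case: ifPn => _ //; rewrite expr0n.
split=> [Lu|[mu_ iu]].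
  split.
    move: Lu; rewrite /L2 inE => /andP[+ _]; rewrite inE /= => mf.
    exact/(measurable_restrictT _ mO).
  by apply/(integrable_mkcond _ mO); rewrite -E; exact: (Lfun2_integrable_sqr Lu).
rewrite /L2 inE; apply/andP; split; rewrite inE /=.
  exact/(measurable_restrictT _ mO).
rewrite /finite_norm unlock.
apply: poweR_lty.
rewrite (_ : (fun x => _) = (fun x => (u x ^+ 2)%:E) \_ Omega); last first.
  rewrite -E; apply/funext => x /=; rewrite powR_mulrn//.
  by rewrite real_normK ?num_real.
rewrite -integral_mkcond; have /integrableP[_] := iu.
by under [X in (X < _)%E -> _]eq_integral => x _ do rewrite gee0_abs ?lee_fin ?sqr_ge0//.
Qed.

Lemma L2_measurable u : L2 Omega u -> measurable_fun Omega (u : _ -> measurableTypeR R).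
Proof. by move=> /L2P[]. Qed.

Lemma L2_mul_integrable u v : L2 Omega u -> L2 Omega v ->
  mu.-integrable Omega (EFin \o (fun x => u x * v x)).
Proof.
move=> /L2P[mu_ iu] /L2P[mv iv].
apply: (le_integrable mO _ _ (integrableD mO iu iv)).
  by apply/measurable_EFinP; exact: measurable_funM.
move=> x _ /=; rewrite lee_fin normrM [leRHS]ger0_norm ?addr_ge0 ?sqr_ge0//.
rewrite -[u x ^+ 2]real_normK ?num_real// -[v x ^+ 2]real_normK ?num_real//.
have := sqr_ge0 (`|u x| - `|v x|); have := normr_ge0 (u x); have := normr_ge0 (v x).
by move: (`|u x|) (`|v x|) => a b; nra.
Qed.

Lemma le_L2 u v : measurable_fun Omega (u : _ -> measurableTypeR R) -> L2 Omega v ->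
  (forall x, Omega x -> `|u x| <= `|v x|) -> L2 Omega u.
Proof.
move=> mu_ /L2P[mv iv] uv; apply/L2P; split=> //.
apply: (le_integrable mO _ _ iv) => [|x Ox /=].
  by apply/measurable_EFinP; exact: measurable_funX.
by rewrite lee_fin !normrX ler_sqr ?nnegrE// uv.
Qed.

Lemma L2_cst c : L2 Omega (fun=> c).
Proof.
apply/L2P; split; first exact: measurable_cst.
apply/integrableP; split; first exact: measurable_cst.
by rewrite integral_cst// lte_mul_pinfty// ?abse_ge0// Omega_finite.
Qed.

Lemma L2_bounded u M : measurable_fun Omega (u : _ -> measurableTypeR R) ->
  (forall x, Omega x -> `|u x| <= M) -> L2 Omega u.
Proof.
move=> mu_ uM; apply: (le_L2 mu_ (L2_cst M)) => x Ox.
exact: le_trans (uM x Ox) (ler_norm _).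
Qed.

Lemma L2_lin k u v : L2 Omega u -> L2 Omega v -> L2 Omega (k *: u + v).
Proof.
move=> Lu Lv; have [mu_ iu] := (L2P u).1 Lu; have [mv iv] := (L2P v).1 Lv.
apply/L2P; split.
  apply: measurable_funD => //; rewrite /GRing.scale /=.
  by apply: measurable_funM => //; exact: measurable_cst.
have iuv := L2_mul_integrable Lu Lv.
rewrite (_ : (fun x => _) = (fun x => (k ^+ 2)%:E * (u x ^+ 2)%:E +
   ((2 * k)%:E * (u x * v x)%:E + (v x ^+ 2)%:E))%E).
  apply: integrableD => //; first exact: integrableZl.
  by apply: integrableD => //; exact: integrableZl.
apply/funext => x; rewrite -!EFinM -!EFinD; congr EFin.
change ((k * u x + v x) ^+ 2 = k ^+ 2 * u x ^+ 2 + (2 * k * (u x * v x) + v x ^+ 2)); ring.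
Qed.

Lemma L2_0 : L2 Omega 0. Proof. exact: L2_cst. Qed.

Lemma subspace_L2 : is_subspace (L2 Omega).
Proof. by split=> [|k u v]; [exact: L2_0|exact: L2_lin]. Qed.

Lemma L2_mul_bounded u v M : L2 Omega v ->
  measurable_fun Omega (u : _ -> measurableTypeR R) ->
  (forall x, Omega x -> `|u x| <= M) -> L2 Omega (fun x => u x * v x).
Proof.
move=> Lv mu_ uM; have mv := L2_measurable Lv.
have LMv : L2 Omega (`|M| *: v) by apply: subspaceZ => //; exact: subspace_L2.
apply: (le_L2 _ LMv); first exact: measurable_funM.
move=> x Ox; rewrite /GRing.scale /= !normrM ler_wpM2r// normr_id.
exact: le_trans (uM x Ox) (ler_norm _).
Qed.

Lemma L2_integrable u : L2 Omega u -> mu.-integrable Omega (EFin \o u).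
Proof.
move=> Lu; have := L2_mul_integrable Lu (L2_cst 1).
by rewrite (_ : EFin \o (fun x => u x * 1) = EFin \o u)//; apply/funext => x /=; rewrite mulr1.
Qed.

Lemma ipC u v : ip u v = ip v u.
Proof. by apply: eq_Rintegral => x _; rewrite mulrC. Qed.

Lemma ip_lin w : L2 Omega w -> linear_on (L2 Omega) (ip w).
Proof.
move=> Lw k u v Lu Lv; have iwu := L2_mul_integrable Lw Lu.
have iwv := L2_mul_integrable Lw Lv.
have ik : mu.-integrable Omega (EFin \o (fun x => k * (w x * u x))).
  exact: (integrableZl mO k iwu).
rewrite /ip -RintegralZl// -RintegralD//.
by apply: eq_Rintegral => x _; rewrite /= mulrDr mulrCA.
Qed.

Lemma semi_inner_ip : semi_inner (L2 Omega) ip.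
Proof.
split=> [u v _ _|w|u Lu]; [exact: ipC|exact: ip_lin|].
by apply: Rintegral_ge0 => x _; rewrite -expr2 sqr_ge0.
Qed.

Lemma ip_ae w u v : L2 Omega w -> L2 Omega u -> L2 Omega v ->
  {ae mu, forall x, Omega x -> u x = v x} -> ip w u = ip w v.
Proof.
move=> Lw Lu Lv uv; rewrite /ip /Rintegral; congr fine.
have mw := L2_measurable Lw.
apply: ae_eq_integral => //.
- by apply/measurable_EFinP; apply: measurable_funM => //; exact: L2_measurable.
- by apply/measurable_EFinP; apply: measurable_funM => //; exact: L2_measurable.
- by apply: filterS uv => x uv Ox; rewrite uv.
Qed.

Lemma Lp_norm_L2 u : L2 Omega u -> Lp_norm Omega 2 u = (Num.sqrt (ip u u))%:E.
Proof.
move=> Lu; rewrite /Lp_norm unlock.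
have iu := L2_mul_integrable Lu Lu.
rewrite (_ : (fun x => _) = (EFin \o (fun x => u x * u x)) \_ Omega); last first.
  apply/funext => x /=; rewrite powR_mulrn// real_normK ?num_real// !patchE.
  by case: ifPn => _; rewrite ?expr2 ?mul0r.
rewrite -integral_mkcond -(fineK (integrable_fin_num mO iu)) -/(Rintegral _ _ _).
by rewrite -/(ip u u) poweR_EFin powR12_sqrt//; have [_ _] := semi_inner_ip; apply.
Qed.

Lemma L2_norm_ip u : L2 Omega u -> L2_norm Omega u = Num.sqrt (ip u u).
Proof. by move=> Lu; rewrite /L2_norm Lp_norm_L2. Qed.

Lemma cvg_Lp_norm0 (u : nat -> 'rV[R]_d -> R) : (forall k, L2 Omega (u k)) ->
  Lp_norm Omega 2 (u k) @[k --> \oo] --> 0%E <-> ip (u k) (u k) @[k --> \oo] --> (0 : R).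
Proof.
move=> Lu; rewrite (_ : (fun k => _) = fun k => (Num.sqrt (ip (u k) (u k)))%:E); last first.
  by apply/funext => k; rewrite Lp_norm_L2.
split=> [/fine_cvg|] h.
  have h' : Num.sqrt (ip (u k) (u k)) @[k --> \oo] --> (0 : R) by exact: h.
  have := cvgM h' h'; rewrite mulr0.
  rewrite (_ : (_ \* _) = fun k => ip (u k) (u k)); first exact.
  apply/funext => k /=.
  by rewrite -expr2 sqr_sqrtr//; have [_ _] := semi_inner_ip; apply.
apply: cvg_EFin; first exact: nearW.
rewrite -[X in _ --> X](@sqrtr0 R).
by apply: continuous_cvg => //; exact: sqrt_continuous.
Qed.

End L2.

Hint Resolve measurable_domain : core.

(** * Weak derivatives and the space H10 *)

Section weak_derivatives.
Variables (R : realType) (d : nat) (Omega : set 'rV[R]_d).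
Context {hO : bounded_domain Omega}.
Let mu := @lebesgue_rV R d.
Implicit Types (u v w g h phi : 'rV[R]_d -> R).
Let sL : is_subspace (L2 Omega). Proof. exact: subspace_L2. Qed.
Let iL : semi_inner (L2 Omega) (ip Omega). Proof. exact: semi_inner_ip. Qed.

Lemma smooth_continuous phi : smooth phi -> continuous phi.
Proof. by move=> sphi x; apply: differentiable_continuous; exact: (sphi [::]). Qed.

Lemma test_function_partial phi i :
  test_function Omega phi -> test_function Omega (partial i phi).
Proof.
move=> [sphi [K [cK KO phi0]]]; split.
  by move=> s x; rewrite -foldr_rcons; exact: sphi.
exists K; split=> // x Kx.
have oK : open (~` K) by rewrite openC; exact: compact_closed.
rewrite /partial (@near_eq_derive _ _ _ phi (cst 0)) ?derive_cst//.
by apply: filterS (open_nbhs_nbhs (conj oK Kx)) => y Ky; exact: phi0.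
Qed.

Lemma test_function_bounded phi : test_function Omega phi ->
  exists M, forall x, `|phi x| <= M.
Proof.
move=> [/smooth_continuous cphi [K [cK KO phi0]]].
have : bounded_set (phi @` K).
  apply/compact_bounded/continuous_compact => //.
  exact: continuous_subspaceT.
move=> [M [_ MP]]; exists (`|M| + 1) => x.
have [Kx|Kx] := pselect (K x); last by rewrite phi0// normr0 addr_ge0.
apply: (MP (`|M| + 1)); last by exists x.
by rewrite (le_lt_trans (ler_norm _))// ltrDl.
Qed.

Lemma test_function_measurable phi D : test_function Omega phi ->
  measurable_fun D (phi : _ -> measurableTypeR R).
Proof.
move=> [/smooth_continuous cphi _]; apply: measurable_funTS.
by apply: continuous_measurable_rV => //; exact: (domain_dim Omega).
Qed.

Lemma test_function_L2 phi : test_function Omega phi -> L2 Omega phi.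
Proof.
move=> tphi; have [M phiM] := test_function_bounded tphi.
by apply: (@L2_bounded _ _ _ _ _ M) => //; exact: test_function_measurable.
Qed.

Lemma partial_lin i k phi psi :
  (forall x, differentiable phi x) -> (forall x, differentiable psi x) ->
  partial i (k *: phi + psi) = k *: partial i phi + partial i psi.
Proof.
move=> sphi spsi; apply/funext => x; rewrite /partial.
have dphi : derivable phi x (delta_mx 0 i) by exact/diff_derivable/sphi.
have dpsi : derivable psi x (delta_mx 0 i) by exact/diff_derivable/spsi.
have dkphi : derivable (k *: phi) x (delta_mx 0 i) by exact: derivableZ.
by rewrite (deriveD dkphi dpsi) deriveZ.
Qed.

Lemma test_function_lin k phi psi : test_function Omega phi ->
  test_function Omega psi -> test_function Omega (k *: phi + psi).
Proof.
move=> [sphi [K [cK KO phi0]]] [spsi [L [cL LO psi0]]].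
have E s : foldr partial (k *: phi + psi) s =
    k *: foldr partial phi s + foldr partial psi s.
  elim: s => //= i s ->; apply: partial_lin => x; [exact: sphi|exact: spsi].
split.
  move=> s x; rewrite E; apply: differentiableD; last exact: spsi.
  by apply: differentiableZ; exact: sphi.
exists (K `|` L); split.
- exact: compactU.
- by move=> x [/KO|/LO].
- move=> x /not_orP[Kx Lx].
  change (k * phi x + psi x = 0).
  by rewrite phi0// psi0// mulr0 addr0.
Qed.

Lemma test_function0 : test_function Omega 0.
Proof.
have E s : foldr (@partial R d) (0 : 'rV[R]_d -> R) s = 0.
  elim: s => //= i s ->; apply/funext => x; rewrite /partial.
  by rewrite (_ : 0 = cst 0)// derive_cst.
split; first by move=> s x; rewrite E; exact: differentiable_cst.
by exists set0; split=> //; exact: compact0.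
Qed.

(** The difference of two weak derivatives is orthogonal to all test functions. *)
Lemma is_weak_partial_unique i u g h : is_weak_partial Omega i u g ->
  is_weak_partial Omega i u h -> {ae mu, forall x, Omega x -> g x = h x}.
Proof.
move=> [Lg gP] [Lh hP].
have Lgh : L2 Omega (g - h) by apply: subspaceB.
suff gh0 : {ae mu, forall x, Omega x -> (g - h) x = 0}.
  by apply: filterS gh0 => x /[apply] /eqP; rewrite subr_eq0 => /eqP.
apply: (fundamental_lemma (domain_dim Omega) (domain_open Omega) (L2_integrable Lgh)).
move=> phi tphi; have Lphi := test_function_L2 tphi.
change (ip Omega (g - h) phi = 0); rewrite ipC (linear_onB (ip_lin Lphi))//.
rewrite ![ip _ phi _]ipC /ip; apply/eqP; rewrite subr_eq0 -eqr_opp.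
by rewrite -gP// -hP.
Qed.

Lemma is_weak_partial_lin i k u v g h : L2 Omega u -> L2 Omega v ->
  is_weak_partial Omega i u g -> is_weak_partial Omega i v h ->
  is_weak_partial Omega i (k *: u + v) (k *: g + h).
Proof.
move=> Lu Lv [Lg gP] [Lh hP]; split; first exact: L2_lin.
move=> phi tphi; have Lphi := test_function_L2 tphi.
have Ldphi := test_function_L2 (test_function_partial i tphi).
change (ip Omega (k *: u + v) (partial i phi) = - ip Omega (k *: g + h) phi).
rewrite ipC (ip_lin Ldphi)// ipC [ip _ _ v]ipC.
rewrite [ip _ (k *: g + h) _]ipC (ip_lin Lphi)// ![ip _ phi _]ipC.
by rewrite /ip gP// hP// opprD mulrN.
Qed.

(** Functions equal on Omega have the same weak derivatives, hence the same chosen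
one: the equality is not only almost everywhere. *)
Lemma eq_weak_partial i u v : (forall x, Omega x -> u x = v x) ->
  weak_partial Omega i u = weak_partial Omega i v.
Proof.
move=> uv; rewrite /weak_partial; congr get; apply/funext => g; apply/propext.
suff E phi : \int[mu]_(x in Omega) (u x * partial i phi x) =
             \int[mu]_(x in Omega) (v x * partial i phi x).
  by split=> -[Lg gP]; split=> // phi tphi; have := gP phi tphi; rewrite /mu E.
by apply: eq_Rintegral => x; rewrite inE => /uv ->.
Qed.

Lemma H1_weak_partial i u : H1_space Omega u ->
  is_weak_partial Omega i u (weak_partial Omega i u).
Proof. by move=> [_ /(_ i)[g gP]]; exact: (@getI _ (is_weak_partial Omega i u) g). Qed.

Lemma H1_weak_partial_L2 i u : H1_space Omega u -> L2 Omega (weak_partial Omega i u).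
Proof. by move=> /(H1_weak_partial i)[]. Qed.

Lemma H1_lin k u v : H1_space Omega u -> H1_space Omega v ->
  H1_space Omega (k *: u + v).
Proof.
move=> Hu Hv; have [[Lu _] [Lv _]] := (Hu, Hv); split; first exact: L2_lin.
move=> i; exists (k *: weak_partial Omega i u + weak_partial Omega i v).
by apply: is_weak_partial_lin => //; exact: H1_weak_partial.
Qed.

(** The choice of a representative does not commute with linear combinations, and
the equality holds where the uniqueness of weak derivatives puts it. *)
Lemma weak_partial_lin i k u v : H1_space Omega u -> H1_space Omega v ->
  {ae mu, forall x, Omega x -> weak_partial Omega i (k *: u + v) x =
    (k *: weak_partial Omega i u + weak_partial Omega i v) x}.
Proof.
move=> Hu Hv; have [[Lu _] [Lv _]] := (Hu, Hv).
apply: (@is_weak_partial_unique i (k *: u + v)).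
  exact/H1_weak_partial/H1_lin.
by apply: is_weak_partial_lin => //; exact: H1_weak_partial.
Qed.

Lemma ip_lin_sqr_le k u v : L2 Omega u -> L2 Omega v ->
  ip Omega (k *: u + v) (k *: u + v) <=
  2 * k ^+ 2 * ip Omega u u + 2 * ip Omega v v.
Proof.
move=> Lu Lv.
have [_ _ apos] := iL.
have := apos (- k *: u + v); rewrite !(semi_inner_sqr sL iL)// sqrrN => h.
have := h (L2_lin (hO := hO) (- k) Lu Lv); nra.
Qed.

Lemma cvg_ip_lin k (u v : nat -> 'rV[R]_d -> R) :
  (forall n, L2 Omega (u n)) -> (forall n, L2 Omega (v n)) ->
  ip Omega (u n) (u n) @[n --> \oo] --> (0 : R) ->
  ip Omega (v n) (v n) @[n --> \oo] --> (0 : R) ->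
  ip Omega (k *: u n + v n) (k *: u n + v n) @[n --> \oo] --> (0 : R).
Proof.
move=> Lu Lv u0 v0.
apply: (@squeeze_cvgr _ _ _ _ (cst 0) (fun n => 2 * k ^+ 2 * ip Omega (u n) (u n) +
   2 * ip Omega (v n) (v n))).
- apply: nearW => n; rewrite ip_lin_sqr_le// andbT.
  by have [_ _ apos] := iL; exact/apos/L2_lin.
- exact: cvg_cst.
- rewrite -[X in _ --> X](_ : 2 * k ^+ 2 * 0 + 2 * 0 = 0); last by rewrite !mulr0 addr0.
  by apply: cvgD; apply: cvgM => //; exact: cvg_cst.
Qed.

Lemma H10_H1 u : H10 Omega u -> H1_space Omega u. Proof. by case. Qed.

Lemma H10_L2 u : H10 Omega u -> L2 Omega u. Proof. by case=> -[]. Qed.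

Lemma H10_partial_L2 i u : H10 Omega u -> L2 Omega (weak_partial Omega i u).
Proof. by move=> /H10_H1; exact: H1_weak_partial_L2. Qed.

(** The combinations of the approximating test functions converge in the norm of
H^1, by the inequality (k x + y)^2 <= 2 k^2 x^2 + 2 y^2. *)
Lemma H10_lin k u v : H10 Omega u -> H10 Omega v -> H10 Omega (k *: u + v).
Proof.
move=> [Hu [phi [tphi phiu dphiu]]] [Hv [psi [tpsi psiv dpsiv]]].
have [[Lu _] [Lv _]] := (Hu, Hv).
split; first exact: H1_lin.
have LB f g : L2 Omega f -> L2 Omega g -> L2 Omega (f - g).
  by move=> Lf Lg; apply: subspaceB.
have reg (f g f' g' : 'rV[R]_d -> R) :
    k *: f + g - (k *: f' + g') = k *: (f - f') + (g - g').
  by rewrite scalerBr opprD addrACA.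
exists (fun n => k *: phi n + psi n); split.
- by move=> n; exact: test_function_lin.
- have Lphi n := test_function_L2 (tphi n); have Lpsi n := test_function_L2 (tpsi n).
  apply/cvg_Lp_norm0 => [n|]; first by apply: LB; exact: L2_lin.
  under eq_fun do rewrite reg.
  apply: cvg_ip_lin => [n|n||]; try exact: LB.
  + by apply/cvg_Lp_norm0 => // n; exact: LB.
  + by apply/cvg_Lp_norm0 => // n; exact: LB.
- move=> i.
  have Lphi n := test_function_L2 (test_function_partial i (tphi n)).
  have Lpsi n := test_function_L2 (test_function_partial i (tpsi n)).
  have Lwu := H1_weak_partial_L2 i Hu; have Lwv := H1_weak_partial_L2 i Hv.
  have Lw : L2 Omega (weak_partial Omega i (k *: u + v)).
    exact/H1_weak_partial_L2/H1_lin.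
  have E n : partial i (k *: phi n + psi n) = k *: partial i (phi n) + partial i (psi n).
    have [dphi _] := tphi n; have [dpsi _] := tpsi n.
    by apply: partial_lin => x; [exact: (dphi [::])|exact: (dpsi [::])].
  apply/cvg_Lp_norm0 => [n|]; first by rewrite E; apply: LB => //; exact: L2_lin.
  (* The chosen derivative of k u + v is replaced by the combination of the chosen
     ones, which changes no integral. *)
  pose w' := k *: weak_partial Omega i u + weak_partial Omega i v.
  have Lw' : L2 Omega w' by exact: L2_lin.
  have F n : ip Omega (partial i (k *: phi n + psi n) - weak_partial Omega i (k *: u + v))
                (partial i (k *: phi n + psi n) - weak_partial Omega i (k *: u + v)) =
      ip Omega (k *: (partial i (phi n) - weak_partial Omega i u) + (partial i (psi n) - weak_partial Omega i v))
               (k *: (partial i (phi n) - weak_partial Omega i u) + (partial i (psi n) - weak_partial Omega i v)).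
    rewrite -reg -/w' E; set f := k *: _ + _.
    have Lf : L2 Omega f by exact: L2_lin.
    have ae : {ae mu, forall x, Omega x -> (f - weak_partial Omega i (k *: u + v)) x = (f - w') x}.
      apply: filterS (weak_partial_lin i k Hu Hv) => x + Ox => /(_ Ox) e.
      by congr (_ - _).
    rewrite (ip_ae _ _ _ ae); try exact: LB.
    by rewrite ipC (ip_ae _ _ _ ae)//; exact: LB.
  under eq_fun do rewrite F.
  apply: cvg_ip_lin => [n|n||]; try exact: LB.
  + by apply/cvg_Lp_norm0 => // n; exact: LB.
  + by apply/cvg_Lp_norm0 => // n; exact: LB.
Qed.

Lemma is_weak_partial0 i : is_weak_partial Omega i 0 0.
Proof.
split; first exact: L2_0.
move=> phi tphi; change (ip Omega 0 (partial i phi) = - ip Omega 0 phi).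
have Lphi := test_function_L2 tphi.
have Ldphi := test_function_L2 (test_function_partial i tphi).
rewrite !(ipC _ 0) (linear_on0 sL (ip_lin Lphi)).
by rewrite (linear_on0 sL (ip_lin Ldphi)) oppr0.
Qed.

Lemma weak_partial0 i :
  {ae mu, forall x, Omega x -> weak_partial Omega i (0 : 'rV[R]_d -> R) x = 0}.
Proof.
have w0 := is_weak_partial0 i.
apply: (is_weak_partial_unique _ w0).
exact: (@getI _ (is_weak_partial Omega i 0) 0).
Qed.

Lemma H10_0 : H10 Omega 0.
Proof.
have H1_0 : H1_space Omega (0 : 'rV[R]_d -> R).
  by split=> [|i]; [exact: L2_0|exists 0; exact: is_weak_partial0].
split=> //; exists (fun=> 0); split.
- by move=> _; exact: test_function0.
- apply/cvg_Lp_norm0 => [n|]; first by rewrite subr0; exact: L2_0.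
  rewrite subr0 (linear_on0 sL (ip_lin (@L2_0 R d Omega hO))); exact: cvg_cst.
- move=> i.
  have L0 : L2 Omega (weak_partial Omega i (0 : 'rV[R]_d -> R)) by exact: H1_weak_partial_L2.
  have Ld : L2 Omega (partial i (0 : 'rV[R]_d -> R)).
    exact/test_function_L2/test_function_partial/test_function0.
  have d0 : partial i (0 : 'rV[R]_d -> R) = 0.
    by apply/funext => x; rewrite /partial (_ : 0 = cst 0)// derive_cst.
  have LB : L2 Omega (partial i (0 : 'rV[R]_d -> R) - weak_partial Omega i 0).
    by apply: subspaceB.
  apply/cvg_Lp_norm0 => // .
  rewrite (ip_ae (v := 0))//; [|exact: L2_0|].
    rewrite (linear_on0 sL (ip_lin LB)); exact: cvg_cst.
  apply: filterS (weak_partial0 i) => x + Ox => /(_ Ox) e.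
  by change (partial i (0 : 'rV[R]_d -> R) x - weak_partial Omega i 0 x = 0); rewrite d0 e subr0.
Qed.

Lemma subspace_H10 : is_subspace (H10 Omega).
Proof. by split=> [|k u v]; [exact: H10_0|exact: H10_lin]. Qed.

End weak_derivatives.

(** * Fields of matrices and gradients *)

Section matrix_L2.
Variables (R : realType) (d : nat) (Omega : set 'rV[R]_d).
Context {hO : bounded_domain Omega}.
Let mu := @lebesgue_rV R d.
Let mO : measurable Omega. Proof. exact: measurable_domain. Qed.

Lemma integrable_Rintegral_sum n (F : 'I_n -> 'rV[R]_d -> R) :
  (forall i, mu.-integrable Omega (EFin \o F i)) ->
  mu.-integrable Omega (EFin \o (fun x => \sum_i F i x)) /\
  \int[mu]_(x in Omega) (\sum_i F i x) = \sum_i \int[mu]_(x in Omega) F i x.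
Proof.
elim: n F => [|n IH] F iF.
  rewrite big_ord0 (_ : (fun x => _) = fun=> 0); last first.
    by apply/funext => x; rewrite big_ord0.
  by split; [exact: integrable0|rewrite Rintegral_cst// mul0r].
have [iS eS] := IH _ (fun i => iF (lift ord0 i)).
rewrite (_ : (fun x => \sum_i F i x) =
   fun x => F ord0 x + \sum_(i < n) F (lift ord0 i) x); last first.
  by apply/funext => x; rewrite big_ord_recl.
split.
  rewrite (_ : EFin \o _ = (EFin \o F ord0) \+ (EFin \o (fun x => \sum_(i < n) F (lift ord0 i) x))).
    exact: integrableD.
  by apply/funext => x /=; rewrite EFinD.
by rewrite RintegralD// eS big_ord_recl.
Qed.

Section fixed_size.
Variables m n : nat.
Implicit Types A B C : 'rV[R]_d -> 'M[R]_(m, n).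

Definition L2m A : Prop := forall i j, L2 Omega (fun x => A x i j).

Definition ipm A B : R := \int[mu]_(x in Omega) mdot (A x) (B x).

Lemma ipmE A B : L2m A -> L2m B ->
  mu.-integrable Omega (EFin \o (fun x => mdot (A x) (B x))) /\
  ipm A B = \sum_i \sum_j ip Omega (fun x => A x i j) (fun x => B x i j).
Proof.
move=> LA LB.
have iij i j : mu.-integrable Omega (EFin \o (fun x => A x i j * B x i j)).
  exact: L2_mul_integrable.
have ii i := integrable_Rintegral_sum (iij i).
have [i0 e0] := integrable_Rintegral_sum (fun i => (ii i).1).
split=> //; rewrite /ipm /mdot e0; apply: eq_bigr => i _.
by rewrite (ii i).2.
Qed.

Lemma ipm_integrable A B : L2m A -> L2m B ->
  mu.-integrable Omega (EFin \o (fun x => mdot (A x) (B x))).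
Proof. by move=> LA LB; have [] := ipmE LA LB. Qed.

Lemma L2m_lin k A B : L2m A -> L2m B -> L2m (k *: A + B).
Proof.
move=> LA LB i j.
rewrite (_ : (fun x => _) = k *: (fun x => A x i j) + (fun x => B x i j)).
  exact: L2_lin.
by apply/funext => x; rewrite !mxE.
Qed.

Lemma L2m0 : L2m 0.
Proof.
move=> i j; rewrite (_ : (fun x => _) = 0); first exact: L2_0.
by apply/funext => x; rewrite mxE.
Qed.

Lemma subspace_L2m : is_subspace L2m.
Proof. by split=> [|k A B]; [exact: L2m0|exact: L2m_lin]. Qed.

Lemma ipmC A B : ipm A B = ipm B A.
Proof. by apply: eq_Rintegral => x _; rewrite mdotC. Qed.

Lemma semi_inner_ipm : semi_inner L2m ipm.
Proof.
split=> [A B _ _|C LC k A B LA LB|A _]; first exact: ipmC.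
  have iA := ipm_integrable LC LA; have iB := ipm_integrable LC LB.
  have ikA : mu.-integrable Omega (EFin \o (fun x => k * mdot (C x) (A x))).
    exact: (integrableZl mO k iA).
  rewrite /ipm -RintegralZl// -RintegralD//.
  by apply: eq_Rintegral => x _ /=; rewrite -mdotZr -mdotDr.
by apply: Rintegral_ge0 => x _; exact: mdot_ge0.
Qed.

Lemma ipm_ae C A B : L2m C -> L2m A -> L2m B ->
  {ae mu, forall x, Omega x -> A x = B x} -> ipm C A = ipm C B.
Proof.
move=> LC LA LB AB; rewrite (ipmE LC LA).2 (ipmE LC LB).2.
apply: eq_bigr => i _; apply: eq_bigr => j _; apply: ip_ae => //.
by apply: filterS AB => x AB Ox; rewrite AB.
Qed.

Lemma measurable_mnorm A : L2m A ->
  measurable_fun Omega ((fun x => mnorm (A x)) : _ -> measurableTypeR R).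
Proof.
move=> LA; rewrite /mnorm.
apply: (@measurableT_comp _ _ _ _ _ _ (@Num.sqrt R)).
  exact: continuous_measurable_fun (@sqrt_continuous R).
rewrite /mdot; apply: measurable_sum => i; apply: measurable_sum => j.
by apply: measurable_funM; exact: L2_measurable.
Qed.

Lemma L2_mnorm A : L2m A -> L2 Omega (fun x => mnorm (A x)).
Proof.
move=> LA; apply/L2P; split; first exact: measurable_mnorm.
rewrite (_ : (fun x => _) = EFin \o (fun x => mdot (A x) (A x))).
  exact: ipm_integrable.
by apply/funext => x; rewrite sqr_mnorm.
Qed.

Lemma ip_mnorm A : ip Omega (fun x => mnorm (A x)) (fun x => mnorm (A x)) = ipm A A.
Proof. by apply: eq_Rintegral => x _; rewrite -expr2 sqr_mnorm. Qed.

Lemma L2_norm_mnorm A : L2m A ->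
  L2_norm Omega (fun x => mnorm (A x)) = Num.sqrt (ipm A A).
Proof. by move=> LA; rewrite L2_norm_ip ?ip_mnorm//; exact: L2_mnorm. Qed.

Lemma L2m_scale (c : 'rV[R]_d -> R) M A : L2m A ->
  measurable_fun Omega (c : _ -> measurableTypeR R) ->
  (forall x, Omega x -> `|c x| <= M) -> L2m (fun x => c x *: A x).
Proof.
move=> LA mc cM i j; rewrite (_ : (fun x => _) = fun x => c x * A x i j).
  exact: (@L2_mul_bounded _ _ _ _ c _ M).
by apply/funext => x; rewrite mxE.
Qed.

End fixed_size.

Lemma mdot_cauchy_schwarz m n (A B : 'M[R]_(m, n)) :
  `|mdot A B| <= mnorm A * mnorm B.
Proof.
apply: (@cauchy_schwarz _ _ setT (@mdot R m n)) => //.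
split=> [u v _ _|w _ k u v _ _|u _]; first exact: mdotC.
  by rewrite mdotDr mdotZr.
exact: mdot_ge0.
Qed.

Section gradients.
Implicit Types (u v w : 'rV[R]_d -> 'rV[R]_d) (S T : 'rV[R]_d -> R).

Lemma component_lin k u v i :
  component (k *: u + v) i = k *: component u i + component v i.
Proof. by apply/funext => x; rewrite /component !mxE. Qed.

Lemma subspace_H10v : is_subspace (H10v Omega).
Proof.
split=> [i|k u v Hu Hv i]; last by rewrite component_lin; exact: H10_lin.
rewrite (_ : component 0 i = 0); first exact: H10_0.
by apply/funext => x; rewrite /component mxE.
Qed.

Lemma L2m_gradv v : H10v Omega v -> L2m (gradv Omega v).
Proof.
move=> Hv i j; rewrite (_ : (fun x => _) = weak_partial Omega j (component v i)).
  exact: H10_partial_L2.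
by apply/funext => x; rewrite mxE.
Qed.

Lemma L2m_grad T : H10 Omega T -> L2m (grad Omega T).
Proof.
move=> HT i j; rewrite (_ : (fun x => _) = weak_partial Omega j T).
  exact: H10_partial_L2.
by apply/funext => x; rewrite mxE.
Qed.

Lemma L2m_field v : H10v Omega v -> L2m v.
Proof. by move=> Hv i j; rewrite ord1; exact: (H10_L2 (Hv j)). Qed.

Lemma gradv_lin k u v : H10v Omega u -> H10v Omega v ->
  {ae mu, forall x, Omega x ->
    gradv Omega (k *: u + v) x = (k *: gradv Omega u + gradv Omega v) x}.
Proof.
move=> Hu Hv.
have h i j : {ae mu, forall x, Omega x ->
    weak_partial Omega j (component (k *: u + v) i) x =
    (k *: weak_partial Omega j (component u i) + weak_partial Omega j (component v i)) x}.
  by rewrite component_lin; apply: weak_partial_lin; exact: H10_H1.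
have : {ae mu, forall x, forall i j, Omega x ->
    weak_partial Omega j (component (k *: u + v) i) x =
    (k *: weak_partial Omega j (component u i) + weak_partial Omega j (component v i)) x}.
  by apply: filter_forall => i; apply: filter_forall => j; exact: h.
apply: filterS => x hx Ox; apply/matrixP => i j; rewrite !mxE hx//.
Qed.

Lemma grad_lin k S T : H10 Omega S -> H10 Omega T ->
  {ae mu, forall x, Omega x ->
    grad Omega (k *: S + T) x = (k *: grad Omega S + grad Omega T) x}.
Proof.
move=> HS HT.
have h j : {ae mu, forall x, Omega x -> weak_partial Omega j (k *: S + T) x =
    (k *: weak_partial Omega j S + weak_partial Omega j T) x}.
  by apply: weak_partial_lin; exact: H10_H1.
have : {ae mu, forall x, forall j, Omega x -> weak_partial Omega j (k *: S + T) x =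
    (k *: weak_partial Omega j S + weak_partial Omega j T) x}.
  by apply: filter_forall => j; exact: h.
by apply: filterS => x hx Ox; apply/rowP => j; rewrite !mxE hx.
Qed.

Lemma ipm_gradv_lin (W : 'rV[R]_d -> 'M[R]_d) : L2m W ->
  linear_on (H10v Omega) (fun v => ipm W (gradv Omega v)).
Proof.
move=> LW k u v Hu Hv.
have Lu := L2m_gradv Hu; have Lv := L2m_gradv Hv.
have [_ lin _] := semi_inner_ipm d d; rewrite -(lin _ LW)//.
have [_ HP] := subspace_H10v.
exact: (ipm_ae LW (L2m_gradv (HP k _ _ Hu Hv)) (L2m_lin k Lu Lv) (gradv_lin k Hu Hv)).
Qed.

Lemma ipm_grad_lin (W : 'rV[R]_d -> 'rV[R]_d) : L2m W ->
  linear_on (H10 Omega) (fun T => ipm W (grad Omega T)).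
Proof.
move=> LW k u v Hu Hv.
have Lu := L2m_grad Hu; have Lv := L2m_grad Hv.
have [_ lin _] := semi_inner_ipm 1 d; rewrite -(lin _ LW)//.
exact: (ipm_ae LW (L2m_grad (H10_lin k Hu Hv)) (L2m_lin k Lu Lv) (grad_lin k Hu Hv)).
Qed.

Definition aV u v : R := ipm (gradv Omega u) (gradv Omega v).
Definition aT S T : R := ipm (grad Omega S) (grad Omega T).

Lemma semi_inner_aV : semi_inner (H10v Omega) aV.
Proof.
split=> [u v _ _|w Hw|u Hu]; first exact: ipmC.
  exact/ipm_gradv_lin/L2m_gradv.
by have [_ _] := semi_inner_ipm d d; apply; exact: L2m_gradv.
Qed.

Lemma semi_inner_aT : semi_inner (H10 Omega) aT.
Proof.
split=> [u v _ _|w Hw|u Hu]; first exact: ipmC.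
  exact/ipm_grad_lin/L2m_grad.
by have [_ _] := semi_inner_ipm 1 d; apply; exact: L2m_grad.
Qed.

Lemma gradv_normE v : H10v Omega v -> gradv_norm Omega v = Num.sqrt (aV v v).
Proof. by move=> Hv; rewrite /gradv_norm L2_norm_mnorm//; exact: L2m_gradv. Qed.

Lemma grad_normE T : H10 Omega T -> grad_norm Omega T = Num.sqrt (aT T T).
Proof. by move=> HT; rewrite /grad_norm L2_norm_mnorm//; exact: L2m_grad. Qed.

End gradients.

End matrix_L2.

(** * Dual norms and the linear dependence of the forms *)

Lemma lipschitz_continuous (R : realType) (f : R -> R) : lipschitz f -> continuous f.
Proof.
move=> [M [Mr MP]] x; apply/cvgrPdist_lt => e e0.
pose k := `|M| + 1; have k0 : 0 < k by rewrite ltr_wpDl.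
have kf y : `|f x - f y| <= k * `|x - y|.
  by apply: (MP k _ (x, y)) => //; rewrite /k (le_lt_trans (ler_norm _))// ltrDl.
have ek : 0 < e / k by rewrite divr_gt0.
apply: filterS (nbhsx_ballx x _ ek) => y xy.
by rewrite (le_lt_trans (kf y))// mulrC -ltr_pdivlMr.
Qed.

Section dual.
Variables (R : realType) (U : lmodType R) (V : set U) (N : U -> R) (f : U -> R).
Hypotheses (sV : is_subspace V) (df : dual_space V N f).
Hypotheses (N0 : forall v, V v -> 0 <= N v)
  (NZ : forall k v, V v -> N (k *: v) = `|k| * N v).

Lemma dual_linear : linear_on V f. Proof. by have [lf _] := df. Qed.

Lemma dual_norm_ge0 : 0 <= dual_norm V N f.
Proof.
have [V0 _] := sV; have [_ [C fC]] := df.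
have N00 : N 0 = 0 by rewrite -(scale0r 0) NZ// normr0 mul0r.
apply: (@le_trans _ _ `|f 0|) => //; apply: sup_ubound.
  exists `|C| => _ [v [Vv Nv1] <-]; rewrite (le_trans (fC v Vv))//.
  rewrite (le_trans (ler_wpM2r (N0 Vv) (ler_norm C)))// ler_piMr//.
by exists 0 => //; split=> //; rewrite N00.
Qed.

(** On a vector of norm zero the functional vanishes because it is bounded; the
others are rescaled to norm one. *)
Lemma le_dual_norm v : V v -> `|f v| <= dual_norm V N f * N v.
Proof.
move=> Vv; have [lf [C fC]] := df.
have [Nv0|Nv0] := eqVneq (N v) 0.
  by have := fC v Vv; rewrite Nv0 !mulr0.
have {}Nv0 : 0 < N v by rewrite lt_neqAle eq_sym Nv0 N0.
rewrite -ler_pdivrMr//.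
have -> : `|f v| / N v = `|f ((N v)^-1 *: v)|.
  rewrite (linear_onZ sV dual_linear)// normrM [`|_^-1|]gtr0_norm ?invr_gt0//.
  by rewrite mulrC.
apply: sup_ubound.
  exists `|C| => _ [w [Vw Nw1] <-]; rewrite (le_trans (fC w Vw))//.
  rewrite (le_trans (ler_wpM2r (N0 Vw) (ler_norm C)))// ler_piMr//.
exists ((N v)^-1 *: v) => //; split; first exact: subspaceZ.
by rewrite NZ// gtr0_norm ?invr_gt0// mulVf ?gt_eqF.
Qed.

End dual.

Section forms.
Variables (R : realType) (d : nat) (Omega : set 'rV[R]_d).
Context {hO : bounded_domain Omega}.
Let mu := @lebesgue_rV R d.
Let mO : measurable Omega. Proof. exact: measurable_domain. Qed.
Let sL : is_subspace (L2 Omega). Proof. exact: subspace_L2. Qed.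
Implicit Types (u v w : 'rV[R]_d -> 'rV[R]_d) (q S T : 'rV[R]_d -> R).

Lemma gradv_norm_ge0 v : H10v Omega v -> 0 <= gradv_norm Omega v.
Proof. by move=> Hv; rewrite gradv_normE// sqrtr_ge0. Qed.

Lemma grad_norm_ge0 S : H10 Omega S -> 0 <= grad_norm Omega S.
Proof. by move=> HS; rewrite grad_normE// sqrtr_ge0. Qed.

Lemma gradv_normZ k v : H10v Omega v ->
  gradv_norm Omega (k *: v) = `|k| * gradv_norm Omega v.
Proof.
move=> Hv; have sH := @subspace_H10v R d Omega hO; have [asym alin _] := @semi_inner_aV R d Omega hO.
have Hkv : H10v Omega (k *: v) by exact: (subspaceZ _ sH Hv).
rewrite !gradv_normE// (linear_onZ sH (alin _ Hkv))// asym//.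
rewrite (linear_onZ sH (alin _ Hv))// mulrA -expr2 sqrtrM ?sqr_ge0//.
by rewrite sqrtr_sqr.
Qed.

Lemma grad_normZ k S : H10 Omega S ->
  grad_norm Omega (k *: S) = `|k| * grad_norm Omega S.
Proof.
move=> Hv; have sH := @subspace_H10 R d Omega hO; have [asym alin _] := @semi_inner_aT R d Omega hO.
have Hkv : H10 Omega (k *: S) by exact: (subspaceZ _ sH Hv).
rewrite !grad_normE// (linear_onZ sH (alin _ Hkv))// asym//.
rewrite (linear_onZ sH (alin _ Hv))// mulrA -expr2 sqrtrM ?sqr_ge0//.
by rewrite sqrtr_sqr.
Qed.

Definition bounded_on (f : 'rV[R]_d -> R) := exists M, forall x, Omega x -> `|f x| <= M.
(** For such fields the integrands of all the forms are products of two functions of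
L^2, so that the integrals of their sums split. *)
Definition bounded_field v := H10v Omega v /\ forall i, bounded_on (component v i).

Section convection.

Let skew_half_lin (k a b c e : R) :
  2^-1 * (k * a + b - (k * c + e)) = k * (2^-1 * (a - c)) + 2^-1 * (b - e).
Proof. ring. Qed.

(** The field of matrices w_i v_j, whose pairing with grad u is the integrand of
a_N at (v, u, w). *)
Definition tensor v w (x : 'rV[R]_d) : 'M[R]_d := (w x)^T *m v x.

Lemma L2m_tensor v w : bounded_field v -> H10v Omega w -> L2m Omega (tensor v w).
Proof.
move=> [Hv Bv] Hw i j; rewrite (_ : (fun x => _) = fun x => component v j x * component w i x).
  have [M vM] := Bv j.
  apply: (@L2_mul_bounded _ _ _ _ (component v j) _ M) => //; first exact: H10_L2.
  exact: (L2_measurable (H10_L2 (Hv j))).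
by apply/funext => x; rewrite /tensor mxE big_ord1 mxE mulrC.
Qed.

Lemma tensor_linl k u v w : tensor (k *: u + v) w = k *: tensor u w + tensor v w.
Proof. by apply/funext => x; rewrite /tensor mulmxDr -scalemxAr. Qed.

Lemma tensor_linr k u v w : tensor u (k *: v + w) = k *: tensor u v + tensor u w.
Proof.
apply/funext => x; rewrite /tensor.
by rewrite (_ : (k *: v + w) x = k *: v x + w x)// linearD linearZ /= mulmxDl -scalemxAl.
Qed.

Lemma a_NE u v w : a_N Omega u v w = ipm Omega (tensor u w) (gradv Omega v).
Proof.
apply: eq_Rintegral => x _; rewrite /mdot big_ord1 /tensor.
rewrite (eq_bigr (fun i => \sum_j u x ord0 j * gradv Omega v x i j * w x ord0 i)).
  apply: eq_bigr => i _; apply: eq_bigr => j _.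
  by rewrite [(_ *m _) _ _]mxE big_ord1 [(_^T) _ _]mxE; ring.
move=> i _; rewrite [(_ *m _) _ _]mxE mulr_suml; apply: eq_bigr => j _.
by rewrite [(_^T) _ _]mxE.
Qed.

Lemma a_N_lin1 k u u' v w : bounded_field u -> bounded_field u' ->
  H10v Omega v -> H10v Omega w ->
  a_N Omega (k *: u + u') v w = k * a_N Omega u v w + a_N Omega u' v w.
Proof.
move=> Bu Bu' Hv Hw; rewrite !a_NE tensor_linl.
rewrite (semi_innerDl (subspace_L2m _ _) (semi_inner_ipm _ _))//.
- exact: L2m_tensor.
- exact: L2m_tensor.
- exact: L2m_gradv.
Qed.

Lemma a_N_lin2 u w : bounded_field u -> H10v Omega w ->
  linear_on (H10v Omega) (fun v => a_N Omega u v w).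
Proof.
move=> Bu Hw k v v' Hv Hv'; rewrite !a_NE.
by rewrite (ipm_gradv_lin (L2m_tensor Bu Hw)).
Qed.

Lemma a_N_lin3 u v : bounded_field u -> H10v Omega v ->
  linear_on (H10v Omega) (fun w => a_N Omega u v w).
Proof.
move=> Bu Hv k w w' Hw Hw'; rewrite !a_NE tensor_linr.
rewrite (semi_innerDl (subspace_L2m _ _) (semi_inner_ipm _ _))//.
- exact: L2m_tensor.
- exact: L2m_tensor.
- exact: L2m_gradv.
Qed.

Definition temp_flux v S (x : 'rV[R]_d) : 'rV[R]_d := S x *: v x.

Lemma L2m_temp_flux v S : bounded_field v -> H10 Omega S -> L2m Omega (temp_flux v S).
Proof.
move=> [Hv Bv] HS i j; rewrite (_ : (fun x => _) = fun x => component v j x * S x).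
  have [M vM] := Bv j.
  apply: (@L2_mul_bounded _ _ _ _ (component v j) _ M) => //; first exact: H10_L2.
  exact: (L2_measurable (H10_L2 (Hv j))).
by apply/funext => x; rewrite /temp_flux mxE mulrC ord1.
Qed.

Lemma a_STE v T S : bounded_field v -> H10 Omega T -> H10 Omega S ->
  a_ST Omega v T S = 2^-1 * (ipm Omega (temp_flux v S) (grad Omega T) -
                             ipm Omega (temp_flux v T) (grad Omega S)).
Proof.
move=> Bv HT HS; rewrite /a_ST; congr (_ * _).
rewrite /ipm -RintegralB//; first last.
- by apply: ipm_integrable; [exact: L2m_temp_flux|exact: L2m_grad].
- by apply: ipm_integrable; [exact: L2m_temp_flux|exact: L2m_grad].
by apply: eq_Rintegral => x _; rewrite /temp_flux !mdotZl mulrC [X in _ - X]mulrC.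
Qed.

Lemma a_ST_self v T : a_ST Omega v T T = 0.
Proof.
rewrite /a_ST [X in _ * X](_ : _ = 0) ?mulr0//.
under eq_Rintegral do rewrite subrr.
by rewrite Rintegral_cst// mul0r.
Qed.

Lemma a_SN_self u v : a_SN Omega u v v = 0.
Proof. by rewrite /a_SN subrr mulr0. Qed.

Lemma a_ST_lin1 k u v T S : bounded_field u -> bounded_field v ->
  bounded_field (k *: u + v) ->
  H10 Omega T -> H10 Omega S ->
  a_ST Omega (k *: u + v) T S = k * a_ST Omega u T S + a_ST Omega v T S.
Proof.
move=> Bu Bv Buv HT HS; rewrite !a_STE//.
have E X : temp_flux (k *: u + v) X = k *: temp_flux u X + temp_flux v X.
  apply/funext => x; rewrite /temp_flux.
  by rewrite (_ : (k *: u + v) x = k *: u x + v x)// scalerDr scalerA mulrC -scalerA.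
have F X Y : H10 Omega X -> H10 Omega Y ->
    ipm Omega (temp_flux (k *: u + v) X) (grad Omega Y) =
    k * ipm Omega (temp_flux u X) (grad Omega Y) + ipm Omega (temp_flux v X) (grad Omega Y).
  move=> HX HY; rewrite E.
  rewrite (semi_innerDl (subspace_L2m _ _) (semi_inner_ipm _ _))//.
  - exact: L2m_temp_flux.
  - exact: L2m_temp_flux.
  - exact: L2m_grad.
by rewrite (F T S)// (F S T)//; exact: skew_half_lin.
Qed.

Lemma temp_flux_lin k v S T : temp_flux v (k *: S + T) = k *: temp_flux v S + temp_flux v T.
Proof.
apply/funext => x; rewrite /temp_flux.
by rewrite (_ : (k *: S + T) x = k * S x + T x)// scalerDl -scalerA.
Qed.

Lemma a_ST_lin3 v T : bounded_field v -> H10 Omega T ->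
  linear_on (H10 Omega) (fun S => a_ST Omega v T S).
Proof.
move=> Bv HT k S S' HS HS'.
have HSS' : H10 Omega (k *: S + S') by exact: H10_lin.
rewrite (a_STE Bv HT HSS') (a_STE Bv HT HS) (a_STE Bv HT HS').
rewrite temp_flux_lin (semi_innerDl (subspace_L2m _ _) (semi_inner_ipm _ _))//; first last.
- exact: L2m_grad.
- exact: L2m_temp_flux.
- exact: L2m_temp_flux.
rewrite (ipm_grad_lin (L2m_temp_flux Bv HT))//; exact: skew_half_lin.
Qed.

Lemma a_ST_lin2 v S : bounded_field v -> H10 Omega S ->
  linear_on (H10 Omega) (fun T => a_ST Omega v T S).
Proof.
move=> Bv HS k T T' HT HT'.
have HTT' : H10 Omega (k *: T + T') by exact: H10_lin.
rewrite (a_STE Bv HTT' HS) (a_STE Bv HT HS) (a_STE Bv HT' HS).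
rewrite temp_flux_lin (semi_innerDl (subspace_L2m _ _) (semi_inner_ipm _ _))//; first last.
- exact: L2m_grad.
- exact: L2m_temp_flux.
- exact: L2m_temp_flux.
rewrite (ipm_grad_lin (L2m_temp_flux Bv HS))//; exact: skew_half_lin.
Qed.

End convection.

Section divergence.

Definition div_form q v : R := \int[mu]_(x in Omega) (q x * divergence Omega v x).

Lemma L2m_scalar_mx q : L2 Omega q -> L2m Omega (fun x => (q x)%:M : 'M[R]_d).
Proof.
move=> Lq i j; rewrite (_ : (fun x => _) = ((i == j)%:R : R) *: q).
  exact: subspaceZ.
by apply/funext => x; rewrite mxE; change (q x *+ (i == j) = (i == j)%:R * q x); rewrite mulr_natl.
Qed.

Lemma div_formE q v : div_form q v =
  ipm Omega (fun x => (q x)%:M : 'M[R]_d) (gradv Omega v).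
Proof.
apply: eq_Rintegral => x _; rewrite /divergence /mxtrace mulr_sumr.
apply: eq_bigr => i _; rewrite (bigD1 i)//= big1 => [|j ji].
  by rewrite [(_%:M) _ _]mxE eqxx mulr1n addr0.
by rewrite [(_%:M) _ _]mxE eq_sym (negbTE ji) mulr0n mul0r.
Qed.

Lemma div_form_lin2 q : L2 Omega q -> linear_on (H10v Omega) (div_form q).
Proof.
move=> Lq k u v Hu Hv; rewrite !div_formE.
by rewrite (ipm_gradv_lin (L2m_scalar_mx Lq)).
Qed.

Lemma div_form_lin1 v : H10v Omega v -> linear_on (L2 Omega) (div_form ^~ v).
Proof.
move=> Hv k q q' Lq Lq'; rewrite !div_formE.
rewrite (_ : (fun x => _) = k *: (fun x => (q x)%:M : 'M[R]_d) + (fun x => (q' x)%:M)).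
  rewrite (semi_innerDl (subspace_L2m _ _) (semi_inner_ipm _ _))//.
  - exact: L2m_scalar_mx.
  - exact: L2m_scalar_mx.
  - exact: L2m_gradv.
apply/funext => x; rewrite (_ : (k *: q + q') x = k * q x + q' x)//.
by rewrite raddfD /= -scale_scalar_mx.
Qed.

(** The divergence pairs the gradient with q times the identity, whose Frobenius norm
is that of q times the square root of d. *)
Lemma div_form_bound q v : L2 Omega q -> H10v Omega v ->
  `|div_form q v| <= Num.sqrt (d%:R * ip Omega q q) * gradv_norm Omega v.
Proof.
move=> Lq Hv; rewrite div_formE gradv_normE//.
apply: le_trans (cauchy_schwarz (subspace_L2m _ _) (semi_inner_ipm _ _) (L2m_scalar_mx Lq) (L2m_gradv Hv)) _.
rewrite ler_wpM2r ?sqrtr_ge0// (_ : ipm _ _ _ = d%:R * ip Omega q q)//.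
rewrite -RintegralZl//; last exact: L2_mul_integrable.
apply: eq_Rintegral => x _; rewrite /mdot (eq_bigr (fun=> q x * q x)).
  by rewrite sumr_const card_ord mulr_natl.
move=> i _; rewrite (bigD1 i)//= big1 => [|j ji]; first by rewrite mxE eqxx mulr1n addr0.
by rewrite !mxE eq_sym (negbTE ji) mulr0n mul0r.
Qed.

End divergence.

End forms.

(** * Variable coefficients and the power term *)

Section nonlinear_terms.
Variables (R : realType) (d : nat) (Omega : set 'rV[R]_d).
Context {hO : bounded_domain Omega}.
Let mu := @lebesgue_rV R d.
Let mO : measurable Omega. Proof. exact: measurable_domain. Qed.
Implicit Types (u v w : 'rV[R]_d -> 'rV[R]_d) (q S T : 'rV[R]_d -> R).

Lemma bounded_field_mnorm u : bounded_field Omega u ->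
  exists2 M, 0 <= M & forall x, Omega x -> mnorm (u x) <= M.
Proof.
move=> [_ Bu]; have [M MP] := choice Bu.
exists (Num.sqrt (\sum_i M i ^+ 2)); first exact: sqrtr_ge0.
move=> x Ox; rewrite ler_wsqrtr// /mdot big_ord1; apply: ler_sum => i _.
rewrite -expr2 -[u x ord0 i ^+ 2]real_normK ?num_real//.
have uM := MP i x Ox.
by rewrite ler_sqr ?nnegrE//; exact: le_trans uM.
Qed.

Section coefficient.
Variables (c : R -> R) (cm cp : R).
Hypotheses (cc : continuous c) (cb : forall r, cm <= c r <= cp) (cm0 : 0 < cm).

Lemma measurable_coefficient T : L2 Omega T ->
  measurable_fun Omega ((fun x => c (T x)) : _ -> measurableTypeR R).
Proof.
move=> LT; apply: (measurableT_comp (f := c)); last exact: L2_measurable.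
exact: continuous_measurable_fun.
Qed.

Lemma coefficient_bound T x : `|c (T x)| <= cp.
Proof.
have /andP[c1 c2] := cb (T x); rewrite ger0_norm//.
by rewrite ltW// (lt_le_trans cm0).
Qed.

Lemma L2m_coefficient m n T (A : 'rV[R]_d -> 'M[R]_(m, n)) : L2 Omega T ->
  L2m Omega A -> L2m Omega (fun x => c (T x) *: A x).
Proof.
move=> LT LA; apply: (@L2m_scale _ _ _ _ _ _ (fun x => c (T x)) cp) => //.
  exact: measurable_coefficient.
by move=> x _; exact: coefficient_bound.
Qed.

Lemma coefficient_form m n T (A B : 'rV[R]_d -> 'M[R]_(m, n)) :
  \int[mu]_(x in Omega) (c (T x) * mdot (A x) (B x)) =
  ipm Omega (fun x => c (T x) *: A x) B.
Proof. by apply: eq_Rintegral => x _; rewrite mdotZl. Qed.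

Lemma coefficient_form_bound m n T (A B : 'rV[R]_d -> 'M[R]_(m, n)) : L2 Omega T ->
  L2m Omega A -> L2m Omega B ->
  `|ipm Omega (fun x => c (T x) *: A x) B| <=
  cp * Num.sqrt (ipm Omega A A) * Num.sqrt (ipm Omega B B).
Proof.
move=> LT LA LB; have LcA := L2m_coefficient LT LA.
apply: le_trans (cauchy_schwarz (subspace_L2m _ _) (semi_inner_ipm _ _) LcA LB) _.
rewrite ler_wpM2r ?sqrtr_ge0//.
have cp0 : 0 <= cp.
  by have /andP[h1 h2] := cb 0; rewrite ltW// (lt_le_trans cm0)// (le_trans h1).
rewrite -[X in X * _](ger0_norm cp0) -sqrtr_sqr -sqrtrM ?sqr_ge0//.
rewrite ler_wsqrtr// -RintegralZl//; last exact: ipm_integrable.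
apply: le_Rintegral => //.
- exact: ipm_integrable.
- exact: (integrableZl mO (cp ^+ 2) (ipm_integrable LA LA)).
move=> x Ox; rewrite mdotZl mdotZr mulrA -expr2 ler_wpM2r ?mdot_ge0//.
rewrite -[c (T x) ^+ 2]real_normK ?num_real// ler_sqr ?nnegrE//.
exact: coefficient_bound.
Qed.

Lemma coefficient_form_coercive m n T (A : 'rV[R]_d -> 'M[R]_(m, n)) : L2 Omega T ->
  L2m Omega A ->
  cm * ipm Omega A A <= ipm Omega (fun x => c (T x) *: A x) A.
Proof.
move=> LT LA; have LcA := L2m_coefficient LT LA.
rewrite -RintegralZl//; last exact: ipm_integrable.
apply: le_Rintegral => //.
- exact: (integrableZl mO cm (ipm_integrable LA LA)).
- exact: ipm_integrable.
move=> x Ox; rewrite mdotZl ler_wpM2r ?mdot_ge0//.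
by have /andP[] := cb (T x).
Qed.

End coefficient.

Section power.
Variable s : R.
Hypothesis hs : 3 <= s <= 4.

Definition power_field u (x : 'rV[R]_d) : 'rV[R]_d := mnorm (u x) `^ (s - 2) *: u x.

Lemma power_form u v : \int[mu]_(x in Omega) (mnorm (u x) `^ (s - 2) * mdot (u x) (v x)) =
  ipm Omega (power_field u) v.
Proof. by apply: eq_Rintegral => x _; rewrite /power_field mdotZl. Qed.

Lemma measurable_mnorm_powR u r : H10v Omega u ->
  measurable_fun Omega ((fun x => mnorm (u x) `^ r) : _ -> measurableTypeR R).
Proof.
move=> Hu; apply: (measurableT_comp (f := fun y : R => y `^ r)).
  exact: measurable_powR.
by apply: measurable_mnorm; exact: L2m_field.
Qed.

Lemma L2m_power_field u : bounded_field Omega u -> L2m Omega (power_field u).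
Proof.
move=> Bu; have [Hu _] := Bu; have [M M0 uM] := bounded_field_mnorm Bu.
apply: (@L2m_scale _ _ _ _ _ _ (fun x => mnorm (u x) `^ (s - 2)) (M `^ (s - 2))).
- exact: L2m_field.
- exact: measurable_mnorm_powR.
move=> x Ox; rewrite ger0_norm ?powR_ge0//.
apply: ge0_ler_powR; rewrite ?nnegrE ?mnorm_ge0//; last exact: uM.
by case/andP: hs; lra.
Qed.

Lemma power_form_ge0 u : 0 <= ipm Omega (power_field u) u.
Proof.
apply: Rintegral_ge0 => x _.
by rewrite /power_field mdotZl mulr_ge0 ?powR_ge0 ?mdot_ge0.
Qed.

(** Hoelder's inequality for |u|^(s-1) and |v|, with exponents s / (s-1) and s. *)
Lemma power_form_bound u v (A B : R) : bounded_field Omega u -> bounded_field Omega v ->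
  0 <= A -> 0 <= B ->
  (Lp_norm Omega s (fun x => mnorm (u x)) <= A%:E)%E ->
  (Lp_norm Omega s (fun x => mnorm (v x)) <= B%:E)%E ->
  `|ipm Omega (power_field u) v| <= A `^ (s - 1) * B.
Proof.
move=> Bu Bv A0 B0 uA vB.
have /andP[s3 s4] := hs.
have [[Hu _] [Hv _]] := (Bu, Bv).
have s0 : 0 < s by lra.
have s10 : 0 < s - 1 by lra.
pose U := (fun x => mnorm (u x) `^ (s - 1)) \_ Omega.
pose V := (fun x => mnorm (v x)) \_ Omega.
have mU : measurable_fun [set: 'rV[R]_d] (U : _ -> measurableTypeR R).
  by apply/(measurable_restrictT _ mO); exact: measurable_mnorm_powR.
have mV : measurable_fun [set: 'rV[R]_d] (V : _ -> measurableTypeR R).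
  by apply/(measurable_restrictT _ mO); apply: measurable_mnorm; exact: L2m_field.
have pq : (s / (s - 1))^-1 + s^-1 = 1.
  by field; rewrite !gt_eqF.
have hold := @hoelder _ _ _ mu U V (s / (s - 1)) s mU mV (divr_gt0 s0 s10) s0 pq.
have NU : ('N[mu]_(s / (s - 1))%:E[EFin \o U] =
    (Lp_norm Omega s (fun x => mnorm (u x))) `^ (s - 1))%E.
  rewrite /Lp_norm unlock -poweRrM invf_div [X in (_ `^ X)%E = _]mulrC.
  apply: (congr1 (fun z : \bar R => (z `^ (s^-1 * (s - 1)))%E)).
  apply: eq_integral => x _ /=; congr EFin.
  rewrite /U !patchE; case: ifPn => [_|_].
    rewrite ger0_norm ?powR_ge0// -powRrM ger0_norm ?mnorm_ge0//.
    by congr (_ `^ _); field; rewrite gt_eqF.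
  by rewrite normr0 !powR0// ?gt_eqF// divr_gt0.
have N1 : ('N[mu]_1[EFin \o (U \* V)%R] =
    \int[mu]_(x in Omega) (mnorm (u x) `^ (s - 1) * mnorm (v x))%:E)%E.
  rewrite Lnorm1 [RHS]integral_mkcond; apply: eq_integral => x _ /=.
  rewrite /U /V !patchE; case: ifPn => [_|_]; last by rewrite mul0r normr0.
  by rewrite ger0_norm// mulr_ge0 ?powR_ge0 ?mnorm_ge0.
have K0 : 0 <= A `^ (s - 1) * B by rewrite mulr_ge0 ?powR_ge0.
have int_le : (\int[mu]_(x in Omega) (mnorm (u x) `^ (s - 1) * mnorm (v x))%:E <=
    (A `^ (s - 1) * B)%:E)%E.
  rewrite -N1 (le_trans hold)// NU EFinM -poweR_EFin.
  apply: lee_pmul; [exact: poweR_ge0|exact: Lnorm_ge0| |exact: vB].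
  apply: gt0_ler_poweR; rewrite ?in_itv/= ?leey ?andbT//; first exact: ltW.
  exact: Lnorm_ge0.
have LP := L2m_power_field Bu; have Lv := L2m_field Hv.
have iuv : mu.-integrable Omega (EFin \o (fun x => mdot (power_field u x) (v x))).
  exact: ipm_integrable.
rewrite -lee_fin EFin_normr_Rintegral//.
apply: (@le_trans _ _ (\int[mu]_(x in Omega) `|(mdot (power_field u x) (v x))%:E|)%E).
  apply: le_abse_integral => //.
  by have /integrableP[] := iuv.
apply: le_trans int_le; apply: ge0_le_integral => //.
- by apply: measurableT_comp => //; exact: (measurable_int _ iuv).
- apply/measurable_EFinP; apply: measurable_funM; first exact: measurable_mnorm_powR.
  by apply: measurable_mnorm.
move=> x Ox /=; rewrite lee_fin /power_field mdotZl normrM ger0_norm ?powR_ge0//.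
have -> : mnorm (u x) `^ (s - 1) = mnorm (u x) `^ (s - 2) * mnorm (u x).
  rewrite -[X in _ * X]powRr1 ?mnorm_ge0// -powRD; last first.
    by apply/implyP => /eqP; lra.
  by congr (_ `^ _); ring.
by rewrite -mulrA ler_wpM2l ?powR_ge0// mdot_cauchy_schwarz.
Qed.

End power.

End nonlinear_terms.

(** * Energy identities and a priori bounds *)

Lemma linear_onDr (R : realType) (U : lmodType R) (V : set U) (f g : U -> R) :
  linear_on V f -> linear_on V g -> linear_on V (fun v => f v + g v).
Proof.
by move=> lf lg k u v Vu Vv; rewrite lf// lg// mulrDr addrACA.
Qed.

Lemma linear_onZr (R : realType) (U : lmodType R) (V : set U) (c : R) (f : U -> R) :
  linear_on V f -> linear_on V (fun v => c * f v).
Proof. by move=> lf k u v Vu Vv; rewrite lf// mulrDr mulrCA. Qed.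

Lemma linear_onBr (R : realType) (U : lmodType R) (V : set U) (f g : U -> R) :
  linear_on V f -> linear_on V g -> linear_on V (fun v => f v - g v).
Proof.
by move=> lf lg k u v Vu Vv; rewrite lf// lg// opprD mulrBr addrACA.
Qed.

Lemma norm_half_sub (R : realType) (x y a b : R) : `|x| <= a -> `|y| <= b ->
  `|2^-1 * (x - y)| <= 2^-1 * (a + b).
Proof.
move=> xa yb; rewrite normrM ger0_norm ?invr_ge0// ler_pM2l ?invr_gt0//.
by rewrite (le_trans (ler_normB _ _))// lerD.
Qed.

Section a_priori.
Variables (R : realType) (d : nat) (Omega : set 'rV[R]_d).
Context {hO : bounded_domain Omega}.
Let mu := @lebesgue_rV R d.
Let mO : measurable Omega. Proof. exact: measurable_domain. Qed.
Implicit Types (u v w : 'rV[R]_d -> 'rV[R]_d) (q S T : 'rV[R]_d -> R).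

(** If a negative constant were admissible, all gradients would vanish, and every
constant would be admissible: there would be no best one. *)
Lemma embedding_constant_ge0 (r C : R) :
  best_embedding_constant Omega r C -> 0 <= C.
Proof.
move=> [CP Cmin]; rewrite leNgt; apply/negP => C0.
suff : embedding_bound Omega r (C - 1) by move=> /Cmin; rewrite lerBrDl; lra.
move=> v Hv; have := CP v Hv; have gv := gradv_norm_ge0 (hO := hO) Hv.
have [g0|g0] := eqVneq (gradv_norm Omega v) 0; first by rewrite g0 !mulr0 => h; exact: h.
have {}gv : 0 < gradv_norm Omega v by rewrite lt_neqAle eq_sym g0.
move=> /(le_trans (Lnorm_ge0 _ _ _)); rewrite lee_fin pmulr_lge0//.
by rewrite leNgt C0.
Qed.

Variables (s num nup kappam kappap : R) (nu kappa : R -> R).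
Variables (f : ('rV[R]_d -> 'rV[R]_d) -> R) (g : ('rV[R]_d -> R) -> R).
Variables (C_N C_2 C_s : R).
Hypothesis hs : 3 <= s <= 4.
Hypotheses (cnu : continuous nu) (ckappa : continuous kappa).
Hypotheses (num0 : 0 < num) (kappam0 : 0 < kappam).
Hypotheses (hnu : forall r, num <= nu r <= nup).
Hypotheses (hkappa : forall r, kappam <= kappa r <= kappap).
Hypotheses (hf : dual_space (H10v Omega) (gradv_norm Omega) f).
Hypotheses (hg : dual_space (H10 Omega) (grad_norm Omega) g).
Hypothesis hC_N : convection_bound Omega C_N.
Hypothesis hC_2 : best_embedding_constant Omega 2 C_2.
Hypothesis hC_s : best_embedding_constant Omega s C_s.

Let normf := dual_norm (H10v Omega) (gradv_norm Omega) f.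
Let normg := dual_norm (H10 Omega) (grad_norm Omega) g.

Lemma normf_ge0 : 0 <= normf.
Proof.
apply: (dual_norm_ge0 (subspace_H10v (hO := hO)) hf); first exact: gradv_norm_ge0.
exact: gradv_normZ.
Qed.

Lemma normg_ge0 : 0 <= normg.
Proof.
apply: (dual_norm_ge0 (subspace_H10 (hO := hO)) hg); first exact: grad_norm_ge0.
exact: grad_normZ.
Qed.

Lemma f_bound v : H10v Omega v -> `|f v| <= normf * gradv_norm Omega v.
Proof.
apply: (le_dual_norm (subspace_H10v (hO := hO)) hf); first exact: gradv_norm_ge0.
exact: gradv_normZ.
Qed.

Lemma g_bound S : H10 Omega S -> `|g S| <= normg * grad_norm Omega S.
Proof.
apply: (le_dual_norm (subspace_H10 (hO := hO)) hg); first exact: grad_norm_ge0.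
exact: grad_normZ.
Qed.

Definition velocity_form u T v : R :=
  \int[mu]_(x in Omega)
     (nu (T x) * mdot (gradv Omega u x) (gradv Omega v x) + mdot (u x) (v x))
  + a_SN Omega u u v
  + \int[mu]_(x in Omega) (mnorm (u x) `^ (s - 2) * mdot (u x) (v x)).

Definition temperature_form u T S : R :=
  \int[mu]_(x in Omega) (kappa (T x) * mdot (grad Omega T x) (grad Omega S x))
  + a_ST Omega u T S.

Lemma velocity_formE u T v : bounded_field Omega u -> L2 Omega T -> H10v Omega v ->
  velocity_form u T v =
  ipm Omega (fun x => nu (T x) *: gradv Omega u x) (gradv Omega v) + ipm Omega u v
  + a_SN Omega u u v + ipm Omega (power_field s u) v.
Proof.
move=> [Hu Bu] LT Hv; rewrite /velocity_form power_form; congr (_ + _ + _).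
rewrite -coefficient_form -RintegralD//.
- rewrite (_ : EFin \o _ = EFin \o (fun x => mdot (nu (T x) *: gradv Omega u x) (gradv Omega v x))).
    apply: ipm_integrable; last exact: L2m_gradv.
    by apply: (L2m_coefficient cnu hnu) => //; exact: L2m_gradv.
  by apply/funext => x /=; rewrite mdotZl.
- by apply: ipm_integrable; exact: L2m_field.
Qed.

Lemma velocity_form_linear u T : bounded_field Omega u -> L2 Omega T ->
  linear_on (H10v Omega) (velocity_form u T).
Proof.
move=> Bu LT; have [Hu _] := Bu.
pose F v := ipm Omega (fun x => nu (T x) *: gradv Omega u x) (gradv Omega v) +
  ipm Omega u v + a_SN Omega u u v + ipm Omega (power_field s u) v.
suff lF : linear_on (H10v Omega) F.
  have FE v : H10v Omega v -> velocity_form u T v = F v by exact: velocity_formE.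
  move=> k v w Hv Hw; have Hvw : H10v Omega (k *: v + w).
    by have [_] := @subspace_H10v R d Omega hO; apply.
  by rewrite (FE _ Hv) (FE _ Hw) (FE _ Hvw); exact: lF.
have lin W : L2m Omega W -> linear_on (H10v Omega) (ipm Omega W).
  move=> LW k v w Hv Hw; have [_ alin _] := @semi_inner_ipm R d Omega hO 1 d.
  by apply: alin => //; exact: L2m_field.
rewrite /F; apply: linear_onDr; first apply: linear_onDr.
- apply: linear_onDr; last by apply: lin; exact: L2m_field.
  apply: ipm_gradv_lin; apply: (L2m_coefficient cnu hnu) => //.
  exact: L2m_gradv.
- by apply: linear_onZr; apply: linear_onBr; [exact: a_N_lin3|exact: a_N_lin2].
- by apply: lin; exact: L2m_power_field.
Qed.

Lemma temperature_form_linear u T : bounded_field Omega u -> H10 Omega T ->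
  linear_on (H10 Omega) (temperature_form u T).
Proof.
move=> Bu HT; apply: linear_onDr; last exact: a_ST_lin3.
have := @ipm_grad_lin R d Omega hO (fun x => kappa (T x) *: grad Omega T x).
move=> lF k v w Hv Hw; rewrite !coefficient_form; apply: lF => //.
apply: (L2m_coefficient ckappa hkappa) => //; first exact: H10_L2.
exact: L2m_grad.
Qed.

(** The convective term disappears by skew-symmetry, and the zeroth order and power
terms are nonnegative. *)
Lemma velocity_energy u T : bounded_field Omega u -> L2 Omega T ->
  num * gradv_norm Omega u ^+ 2 <= velocity_form u T u.
Proof.
move=> Bu LT; have [Hu _] := Bu; rewrite velocity_formE// a_SN_self addr0.
have [_ _ apos] := @semi_inner_aV R d Omega hO.
rewrite gradv_normE// sqr_sqrtr; last exact: apos.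
have h1 := coefficient_form_coercive (hO := hO) cnu hnu num0 LT (L2m_gradv Hu).
have h2 : 0 <= ipm Omega u u.
  by have [_ _] := @semi_inner_ipm R d Omega hO 1 d; apply; exact: L2m_field.
have h3 : 0 <= ipm Omega (power_field s u) u by exact: power_form_ge0.
by rewrite -addrA (le_trans h1)// lerDl addr_ge0.
Qed.

Lemma temperature_energy u T : H10 Omega T ->
  kappam * grad_norm Omega T ^+ 2 <= temperature_form u T T.
Proof.
move=> HT; rewrite /temperature_form a_ST_self addr0 coefficient_form.
have [_ _ apos] := @semi_inner_aT R d Omega hO.
rewrite grad_normE// sqr_sqrtr; last exact: apos.
by apply: (coefficient_form_coercive ckappa hkappa) => //; [exact: H10_L2|exact: L2m_grad].
Qed.

(** The sum of bounds for the terms of the momentum equation other than the pressure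
and the force, as functionals of v, where gu is the norm of grad u. *)
Definition velocity_constant (gu : R) : R :=
  nup * gu + C_2 ^+ 2 * gu + C_N * gu ^+ 2 + C_s `^ s * gu `^ (s - 1).

Lemma velocity_form_bound u T v : bounded_field Omega u -> L2 Omega T ->
  bounded_field Omega v ->
  `|velocity_form u T v| <= velocity_constant (gradv_norm Omega u) * gradv_norm Omega v.
Proof.
move=> Bu LT Bv; have [[Hu _] [Hv _]] := (Bu, Bv).
rewrite velocity_formE//.
set gu := gradv_norm Omega u; set gv := gradv_norm Omega v.
have gu0 : 0 <= gu by exact: gradv_norm_ge0.
have gv0 : 0 <= gv by exact: gradv_norm_ge0.
have h1 : `|ipm Omega (fun x => nu (T x) *: gradv Omega u x) (gradv Omega v)| <=
    nup * gu * gv.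
  rewrite /gu /gv !gradv_normE//.
  by apply: (coefficient_form_bound cnu hnu) => //; exact: L2m_gradv.
have h2 : `|ipm Omega u v| <= C_2 ^+ 2 * gu * gv.
  have emb w : H10v Omega w -> Num.sqrt (ipm Omega w w) <= C_2 * gradv_norm Omega w.
    move=> Hw; have [/(_ w Hw) + _] := hC_2.
    by rewrite Lp_norm_L2 ?ip_mnorm ?lee_fin//; apply: L2_mnorm; exact: L2m_field.
  apply: le_trans (cauchy_schwarz (subspace_L2m _ _) (semi_inner_ipm _ _) (L2m_field Hu) (L2m_field Hv)) _.
  rewrite (_ : C_2 ^+ 2 * gu * gv = (C_2 * gu) * (C_2 * gv)); last by ring.
  exact: (ler_pM (sqrtr_ge0 _) (sqrtr_ge0 _) (emb u Hu) (emb v Hv)).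
have h3 : `|a_SN Omega u u v| <= C_N * gu ^+ 2 * gv.
  have n1 : `|a_N Omega u u v| <= C_N * gu * gu * gv by exact: hC_N.
  have n2 : `|a_N Omega u v u| <= C_N * gu * gv * gu by exact: hC_N.
  apply: le_trans (norm_half_sub n1 n2) _.
  move: gu gv {n1 n2 h1 h2 gu0 gv0} => a b.
  by rewrite (_ : 2^-1 * _ = C_N * a ^+ 2 * b)//; field.
have h4 : `|ipm Omega (power_field s u) v| <= C_s `^ s * gu `^ (s - 1) * gv.
  have Cs0 := embedding_constant_ge0 hC_s; have [emb _] := hC_s.
  have -> : C_s `^ s * gu `^ (s - 1) * gv = (C_s * gu) `^ (s - 1) * (C_s * gv).
    rewrite powRM// -(mulr_powRB1 Cs0); last by case/andP: hs; lra.
    ring.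
  exact: (power_form_bound hs Bu Bv (mulr_ge0 Cs0 gu0) (mulr_ge0 Cs0 gv0) (emb u Hu) (emb v Hv)).
rewrite /velocity_constant !mulrDl.
apply: le_trans (ler_normD _ _) _; apply: lerD => //.
apply: le_trans (ler_normD _ _) _; apply: lerD => //.
by apply: le_trans (ler_normD _ _) _; exact: lerD.
Qed.

Lemma velocity_bound u T : bounded_field Omega u -> L2 Omega T ->
  velocity_form u T u = f u -> gradv_norm Omega u <= num^-1 * normf.
Proof.
move=> Bu LT uf; have [Hu _] := Bu.
have gu0 := gradv_norm_ge0 (hO := hO) Hu.
have := velocity_energy Bu LT; rewrite uf => h.
have := le_trans h (le_trans (ler_norm _) (f_bound Hu)).
have [->|gn0] := eqVneq (gradv_norm Omega u) 0.
  by move=> _; rewrite mulr_ge0 ?invr_ge0 ?normf_ge0// ltW.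
have gu : 0 < gradv_norm Omega u by rewrite lt_neqAle eq_sym gn0.
by rewrite expr2 mulrA ler_pM2r// ler_pdivlMl.
Qed.

Lemma temperature_bound u T : H10 Omega T ->
  temperature_form u T T = g T -> grad_norm Omega T <= kappam^-1 * normg.
Proof.
move=> HT Tg; have gT0 := grad_norm_ge0 (hO := hO) HT.
have := temperature_energy u HT; rewrite Tg => h.
have := le_trans h (le_trans (ler_norm _) (g_bound HT)).
have [->|gn0] := eqVneq (grad_norm Omega T) 0.
  by move=> _; rewrite mulr_ge0 ?invr_ge0 ?normg_ge0// ltW.
have gu : 0 < grad_norm Omega T by rewrite lt_neqAle eq_sym gn0.
by rewrite expr2 mulrA ler_pM2r// ler_pdivlMl.
Qed.

(** Each term of velocity_constant is increasing in gu; at the bound of gu it is the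
norm of f times the corresponding term of Lambda.  The norm of f itself, added
on the left, accounts for the term 1. *)
Lemma velocity_constant_bound gu : 0 <= C_N -> 0 <= gu -> gu <= num^-1 * normf ->
  velocity_constant gu + normf <= Lambda s num nup C_N C_2 C_s normf * normf.
Proof.
move=> CN0 gu0 guf; have nf := normf_ge0.
have /andP[s3 s4] := hs.
have nup0 : 0 <= nup.
  by have /andP[a b] := hnu 0; rewrite (le_trans (ltW num0))// (le_trans a).
have nV : 0 <= num^-1 by rewrite invr_ge0 ltW.
have h1 : nup * gu <= nup * num^-1 * normf by rewrite -mulrA ler_wpM2l.
have h2 : C_2 ^+ 2 * gu <= C_2 ^+ 2 * num^-1 * normf by rewrite -mulrA ler_wpM2l// sqr_ge0.
have h3 : C_N * gu ^+ 2 <= C_N * num ^- 2 * normf * normf.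
  rewrite -!mulrA ler_wpM2l// (_ : _ * _ = (num^-1 * normf) ^+ 2); last first.
    by rewrite exprMn exprVn expr2.
  by rewrite ler_sqr ?nnegrE// mulr_ge0.
have h4 : C_s `^ s * gu `^ (s - 1) <=
    C_s `^ s * num `^ (1 - s) * normf `^ (s - 2) * normf.
  rewrite -!mulrA ler_wpM2l ?powR_ge0//.
  apply: (@le_trans _ _ ((num^-1 * normf) `^ (s - 1))).
    by apply: ge0_ler_powR; rewrite ?nnegrE ?mulr_ge0//; lra.
  rewrite powRM// -powR_inv1 ?(ltW num0)// -powRrM mulN1r opprB ler_wpM2l ?powR_ge0//.
  rewrite [X in _ <= X]mulrC -{1}[s - 1](_ : s - 2 + 1 = s - 1); last by ring.
  rewrite powRD ?powRr1// 1?mulrC//.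
  by apply/implyP => /eqP; lra.
by rewrite /velocity_constant /Lambda !mulrDl mul1r; lra.
Qed.

End a_priori.

(** * Finite dimension of the discrete spaces *)

Section finite_dimension.
Variable R : realType.

(** Off K the functions of V are arbitrary: finite element functions are determined
on the closure of the domain only. *)
Definition spanned_on (X : Type) (K : set X) (V : set (X -> R)) :=
  exists (J : finType) (e : J -> X -> R), forall u, V u ->
    exists c : J -> R, forall x, K x -> u x = \sum_j c j * e j x.

Lemma spanned_onS (X : Type) (K : set X) (V V' : set (X -> R)) :
  V' `<=` V -> spanned_on K V -> spanned_on K V'.
Proof. by move=> VV [J [e eP]]; exists J, e => u /VV; exact: eP. Qed.

(** The generators for K are cut off outside K, and those for L on K.  The coefficients
on both parts are taken independently, which forgets the matching of a function
on the interface but can only enlarge the span. *)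
Lemma spanned_onU (X : Type) (K L : set X) (V : set (X -> R)) :
  spanned_on K V -> spanned_on L V -> spanned_on (K `|` L) V.
Proof.
move=> [J [e eP]] [I [h hP]].
pose E (k : J + I) x := match k with
  | inl j => if `[< K x >] then e j x else 0
  | inr i => if `[< K x >] then 0 else h i x end.
exists (J + I)%type, E => u Vu.
have [c cP] := eP u Vu; have [b bP] := hP u Vu.
exists (fun k => match k with inl j => c j | inr i => b i end) => x KLx.
rewrite big_sumType /=; case: asboolP => Kx.
  by rewrite [X in _ + X]big1 ?addr0 => [|i _]; rewrite ?mulr0//; exact: cP.
rewrite big1 ?add0r => [|j _]; last by rewrite mulr0.
by apply: bP; case: KLx.
Qed.

Lemma spanned_on_bigU (X : Type) (I : eqType) (r : seq I) (K : I -> set X)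
    (V : set (X -> R)) : (forall i, i \in r -> spanned_on (K i) V) ->
  spanned_on [set x | exists2 i, i \in r & K i x] V.
Proof.
elim: r => [|i r IH] sK.
  by exists void, (fun _ _ => 0) => u Vu; exists (fun=> 0) => x [].
rewrite (_ : mkset _ = K i `|` [set x | exists2 i, i \in r & K i x]).
  apply: spanned_onU; first by apply: sK; rewrite mem_head.
  by apply: IH => j jr; apply: sK; rewrite inE jr orbT.
apply/seteqP; split=> x /=.
  by move=> [j]; rewrite inE => /predU1P[->|jr]; [left|right; exists j].
by move=> [Kx|[j jr Kx]]; [exists i; rewrite ?mem_head|exists j; rewrite // inE jr orbT].
Qed.

(** The coordinates of u are those of its values ev u in the spanning family: a
relation between the coordinates of vectors is one between their values on K,
and vectors whose values vanish on K are null. *)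
Lemma fin_dim_spanned (U : lmodType R) (V : set U) (a : U -> U -> R)
    (X : Type) (K : set X) (ev : U -> X -> R) :
  is_subspace V -> (forall x, linear_on setT (ev ^~ x)) ->
  spanned_on K [set ev u | u in V] ->
  (forall u, V u -> (forall x, K x -> ev u x = 0) -> a u u = 0) ->
  fin_dim V a.
Proof.
move=> sV lev [J [e eP]] a0.
have /choice[c cP] : forall u, exists c : J -> R, V u ->
    forall x, K x -> ev u x = \sum_j c j * e j x.
  move=> u; have [Vu|Vu] := pselect (V u); last by exists (fun=> 0).
  by have [|c cP] := eP (ev u); [exists u|exists c].
exists #|J|, (fun u => \row_i c u (enum_val i)) => n v k Vv kv0.
apply: a0; first exact: subspace_sum.
move=> x Kx.
have sT : is_subspace [set: U] by [].
rewrite (linear_on_sum sT (lev x))//.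
rewrite (eq_bigr (fun i => \sum_j k i * c (v i) j * e j x)); last first.
  by move=> i _; rewrite (cP _ (Vv i) _ Kx) mulr_sumr; apply: eq_bigr => j _; rewrite mulrA.
rewrite exchange_big big1//= => j _; rewrite -mulr_suml.
move/rowP : kv0 => /(_ (enum_rank j)); rewrite mxE summxE.
under eq_bigr do rewrite !mxE enum_rankK.
by move=> ->; rewrite mul0r.
Qed.

Lemma fin_dimS (U : lmodType R) (V V' : set U) (a : U -> U -> R) :
  V' `<=` V -> fin_dim V a -> fin_dim V' a.
Proof.
move=> VV [N [phi phiP]]; exists N, phi => n v c Vv; apply: phiP => i.
exact/VV/Vv.
Qed.

Section product.
Variables (U W : lmodType R) (V : set U) (Y : set W).
Variables (a : U -> U -> R) (b : W -> W -> R).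

Definition sum_form (x y : U * W) : R := a x.1 y.1 + b x.2 y.2.

Lemma sum_pair n (c : 'I_n -> R) (v : 'I_n -> U * W) :
  \sum_i c i *: v i = (\sum_i c i *: (v i).1, \sum_i c i *: (v i).2).
Proof.
elim: n c v => [|n IH] c v; first by rewrite !big_ord0.
by rewrite !big_ord_recl IH.
Qed.

Lemma is_subspace_prod : is_subspace V -> is_subspace Y -> is_subspace (V `*` Y).
Proof.
move=> [V0 VP] [Y0 YP]; split; first by split.
by move=> k u v [Vu Yu] [Vv Yv]; split; [exact: VP|exact: YP].
Qed.

Lemma semi_inner_prod : semi_inner V a -> semi_inner Y b ->
  semi_inner (V `*` Y) sum_form.
Proof.
move=> [asym alin apos] [bsym blin bpos]; split.
- by move=> u v [Vu Yu] [Vv Yv]; rewrite /sum_form asym// bsym.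
- move=> w [Vw Yw] k u v [Vu Yu] [Vv Yv]; rewrite /sum_form /= alin// blin//.
  by rewrite mulrDr addrACA.
- by move=> u [Vu Yu]; rewrite addr_ge0// (apos, bpos).
Qed.

Lemma fin_dim_prod : fin_dim V a -> fin_dim Y b -> fin_dim (V `*` Y) sum_form.
Proof.
move=> [N [phi phiP]] [M [psi psiP]].
exists (N + M)%N, (fun x => row_mx (phi x.1) (psi x.2)) => n v c Vv.
rewrite (eq_bigr (fun i => row_mx (c i *: phi (v i).1) (c i *: psi (v i).2))); last first.
  by move=> i _; rewrite scale_row_mx.
have -> : \sum_i row_mx (c i *: phi (v i).1) (c i *: psi (v i).2) =
    row_mx (\sum_i c i *: phi (v i).1) (\sum_i c i *: psi (v i).2).
  elim: n v c {Vv} => [|n IH] v c; first by rewrite !big_ord0 row_mx0.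
  by rewrite !big_ord_recl IH add_row_mx.
move=> e0; have /eq_row_mx[c1 c2] := etrans e0 (esym (row_mx0 _ _ _ _)).
rewrite sum_pair /sum_form /= phiP//; last by move=> i; case: (Vv i).
by rewrite psiP ?addr0// => i; case: (Vv i).
Qed.

End product.

End finite_dimension.

Section continuous_on_closure.
Variables (R : realType) (d : nat) (Omega : set 'rV[R]_d).
Context {hO : bounded_domain Omega}.
Let mu := @lebesgue_rV R d.
Let mO : measurable Omega. Proof. exact: measurable_domain. Qed.
Implicit Types (u v : 'rV[R]_d -> 'rV[R]_d) (q S T : 'rV[R]_d -> R).

Lemma compact_closure_domain : compact (closure Omega).
Proof.
have [a [b Oab]] := bounded_obox (domain_bounded Omega).
apply: (@subclosed_compact _ _ (cbox a b)); first exact: closed_closure.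
  exact: compact_cbox.
have Oc : Omega `<=` cbox a b.
  by move=> x /Oab xab i; have /andP[/ltW -> /ltW ->] := xab i.
rewrite [X in _ `<=` X](_ : _ = closure (cbox a b)); first exact: closure_subset.
apply/closure_id; apply: compact_closed; first exact: norm_hausdorff.
exact: compact_cbox.
Qed.

Lemma within_continuous_bounded S : {within closure Omega, continuous S} ->
  bounded_on Omega S.
Proof.
move=> cS; have : bounded_set (S @` closure Omega).
  by apply/compact_bounded/continuous_compact => //; exact: compact_closure_domain.
move=> [M [_ MP]]; exists (`|M| + 1) => x Ox.
apply: (MP (`|M| + 1)); last by exists x => //; exact: subset_closure.
by rewrite (le_lt_trans (ler_norm _))// ltrDl.
Qed.

Lemma within_continuous_component v i : {within closure Omega, continuous v} ->
  {within closure Omega, continuous (component v i)}.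
Proof.
move=> cv x.
apply: (@continuous_comp (subspace (closure Omega)) 'rV[R]_d R v
  (fun y : 'rV[R]_d => y ord0 i) x (cv x)).
exact: coord_continuous.
Qed.

Lemma within_continuous_lin (V : normedModType R) k (u v : 'rV[R]_d -> V) :
  {within closure Omega, continuous u} -> {within closure Omega, continuous v} ->
  {within closure Omega, continuous (k *: u + v)}.
Proof.
move=> cu cv x; exact: (cvgD (cvgZl_tmp (k := k) (cu x)) (cv x)).
Qed.

(** Where S is nonzero it stays so in a neighbourhood, which in Omega contains a box
of positive measure; the closure follows by density. *)
Lemma within_continuous_eq0 S : {within closure Omega, continuous S} ->
  {ae mu, forall x, Omega x -> S x = 0} -> forall x, closure Omega x -> S x = 0.
Proof.
move=> cS S0.
have near_neq0 x : closure Omega x -> S x != 0 ->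
    exists2 A, nbhs x A & forall y, A y -> closure Omega y -> S y != 0.
  move=> Kx Sx0.
  have := cS x; move=> /(_ [set r | r != 0]).
  have n0 : nbhs (S x) [set r : R | r != 0].
    by apply: open_nbhs_nbhs; split => //; exact: open_neq.
  move=> /(_ n0) h.
  have {}h : within (closure Omega) (nbhs x) (S @^-1` [set r | r != 0]).
    by rewrite (nbhs_subspace_in Kx); exact: h.
  by exists [set y | closure Omega y -> S y != 0] => // y; exact.
have inO x : Omega x -> S x = 0.
  move=> Ox; apply/eqP/negPn/negP => Sx0.
  have [A xA A0] := near_neq0 x (subset_closure Ox) Sx0.
  have : nbhs x (A `&` Omega).
    by apply: filterI => //; apply: open_nbhs_nbhs; split => //; exact: domain_open.
  case/nbhs_ballP => e /= e0 xe.
  pose a : 'rV[R]_d := \row_i (x ord0 i - e / 2).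
  pose b : 'rV[R]_d := \row_i (x ord0 i + e / 2).
  have e20 : 0 < e / 2 by rewrite divr_gt0.
  have e2e : e / 2 < e by rewrite ltr_pdivrMr// ltr_pMr// ltr1n.
  have abe : obox a b `<=` ball x e.
    move=> y yab; apply: rV_ball => // i; have := yab i; rewrite !mxE ltr_distl.
    by move=> /andP[? ?]; apply/andP; split; lra.
  have : mu (obox a b) = 0%E.
    apply/(negligibleP _ (measurable_obox a b)).
    apply: negligibleS S0 => y yab /=.
    have [Ay Oy] := xe y (abe y yab).
    by move=> /(_ Oy) Sy; have := A0 y Ay (subset_closure Oy); rewrite Sy eqxx.
  have ab i : a ord0 i <= b ord0 i by rewrite !mxE; lra.
  rewrite /mu lebesgue_rV_obox// => -[] /eqP; apply/negP; rewrite gt_eqF//.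
  by apply: prodr_gt0 => i _; rewrite !mxE; lra.
move=> x Kx; apply/eqP/negPn/negP => Sx0.
have [A xA A0] := near_neq0 x Kx Sx0.
have [y [Oy Ay]] := Kx A xA.
by have := A0 y Ay (subset_closure Oy); rewrite inO// eqxx.
Qed.

Lemma ip_eq0 S : L2 Omega S -> ip Omega S S = 0 ->
  {ae mu, forall x, Omega x -> S x = 0}.
Proof.
move=> LS S0; have iS := L2_mul_integrable (hO := hO) LS LS.
have mS := L2_measurable (hO := hO) LS.
have e0 : (\int[mu]_(x in Omega) `|(S x * S x)%:E| = 0)%E.
  under eq_integral do rewrite gee0_abs ?lee_fin -?expr2 ?sqr_ge0//.
  rewrite -(fineK (integrable_fin_num mO iS)) /= in S0 *.
  by move: S0; rewrite /ip /Rintegral => S0; congr EFin; rewrite -[RHS]S0; congr fine; apply: eq_integral => x _; rewrite expr2.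
have := ae_eq_integral_abs mu mO (measurable_int _ iS).
move=> [+ _] => /(_ e0); apply: filterS => x + Ox => /(_ Ox) [] /eqP.
by rewrite -expr2 sqrf_eq0 => /eqP.
Qed.

End continuous_on_closure.

Section discrete_spaces.
Variables (R : realType) (d : nat) (Omega : set 'rV[R]_d).
Context {hO : bounded_domain Omega}.
Variables (fe : fe_pair R d) (Th : mesh R d).
Hypothesis closureE : closure Omega = mesh_union Th.
Let mu := @lebesgue_rV R d.
Let mO : measurable Omega. Proof. exact: measurable_domain. Qed.
Implicit Types (u v : 'rV[R]_d -> 'rV[R]_d) (q S T : 'rV[R]_d -> R).

Lemma poly_on_lin k n (K : set 'rV[R]_d) q S : poly_on n K q -> poly_on n K S ->
  poly_on n K (k *: q + S).
Proof.
move=> [b qb] [c Sc]; exists (fun m => k * b m + c m) => x Kx.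
change (k * q x + S x = \sum_(m : {ffun 'I_d -> 'I_n.+1} | (\sum_i m i <= n)%N)
  (k * b m + c m) * \prod_i x ord0 i ^+ m i).
rewrite qb// Sc// mulr_sumr -big_split; apply: eq_bigr => m _ /=.
by rewrite mulrDl mulrA.
Qed.

Lemma poly_on0 n (K : set 'rV[R]_d) : poly_on n K (0 : 'rV[R]_d -> R).
Proof. by exists (fun=> 0) => x _; rewrite big1// => m _; rewrite mul0r. Qed.

Lemma velocity_local_lin k A q S : velocity_local fe A q -> velocity_local fe A S ->
  velocity_local fe A (k *: q + S).
Proof.
rewrite /velocity_local; case: fe => [|b]; first exact: poly_on_lin.
move=> [w [c [pw qE]]] [w' [c' [pw' SE]]]; exists (k *: w + w'), (k * c + c').
split; first exact: poly_on_lin.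
move=> x Ax; change (k * q x + S x = k * w x + w' x + (k * c + c') * b A x).
by rewrite qE// SE// mulrDr mulrDl -!addrA mulrA; congr (_ + _); rewrite addrCA.
Qed.

Lemma velocity_local0 A : velocity_local fe A 0.
Proof.
rewrite /velocity_local; case: fe => [|b]; first exact: poly_on0.
exists 0, 0; split; first exact: poly_on0.
by move=> x _; rewrite mul0r addr0.
Qed.

Lemma subspace_Xh : is_subspace (Xh Omega fe Th).
Proof.
have [H0 HP] := @subspace_H10v R d Omega hO.
split.
  split; [move=> x; exact: cvg_cst| |exact: H0].
  move=> A i _; rewrite (_ : component _ _ = 0); first exact: velocity_local0.
  by apply/funext => x; rewrite /component mxE.
move=> k u v [cu lu Hu] [cv lv Hv]; split; first exact: within_continuous_lin.
  by move=> A i AT; rewrite component_lin; apply: velocity_local_lin; [exact: lu|exact: lv].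
exact: HP.
Qed.

Lemma subspace_Yh : is_subspace (Yh Omega fe Th).
Proof.
split.
  by split; [move=> x; exact: cvg_cst|move=> A _; exact: poly_on0|exact: H10_0].
move=> k S T [cS pS HS] [cT pT HT]; split; first exact: within_continuous_lin.
  by move=> A AT; apply: poly_on_lin; [exact: pS|exact: pT].
exact: H10_lin.
Qed.

Lemma subspace_Mh : is_subspace (Mh Omega Th).
Proof.
split.
  split; [exact: L2_0| |move=> x; exact: cvg_cst|move=> A _; exact: poly_on0].
  by rewrite Rintegral_cst// mul0r.
move=> k q p [Lq q0 cq pq] [Lp p0 cp pp]; split.
- exact: L2_lin.
- have E r : \int[mu]_(x in Omega) r x = ip Omega (fun=> 1) r.
    by apply: eq_Rintegral => x _; rewrite mul1r.
  rewrite E (ip_lin (L2_cst 1))// -!E.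
  by move: q0 p0; rewrite -/mu => -> ->; rewrite mulr0 addr0.
- exact: within_continuous_lin.
- by move=> A AT; apply: poly_on_lin; [exact: pq|exact: pp].
Qed.

Lemma Xh_bounded u : Xh Omega fe Th u -> bounded_field Omega u.
Proof.
move=> [cu _ Hu]; split=> // i.
by apply: within_continuous_bounded; exact: within_continuous_component.
Qed.

Lemma Xh_H10v u : Xh Omega fe Th u -> H10v Omega u. Proof. by case. Qed.
Lemma Yh_H10 T : Yh Omega fe Th T -> H10 Omega T. Proof. by case. Qed.
Lemma Mh_L2 q : Mh Omega Th q -> L2 Omega q. Proof. by case. Qed.

Lemma gradv_eq0 v : (forall x, Omega x -> v x = 0) -> gradv Omega v = gradv Omega 0.
Proof.
move=> v0; apply/funext => x; apply/matrixP => i j; rewrite !mxE.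
congr (_ x); apply: eq_weak_partial => y Oy.
by rewrite /component v0.
Qed.

Lemma grad_eq0 S : (forall x, Omega x -> S x = 0) -> grad Omega S = grad Omega 0.
Proof.
move=> S0; apply/funext => x; apply/rowP => j; rewrite !mxE.
by congr (_ x); apply: eq_weak_partial => y Oy; rewrite S0.
Qed.

Lemma aV_eq0 v : (forall x, Omega x -> v x = 0) -> aV Omega v v = 0.
Proof.
move=> v0; have [H0 _] := @subspace_H10v R d Omega hO.
have [_ alin _] := @semi_inner_aV R d Omega hO.
by rewrite /aV gradv_eq0// -[LHS]/(aV Omega 0 0) (linear_on0 (subspace_H10v (hO := hO)) (alin _ H0)).
Qed.

Lemma aT_eq0 S : (forall x, Omega x -> S x = 0) -> aT Omega S S = 0.
Proof.
move=> S0; have [H0 _] := @subspace_H10 R d Omega hO.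
have [_ alin _] := @semi_inner_aT R d Omega hO.
by rewrite /aT grad_eq0// -[LHS]/(aT Omega 0 0) (linear_on0 (subspace_H10 (hO := hO)) (alin _ H0)).
Qed.

Lemma spanned_on_poly n (K : set 'rV[R]_d) : spanned_on K [set q | poly_on n K q].
Proof.
exists {ffun 'I_d -> 'I_n.+1}, (fun (m : {ffun 'I_d -> 'I_n.+1}) (x : 'rV[R]_d) =>
  if (\sum_i m i <= n)%N then \prod_i x ord0 i ^+ m i else 0).
move=> q [c qc]; exists c => x Kx; rewrite qc// big_mkcond.
by apply: eq_bigr => m _; case: ifP => _; rewrite ?mulr0.
Qed.

Lemma spanned_on_velocity A : spanned_on (simplex A) [set q | velocity_local fe A q].
Proof.
rewrite /velocity_local; case: fe => [|b]; first exact: spanned_on_poly.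
have [J [e eP]] := @spanned_on_poly 1 (simplex A).
exists (J + 'I_1)%type, (fun j => if j is inl i then e i else b A).
move=> q [w [k [pw qE]]]; have [c wc] := eP w pw.
exists (fun j => if j is inl i then c i else k) => x Ax.
by rewrite qE// wc// big_sumType big_ord1.
Qed.

Lemma spanned_on_closure (V : set ('rV[R]_d -> R)) :
  (forall A, A \in Th -> spanned_on (simplex A) V) -> spanned_on (closure Omega) V.
Proof. by move=> sV; rewrite closureE; exact: spanned_on_bigU. Qed.

Lemma fin_dim_Yh : fin_dim (Yh Omega fe Th) (aT Omega).
Proof.
apply: (@fin_dim_spanned R _ _ _ 'rV[R]_d (closure Omega) (fun S => S)).
- exact: subspace_Yh.
- by move=> x k S T _ _.
- apply: spanned_on_closure => A AT.
  apply: spanned_onS (spanned_on_poly (temperature_degree fe) (simplex A)).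
  by move=> _ [S [_ pS _] <-]; exact: pS.
- by move=> S _ S0; apply: aT_eq0 => x Ox; apply: S0; exact: subset_closure.
Qed.

Lemma fin_dim_Mh : fin_dim (Mh Omega Th) (ip Omega).
Proof.
apply: (@fin_dim_spanned R _ _ _ 'rV[R]_d (closure Omega) (fun S => S)).
- exact: subspace_Mh.
- by move=> x k S T _ _.
- apply: spanned_on_closure => A AT.
  apply: spanned_onS (spanned_on_poly 1 (simplex A)).
  by move=> _ [S [_ _ _ pS] <-]; exact: pS.
- move=> q _ q0; rewrite /ip (@eq_Rintegral _ _ _ _ _ (fun=> 0)).
    by rewrite Rintegral_cst// mul0r.
  by move=> x; rewrite inE => Ox; rewrite q0 ?mul0r//; exact: subset_closure.
Qed.

(** The values of a velocity are indexed by the points and the components. *)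
Lemma fin_dim_Xh : fin_dim (Xh Omega fe Th) (aV Omega).
Proof.
pose K : set ('rV[R]_d * 'I_d) := [set xi | closure Omega xi.1].
apply: (@fin_dim_spanned R _ _ _ _ K (fun v xi => v xi.1 ord0 xi.2)).
- exact: subspace_Xh.
- by move=> x k u v _ _; rewrite !mxE.
- have [J [e eP]] : spanned_on (closure Omega)
      [set q | forall A, A \in Th -> velocity_local fe A q].
    apply: spanned_on_closure => A AT.
    by apply: spanned_onS (spanned_on_velocity A) => q /(_ A AT).
  exists (J * 'I_d)%type, (fun ji xk => (ji.2 == xk.2)%:R * e ji.1 xk.1).
  move=> _ [v [_ lv _] <-].
  have /choice[c cP] : forall i, exists c : J -> R, forall x, closure Omega x ->
      component v i x = \sum_j c j * e j x.
    by move=> i; apply: eP => A AT; exact: lv.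
  exists (fun ji => c ji.2 ji.1) => -[x k] Kx /=.
  rewrite -[LHS]/(component v k x) cP//.
  rewrite -(pair_bigA _ (fun j i => c i j * ((i == k)%:R * e j x)))/=.
  apply: eq_bigr => j _; rewrite (bigD1 k)//= big1 => [|i ik].
    by rewrite eqxx mul1r addr0.
  by rewrite (negbTE ik) mul0r mulr0.
- move=> v _ v0; apply: aV_eq0 => x Ox; apply/rowP => i; rewrite mxE.
  by apply: (v0 (x, i)); exact: subset_closure.
Qed.

Section definiteness.
Variable C_2 : R.
Hypothesis hC_2 : embedding_bound Omega 2 C_2.

(** The embedding of vector fields into L^2, applied to S times a basis vector, is a
Poincare inequality for S. *)
Lemma aT_definite S : H10 Omega S -> aT Omega S S = 0 -> ip Omega S S = 0.
Proof.
move=> HS S0; pose i0 : 'I_d := Ordinal (@domain_dim R d Omega hO).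
pose v (x : 'rV[R]_d) : 'rV[R]_d := \row_i (if i == i0 then S x else 0).
have vE i : component v i = if i == i0 then S else 0.
  by apply/funext => x; rewrite /component mxE; case: ifP.
have Hv : H10v Omega v by move=> i; rewrite vE; case: ifP => _; [exact: HS|exact: H10_0].
have NE : ip Omega (fun x => mnorm (v x)) (fun x => mnorm (v x)) = ip Omega S S.
  rewrite ip_mnorm; apply: eq_Rintegral => x _.
  rewrite /mdot big_ord1 (bigD1 i0)//= big1 => [|i ii0]; first by rewrite !mxE eqxx addr0.
  by rewrite !mxE (negbTE ii0) mulr0.
have L0 j : L2 Omega (weak_partial Omega j 0) by apply: H10_partial_L2; exact: H10_0.
have v0 : aV Omega v v = 0.
  rewrite /aV (ipmE (L2m_gradv Hv) (L2m_gradv Hv)).2 (bigD1 i0)//= [X in _ + X]big1 => [|i ii0].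
    rewrite addr0 -[RHS]S0 /aT (ipmE (L2m_grad HS) (L2m_grad HS)).2 big_ord1.
    apply: eq_bigr => j _; congr (ip Omega _ _); apply/funext => x;
    by rewrite !mxE vE eqxx.
  rewrite big1// => j _.
  rewrite (_ : (fun x => _) = weak_partial Omega j 0); last first.
    by apply/funext => x; rewrite mxE vE (negbTE ii0).
  rewrite (ip_ae (v := 0) (L0 j) (L0 j) (@L2_0 R d Omega hO) (weak_partial0 j)).
  by rewrite (linear_on0 (subspace_L2 (hO := hO)) (ip_lin (L0 j))).
have := hC_2 Hv.
have LN : L2 Omega (fun x => mnorm (v x)) by apply: L2_mnorm; exact: L2m_field.
rewrite Lp_norm_L2// NE gradv_normE// v0 sqrtr0 mulr0 lee_fin => N0.
have [_ _ apos] := @semi_inner_ip R d Omega hO.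
apply/eqP; rewrite eq_le (apos _ (H10_L2 HS)) andbT -sqrtr_eq0 eq_le N0.
by rewrite sqrtr_ge0.
Qed.

Lemma Yh_definite S : Yh Omega fe Th S -> aT Omega S S = 0 ->
  forall x, Omega x -> S x = 0.
Proof.
move=> [cS _ HS] /(aT_definite HS) S0 x Ox.
apply: (within_continuous_eq0 cS); last exact: subset_closure.
by apply: ip_eq0 => //; exact: H10_L2.
Qed.

End definiteness.

End discrete_spaces.

(** * Continuous dependence on the coefficients *)

Lemma norm_powR_continuous (R : realType) (r : R) : 1 <= r ->
  continuous (fun a : R => `|a| `^ r).
Proof.
move=> r1 a; have [->|a0] := eqVneq a 0.
  rewrite /continuous_at normr0 powR0; last by rewrite gt_eqF// (lt_le_trans ltr01).
  apply/cvgrPdist_lt => e e0.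
  have m0 : 0 < Num.min e 1 by rewrite lt_min e0 ltr01.
  apply: filterS (nbhsx_ballx (0 : R) _ m0) => y.
  rewrite /ball /= sub0r normrN lt_min => /andP[ye y1].
  rewrite sub0r normrN ger0_norm ?powR_ge0//.
  have [->|y0] := eqVneq y 0.
    by rewrite normr0 powR0// gt_eqF// (lt_le_trans ltr01).
  apply: le_lt_trans ye; apply: ge1r_powR => //.
  by rewrite normr_gt0 y0 ltW.
apply: (@continuous_comp R R R (fun a : R => `|a|) (fun b : R => b `^ r) a).
  exact: norm_continuous.
apply: differentiable_continuous; apply/derivable1_diffP.
by apply: derivable_powR; rewrite in_itv/= normr_gt0 a0.
Qed.

Section parametric_integral.
Variables (R : realType) (d : nat) (Omega : set 'rV[R]_d).
Context {hO : bounded_domain Omega}.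
Let mu := @lebesgue_rV R d.
Let mO : measurable Omega. Proof. exact: measurable_domain. Qed.

(** Dominated convergence is a statement on sequences.  If continuity failed at c0,
some sequence would tend to c0 while the values of the integral stay away from
its value at c0; the sequence is bounded, so that one function k dominates the integrands. *)
Lemma continuous_Rintegral n (h : 'rV[R]_n -> 'rV[R]_d -> R) :
  (forall c, measurable_fun Omega (h c : _ -> measurableTypeR R)) ->
  (forall x, Omega x -> continuous (h ^~ x)) ->
  (forall r, exists2 k : 'rV[R]_d -> R, mu.-integrable Omega (EFin \o k) &
     forall c : 'rV[R]_n, (forall i, `|c ord0 i| <= r) -> forall x, Omega x -> `|h c x| <= k x) ->
  continuous (fun c => \int[mu]_(x in Omega) h c x).
Proof.
move=> mh ch bh c0; apply/(@cvgrPdist_lt _ _ _ (nbhs c0)) => e e0.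
set f := fun c => \int[mu]_(x in Omega) h c x.
apply: contrapT => nf.
have /choice[y yP] : forall k : nat, exists y, ball c0 k.+1%:R^-1 y /\ e <= `|f c0 - f y|.
  move=> k; apply: contrapT => nex; apply: nf; apply/nbhs_ballP.
  exists k.+1%:R^-1 => /=; first by rewrite invr_gt0.
  by move=> y yk; rewrite ltNge; apply/negP => ey; apply: nex; exists y.
have y0 : y k @[k --> \oo] --> c0.
  apply/cvg_ballP => r r0.
  have hr : \forall k \near \oo, k.+1%:R^-1 < r :> R.
    have /cvgrPdist_lt/(_ r r0) := @cvg_harmonic R.
    by apply: filterS => k; rewrite sub0r normrN ger0_norm ?invr_ge0.
  by apply: filterS hr => k kr; apply: (le_ball (ltW kr)); have [] := yP k.
pose r := `|c0| + 1.
have yr k i : `|y k ord0 i| <= r.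
  have [yk _] := yP k; rewrite -ball_normE /= in yk.
  have ylt : `|c0 - y k| <= 1 by rewrite (le_trans (ltW yk))// invf_le1// ler1n.
  rewrite (le_trans (le_coord _ _))// -[y k](subKr c0) (le_trans (ler_normB _ _))//.
  by rewrite lerD.
have c0r i : `|c0 ord0 i| <= r by rewrite (le_trans (le_coord _ _))// lerDl.
have [k ik hk] := bh r.
have [] := @dominated_convergence _ _ _ mu Omega mO (fun m x => (h (y m) x)%:E)
  (fun x => (h c0 x)%:E) (EFin \o k).
- by move=> m; apply/measurable_EFinP; exact: mh.
- by apply/measurable_EFinP; exact: mh.
- apply: aeW => x Ox; apply: cvg_EFin; first exact: nearW.
  by apply: (@cvg_comp _ _ _ y (h^~ x) _ (nbhs c0)) => //; exact: ch.
- exact: ik.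
- by apply: aeW => x m Ox; rewrite lee_fin; exact: hk.
move=> i0 _ cv.
have /fine_cvg fcv : [sequence (\int[mu]_(x in Omega) (h (y m) x)%:E)%E]_m @ \oo -->
    (fine (\int[mu]_(x in Omega) (h c0 x)%:E))%:E.
  by rewrite fineK//; exact: integrable_fin_num.
have /cvgrPdist_lt/(_ e e0)[N _ /(_ N (leqnn N))] /= := fcv.
by have [_] := yP N; rewrite leNgt => /negP; apply.
Qed.

End parametric_integral.

Lemma sum_apply (R : realType) (X : Type) (L : lmodType R) n (c : 'I_n -> R)
    (v : 'I_n -> X -> L) x : (\sum_i c i *: v i) x = \sum_i c i *: v i x.
Proof.
elim: n c v => [|n IH] c v; first by rewrite !big_ord0.
by rewrite !big_ord_recl -(IH (fun i => c (lift ord0 i)) (fun i => v (lift ord0 i))).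
Qed.

Lemma continuous_comb (R : realType) n (K : 'I_n -> 'rV[R]_n -> R) :
  (forall i, continuous (K i)) -> continuous (fun c : 'rV[R]_n => \sum_i c ord0 i * K i c).
Proof.
move=> cK c; apply: (@cvg_sum _ _ _ _ (nbhs c)) => i _.
by apply: (@cvgM _ _ (nbhs c)); [exact: coord_continuous|exact: cK].
Qed.

Lemma mnorm_triangle (R : realType) m n (A B : 'M[R]_(m, n)) :
  mnorm (A + B) <= mnorm A + mnorm B.
Proof.
rewrite -(@ler_pXn2r _ 2)// ?nnegrE ?addr_ge0 ?mnorm_ge0//.
rewrite sqr_mnorm sqrrD !sqr_mnorm mdotDl !mdotDr (mdotC B A).
have := le_trans (ler_norm _) (mdot_cauchy_schwarz A B).
by rewrite mulr2n; lra.
Qed.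

Lemma mnormZ (R : realType) m n k (A : 'M[R]_(m, n)) : mnorm (k *: A) = `|k| * mnorm A.
Proof. by rewrite /mnorm mdotZl mdotZr mulrA -expr2 sqrtrM ?sqr_ge0// sqrtr_sqr. Qed.

Lemma mnorm_sum_le (R : realType) n (r : R) (c : 'I_n -> R) d (v : 'I_n -> 'rV[R]_d)
    (M : 'I_n -> R) : (forall i, `|c i| <= r) -> (forall i, mnorm (v i) <= M i) ->
  mnorm (\sum_i c i *: v i) <= r * \sum_i M i.
Proof.
move=> cr vM; rewrite mulr_sumr.
apply: (big_ind2 (fun (a : 'rV[R]_d) b => mnorm a <= b)).
- by rewrite -(scale0r 0) mnormZ normr0 mul0r.
- by move=> a a' b b' ha hb; rewrite (le_trans (mnorm_triangle _ _))// lerD.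
- by move=> i _; rewrite mnormZ ler_pM// mnorm_ge0.
Qed.

Section coefficient_dependence.
Variables (R : realType) (d : nat) (Omega : set 'rV[R]_d).
Context {hO : bounded_domain Omega}.
Let mu := @lebesgue_rV R d.
Let mO : measurable Omega. Proof. exact: measurable_domain. Qed.
Variable n : nat.

Let sH : is_subspace (H10v Omega). Proof. exact: subspace_H10v. Qed.
Let sH1 : is_subspace (H10 Omega). Proof. exact: subspace_H10. Qed.

Section coefficient.
Variables (cf : R -> R) (cm cp : R) (T : 'I_n -> 'rV[R]_d -> R).
Hypotheses (cc : continuous cf) (cb : forall r, cm <= cf r <= cp) (cm0 : 0 < cm).
Hypothesis HT : forall i, H10 Omega (T i).

Let Tc (c : 'rV[R]_n) := \sum_i c ord0 i *: T i.

Let HTc c : H10 Omega (Tc c). Proof. exact: subspace_sum. Qed.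

(** The integrand is dominated by cp times k, uniformly in c. *)
Lemma coefficient_continuous (k : 'rV[R]_d -> R) :
  mu.-integrable Omega (EFin \o k) ->
  continuous (fun c : 'rV[R]_n => \int[mu]_(x in Omega) (cf (Tc c x) * k x)).
Proof.
move=> ik; have mk : measurable_fun Omega (k : _ -> measurableTypeR R).
  by apply/measurable_EFinP; have /integrableP[] := ik.
apply: continuous_Rintegral.
- move=> c; apply: measurable_funM => //.
  by apply: measurable_coefficient => //; exact: H10_L2.
- move=> x Ox c; apply: (@cvgM _ _ (nbhs c)); last exact: cvg_cst.
  have cT : continuous (fun c : 'rV[R]_n => Tc c x).
    rewrite (_ : (fun c => _) = fun c : 'rV[R]_n => \sum_i c ord0 i * T i x).
      by apply: continuous_comb => i; exact: cst_continuous.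
    by apply/funext => c'; rewrite /Tc sum_apply.
  by apply: (@continuous_comp _ _ _ (fun c : 'rV[R]_n => Tc c x) cf); [exact: cT|exact: cc].
- move=> r; exists (fun x => cp * `|k x|).
    rewrite (_ : EFin \o _ = fun x => (cp%:E * (`|k x|)%:E)%E); last by apply/funext.
    by apply: integrableZl => //; exact: (integrable_abse ik).
  move=> c _ x Ox; rewrite normrM ler_wpM2r//.
  exact: (coefficient_bound cb).
Qed.

(** The gradient of a combination is, under the integral, the combination of the
gradients: the only nonlinear dependence on c is through the coefficient. *)
Lemma coefficient_gradv_continuous (u : 'I_n -> 'rV[R]_d -> 'rV[R]_d) B :
  (forall i, H10v Omega (u i)) -> L2m Omega B ->
  continuous (fun c : 'rV[R]_n =>
    ipm Omega (fun x => cf (Tc c x) *: gradv Omega (\sum_i c ord0 i *: u i) x) B).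
Proof.
move=> Hu LB; pose k i x := mdot (B x) (gradv Omega (u i) x).
rewrite (_ : (fun c => _) = fun c : 'rV[R]_n => \sum_i c ord0 i *
    \int[mu]_(x in Omega) (cf (Tc c x) * k i x)).
  apply: continuous_comb => i; apply: coefficient_continuous.
  by apply: ipm_integrable => //; exact: L2m_gradv.
apply/funext => c.
transitivity (ipm Omega (fun x => cf (Tc c x) *: B x) (gradv Omega (\sum_i c ord0 i *: u i))).
  by apply: eq_Rintegral => x _; rewrite !mdotZl mdotC.
have LcB : L2m Omega (fun x => cf (Tc c x) *: B x).
  by apply: (L2m_coefficient cc cb) => //; exact: H10_L2.
rewrite (linear_on_sum sH (ipm_gradv_lin LcB))//.
by apply: eq_bigr => i _; rewrite coefficient_form.
Qed.

Lemma coefficient_grad_continuous B : L2m Omega B ->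
  continuous (fun c : 'rV[R]_n =>
    ipm Omega (fun x => cf (Tc c x) *: grad Omega (Tc c) x) B).
Proof.
move=> LB; pose k i x := mdot (B x) (grad Omega (T i) x).
rewrite (_ : (fun c => _) = fun c : 'rV[R]_n => \sum_i c ord0 i *
    \int[mu]_(x in Omega) (cf (Tc c x) * k i x)).
  apply: continuous_comb => i; apply: coefficient_continuous.
  by apply: ipm_integrable => //; exact: L2m_grad.
apply/funext => c.
transitivity (ipm Omega (fun x => cf (Tc c x) *: B x) (grad Omega (Tc c))).
  by apply: eq_Rintegral => x _; rewrite !mdotZl mdotC.
have LcB : L2m Omega (fun x => cf (Tc c x) *: B x).
  by apply: (L2m_coefficient cc cb) => //; exact: H10_L2.
rewrite (linear_on_sum sH1 (ipm_grad_lin LcB))//.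
by apply: eq_bigr => i _; rewrite coefficient_form.
Qed.

End coefficient.

(** For bounded coefficients c the combinations of bounded fields are bounded by a
constant B, which dominates the integrand; pointwise it is continuous in c as
s - 2 >= 1. *)
Lemma power_continuous (s : R) (u : 'I_n -> 'rV[R]_d -> 'rV[R]_d) v :
  3 <= s <= 4 -> (forall i, bounded_field Omega (u i)) -> bounded_field Omega v ->
  continuous (fun c : 'rV[R]_n => ipm Omega (power_field s (\sum_i c ord0 i *: u i)) v).
Proof.
move=> /andP[s3 s4] Bu Bv.
have Hu i : H10v Omega (u i) by case: (Bu i).
have Hv : H10v Omega v by case: Bv.
pose uc (c : 'rV[R]_n) := \sum_i c ord0 i *: u i.
have Huc c : H10v Omega (uc c) by exact: subspace_sum.
have muc c : measurable_fun Omega ((fun x => mnorm (uc c x) `^ (s - 2)) : _ -> measurableTypeR R).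
  exact: (measurable_mnorm_powR (s - 2) (Huc c)).
have mdot_uc c : mu.-integrable Omega (EFin \o (fun x => mdot (uc c x) (v x))).
  exact: (ipm_integrable (L2m_field (Huc c)) (L2m_field Hv)).
rewrite (_ : (fun c => _) = fun c : 'rV[R]_n => \int[mu]_(x in Omega)
   (mnorm (uc c x) `^ (s - 2) * mdot (uc c x) (v x))); last first.
  by apply/funext => c; rewrite power_form.
have cN : continuous (fun y : 'rV[R]_d => mnorm y `^ (s - 2)).
  rewrite (_ : (fun y => _) = (fun a : R => `|a| `^ (s - 2)) \o (@mnorm R 1 d)).
    move=> y; apply: (@continuous_comp _ _ _ (@mnorm R 1 d) (fun a : R => `|a| `^ (s - 2))).
      exact: mnorm_continuous.
    by apply: norm_powR_continuous; lra.
  by apply/funext => y /=; rewrite ger0_norm// mnorm_ge0.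
apply: continuous_Rintegral.
- move=> c; apply: measurable_funM; first exact: muc.
  by apply/measurable_EFinP; have /integrableP[] := mdot_uc c.
- move=> x Ox c.
  have cuc : (fun c' => uc c' x) @ c --> uc c x.
    rewrite /uc; under eq_fun do rewrite sum_apply.
    rewrite sum_apply; apply: (@cvg_sum _ _ _ _ (nbhs c)) => i _.
    by apply: (@cvgZ _ _ _ (nbhs c)); [exact: coord_continuous|exact: cvg_cst].
  apply: (@cvgM _ _ (nbhs c)).
    exact: (cvg_comp _ _ cuc (cN _)).
  rewrite /mdot; apply: (@cvg_sum _ _ _ _ (nbhs c)) => i _.
  apply: (@cvg_sum _ _ _ _ (nbhs c)) => j _.
  apply: (@cvgM _ _ (nbhs c)); last exact: cst_continuous.
  exact: (cvg_comp _ _ cuc (@coord_continuous R 1 d i j (uc c x))).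
- move=> r.
  have /choice[M MP] : forall i, exists M, forall x, Omega x -> mnorm (u i x) <= M.
    by move=> i; have [M _ MP] := bounded_field_mnorm (Bu i); exists M.
  have [N N0 vN] := bounded_field_mnorm Bv.
  pose B := r * \sum_i M i.
  exists (fun=> B `^ (s - 2) * (B * N)); first exact/L2_integrable/L2_cst.
  move=> c cr x Ox.
  have uB : mnorm (uc c x) <= B.
    by rewrite /uc sum_apply; apply: mnorm_sum_le => // i; exact: MP.
  rewrite normrM ger0_norm ?powR_ge0//; apply: ler_pM; rewrite ?powR_ge0//.
    apply: (ge0_ler_powR _ _ _ uB); rewrite ?nnegrE ?mnorm_ge0//; first by lra.
    by apply: (@le_trans _ _ (mnorm (uc c x))); [exact: mnorm_ge0|exact: uB].
  rewrite (le_trans (mdot_cauchy_schwarz _ _))//.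
  by apply: ler_pM; rewrite ?mnorm_ge0//; exact: vN.
Qed.

End coefficient_dependence.

(** * Existence of a solution and the bounds *)

Lemma linear_on_sub (R : realType) (U : lmodType R) (V V' : set U) (f : U -> R) :
  V' `<=` V -> linear_on V f -> linear_on V' f.
Proof. by move=> VV lf k u v /VV Vu /VV Vv; exact: lf. Qed.

Lemma semi_inner_sub (R : realType) (U : lmodType R) (V V' : set U) (a : U -> U -> R) :
  V' `<=` V -> semi_inner V a -> semi_inner V' a.
Proof.
move=> VV [asym alin apos]; split=> [u v /VV Vu /VV Vv|u /VV Vu|u /VV Vu].
- exact: asym.
- exact: linear_on_sub VV (alin u Vu).
- exact: apos.
Qed.

Section existence.
Variables (R : realType) (d : nat) (Omega : set 'rV[R]_d).
Context {hO : bounded_domain Omega}.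
Variables (fe : fe_pair R d) (Th : mesh R d).
Hypothesis closureE : closure Omega = mesh_union Th.
Variables (s num nup kappam kappap : R) (nu kappa : R -> R).
Variables (f : ('rV[R]_d -> 'rV[R]_d) -> R) (g : ('rV[R]_d -> R) -> R).
Variables (C_N C_2 C_s : R).
Hypothesis hs : 3 <= s <= 4.
Hypotheses (cnu : continuous nu) (ckappa : continuous kappa).
Hypotheses (num0 : 0 < num) (kappam0 : 0 < kappam).
Hypotheses (hnu : forall r, num <= nu r <= nup).
Hypotheses (hkappa : forall r, kappam <= kappa r <= kappap).
Hypotheses (hf : dual_space (H10v Omega) (gradv_norm Omega) f).
Hypotheses (hg : dual_space (H10 Omega) (grad_norm Omega) g).
Hypothesis hC_N : convection_bound Omega C_N.
Hypothesis hC_2 : best_embedding_constant Omega 2 C_2.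
Hypothesis hC_s : best_embedding_constant Omega s C_s.

Let mu := @lebesgue_rV R d.
Let X := Xh Omega fe Th.
Let Y := Yh Omega fe Th.
Let M := Mh Omega Th.
Let normf := dual_norm (H10v Omega) (gradv_norm Omega) f.
Let normg := dual_norm (H10 Omega) (grad_norm Omega) g.
Implicit Types (u v w : 'rV[R]_d -> 'rV[R]_d) (q S T : 'rV[R]_d -> R).

Let sX : is_subspace X. Proof. exact: subspace_Xh. Qed.
Let sY : is_subspace Y. Proof. exact: subspace_Yh. Qed.
Let sM : is_subspace M. Proof. exact: subspace_Mh. Qed.
Let sHv : is_subspace (H10v Omega). Proof. exact: subspace_H10v. Qed.
Let sH : is_subspace (H10 Omega). Proof. exact: subspace_H10. Qed.

Let XB u : X u -> bounded_field Omega u. Proof. exact: Xh_bounded. Qed.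
Let XH u : X u -> H10v Omega u. Proof. exact: Xh_H10v. Qed.
Let YH T : Y T -> H10 Omega T. Proof. exact: Yh_H10. Qed.
Let YL T : Y T -> L2 Omega T. Proof. by move=> /YH /H10_L2. Qed.

Let iX : semi_inner X (aV Omega). Proof. exact: (semi_inner_sub XH (@semi_inner_aV R d Omega hO)). Qed.
Let iY : semi_inner Y (aT Omega). Proof. exact: (semi_inner_sub YH (@semi_inner_aT R d Omega hO)). Qed.

Definition residual (w z : ('rV[R]_d -> 'rV[R]_d) * ('rV[R]_d -> R)) : R :=
  (velocity_form Omega s nu w.1 w.2 z.1 - f z.1) +
  (temperature_form Omega kappa w.1 w.2 z.2 - g z.2).

Let f_linear : linear_on (H10v Omega) f. Proof. by case: hf. Qed.
Let g_linear : linear_on (H10 Omega) g. Proof. by case: hg. Qed.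

Lemma velocity_residual_linear u T : X u -> Y T ->
  linear_on X (fun v => velocity_form Omega s nu u T v - f v).
Proof.
move=> Xu YT; apply: (linear_on_sub XH); apply: linear_onBr => //.
by apply: (velocity_form_linear hs cnu num0 hnu); [exact: XB|exact: YL].
Qed.

Lemma temperature_residual_linear u T : X u -> Y T ->
  linear_on Y (fun S => temperature_form Omega kappa u T S - g S).
Proof.
move=> Xu YT; apply: (linear_on_sub YH); apply: linear_onBr => //.
by apply: (temperature_form_linear ckappa kappam0 hkappa); [exact: XB|exact: YH].
Qed.

Lemma velocity_residual0 u T v : X u -> Y T -> X v -> aV Omega v v = 0 ->
  velocity_form Omega s nu u T v - f v = 0.
Proof.
move=> Xu YT Xv v0.
have gv0 : gradv_norm Omega v = 0 by rewrite gradv_normE ?v0 ?sqrtr0//; exact: XH.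
have h1 := velocity_form_bound (hO := hO) hs cnu num0 hnu hC_N hC_2 hC_s (XB Xu) (YL YT) (XB Xv).
have h2 := f_bound (hO := hO) hf (XH Xv).
move: h1 h2; rewrite gv0 !mulr0 !normr_le0 => /eqP -> /eqP ->.
by rewrite subrr.
Qed.

(** Half of the convective term contains S rather than its gradient.  By the
definiteness of the gradient norm on Y_h, a null S vanishes on Omega. *)
Lemma temperature_residual0 u T S : X u -> Y T -> Y S -> aT Omega S S = 0 ->
  temperature_form Omega kappa u T S - g S = 0.
Proof.
move=> Xu YT YS S0.
have [emb2 _] := hC_2.
have SO := Yh_definite (hO := hO) emb2 YS S0.
have gS0 : grad_norm Omega S = 0 by rewrite grad_normE ?S0 ?sqrtr0//; exact: YH.
have := g_bound (hO := hO) hg (YH YS); rewrite gS0 mulr0 normr_le0 => /eqP ->.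
have -> : temperature_form Omega kappa u T S = temperature_form Omega kappa u T 0.
  rewrite /temperature_form /a_ST (grad_eq0 SO); congr (_ + _ * _).
  by apply: eq_Rintegral => x; rewrite inE => Ox; rewrite SO.
have lin := temperature_form_linear (hO := hO) (u := u) ckappa kappam0 hkappa (XB Xu) (YH YT).
by rewrite (linear_on0 sH lin) subrr.
Qed.

(** The convective terms are quadratic polynomials in the coefficients. *)
Lemma a_SN_comb n (c : 'I_n -> R) (u : 'I_n -> 'rV[R]_d -> 'rV[R]_d) v :
  (forall i, X (u i)) -> X v ->
  a_SN Omega (\sum_i c i *: u i) (\sum_i c i *: u i) v =
  2^-1 * (\sum_i c i * (\sum_j c j * a_N Omega (u i) (u j) v) -
          \sum_i c i * (\sum_j c j * a_N Omega (u i) v (u j))).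
Proof.
move=> Xu Xv; have Xs := subspace_sum c sX Xu; rewrite /a_SN; congr (_ * (_ - _)).
- have lin : linear_on X (fun w => a_N Omega w (\sum_i c i *: u i) v).
    by move=> k w w' Xw Xw'; exact: (a_N_lin1 k (XB Xw) (XB Xw') (XH Xs) (XH Xv)).
  rewrite (linear_on_sum sX lin)//; apply: eq_bigr => i _; congr (_ * _).
  exact: (linear_on_sum sHv (a_N_lin2 (XB (Xu i)) (XH Xv)) c (fun j => XH (Xu j))).
- have lin : linear_on X (fun w => a_N Omega w v (\sum_i c i *: u i)).
    by move=> k w w' Xw Xw'; exact: (a_N_lin1 k (XB Xw) (XB Xw') (XH Xv) (XH Xs)).
  rewrite (linear_on_sum sX lin)//; apply: eq_bigr => i _; congr (_ * _).
  exact: (linear_on_sum sHv (a_N_lin3 (XB (Xu i)) (XH Xv)) c (fun j => XH (Xu j))).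
Qed.

Lemma a_ST_comb n (c : 'I_n -> R) (u : 'I_n -> 'rV[R]_d -> 'rV[R]_d)
    (T : 'I_n -> 'rV[R]_d -> R) S : (forall i, X (u i)) -> (forall i, Y (T i)) -> Y S ->
  a_ST Omega (\sum_i c i *: u i) (\sum_i c i *: T i) S =
  \sum_i c i * (\sum_j c j * a_ST Omega (u i) (T j) S).
Proof.
move=> Xu YT YS; have Ys := subspace_sum c sY YT.
have lin : linear_on X (fun w => a_ST Omega w (\sum_i c i *: T i) S).
  move=> k w w' Xw Xw'; have Xww' : X (k *: w + w') by have [_] := sX; apply.
  exact: (a_ST_lin1 (XB Xw) (XB Xw') (XB Xww') (YH Ys) (YH YS)).
rewrite (linear_on_sum sX lin)//; apply: eq_bigr => i _; congr (_ * _).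
exact: (linear_on_sum sH (a_ST_lin2 (XB (Xu i)) (YH YS)) c (fun j => YH (YT j))).
Qed.

Lemma residual_continuous n (w : 'I_n -> ('rV[R]_d -> 'rV[R]_d) * ('rV[R]_d -> R)) z :
  (forall i, (X `*` Y) (w i)) -> (X `*` Y) z ->
  continuous (fun c : 'rV[R]_n => residual (\sum_i c ord0 i *: w i) z : R).
Proof.
move=> Vw [Xv YS].
pose u i := (w i).1; pose T i := (w i).2; pose v := z.1; pose S := z.2.
have Xu i : X (u i) by case: (Vw i).
have YT i : Y (T i) by case: (Vw i).
pose uc (c : 'rV[R]_n) := \sum_i c ord0 i *: u i.
pose Tc (c : 'rV[R]_n) := \sum_i c ord0 i *: T i.
have Xuc c : X (uc c) by exact: subspace_sum.
have YTc c : Y (Tc c) by exact: subspace_sum.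
have addc (h k : 'rV[R]_n -> R) : continuous h -> continuous k -> continuous (fun c => h c + k c).
  by move=> ch ck c; apply: (@cvgD _ _ _ (nbhs c) _ h k); [exact: ch|exact: ck].
have oppc (h : 'rV[R]_n -> R) : continuous h -> continuous (fun c => - h c).
  by move=> ch c; apply: (@cvgN _ _ _ (nbhs c)); exact: ch.
have quad (K : 'I_n -> 'I_n -> R) :
    continuous (fun c : 'rV[R]_n => \sum_i c ord0 i * (\sum_j c ord0 j * K i j)).
  apply: continuous_comb => i; apply: continuous_comb => j.
  exact: cst_continuous.
rewrite (_ : (fun c => _) = fun c =>
   ipm Omega (fun x => nu (Tc c x) *: gradv Omega (uc c) x) (gradv Omega v)
   + \sum_i c ord0 i * ipm Omega (u i) v
   + 2^-1 * (\sum_i c ord0 i * (\sum_j c ord0 j * a_N Omega (u i) (u j) v) -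
             \sum_i c ord0 i * (\sum_j c ord0 j * a_N Omega (u i) v (u j)))
   + ipm Omega (power_field s (uc c)) v
   - f v
   + (ipm Omega (fun x => kappa (Tc c x) *: grad Omega (Tc c) x) (grad Omega S)
      + \sum_i c ord0 i * (\sum_j c ord0 j * a_ST Omega (u i) (T j) S) - g S)).
  apply: (addc); last first.
    apply: (addc); last exact: cst_continuous.
    apply: (addc); last exact: quad.
    apply: (coefficient_grad_continuous ckappa hkappa kappam0) => [i|].
      exact: (YH (YT i)).
    exact: (L2m_grad (YH YS)).
  apply: (addc); last exact: cst_continuous.
  apply: (addc); last first.
    exact: (power_continuous hs (fun i => XB (Xu i)) (XB Xv)).
  apply: (addc); last first.
    move=> c; apply: (@cvgM _ _ (nbhs c)); first exact: cst_continuous.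
    by apply: (addc _ (fun c => - _)); [exact: quad|apply: (oppc); exact: quad].
  apply: (addc); last by apply: continuous_comb => i; exact: cst_continuous.
  exact: (coefficient_gradv_continuous cnu hnu num0 (fun i => YH (YT i))
    (fun i => XH (Xu i)) (L2m_gradv (XH Xv))).
apply/funext => c; rewrite sum_pair /residual /= -/u -/T -/(uc c) -/(Tc c) -/v -/S.
rewrite (velocity_formE s cnu num0 hnu (XB (Xuc c)) (YL (YTc c)) (XH Xv)).
rewrite /temperature_form coefficient_form a_SN_comb// a_ST_comb//.
have linm : linear_on (H10v Omega) (fun w => ipm Omega w v).
  move=> k w1 w2 H1 H2.
  exact: (semi_innerDl (subspace_L2m _ _) (semi_inner_ipm _ _) k (L2m_field H1) (L2m_field H2) (L2m_field (XH Xv))).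
by rewrite (linear_on_sum sHv linm _ (fun i => XH (Xu i))).
Qed.

Let Vh : set ('rV[R]_d -> 'rV[R]_d) :=
  [set v | X v /\ forall q, M q -> div_form Omega q v = 0].

Let sVh : is_subspace Vh.
Proof.
have [X0 XP] := sX; split.
  split=> // q Mq.
  exact: (linear_on0 sHv (div_form_lin2 (Mh_L2 Mq))).
move=> k u v [Xu du] [Xv dv]; split; first exact: XP.
move=> q Mq; rewrite (div_form_lin2 (Mh_L2 Mq))//; [|exact: XH|exact: XH].
by rewrite du// dv// mulr0 addr0.
Qed.

Let VX : Vh `<=` X. Proof. by move=> v []. Qed.

Lemma exists_solution : exists u p T,
  discrete_solution Omega fe Th s nu kappa f g u p T.
Proof.
have sV := is_subspace_prod sVh sY.
have iV := semi_inner_prod (semi_inner_sub VX iX) iY.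
have fV : fin_dim (Vh `*` Y) (sum_form (aV Omega) (aT Omega)).
  apply: fin_dim_prod; last exact: fin_dim_Yh.
  exact: fin_dimS VX (fin_dim_Xh fe closureE).
have VXY : Vh `*` Y `<=` X `*` Y by move=> w [/VX Xw Yw].
(* On the sphere of radius rho the coercive part is at least
   m rho^2 = (|f| + |g| + 1) rho, which exceeds f u + g T. *)
pose m := Num.min num kappam.
have m0 : 0 < m by rewrite lt_min num0.
have nf0 : 0 <= normf by exact: normf_ge0.
have ng0 : 0 <= normg by exact: normg_ge0.
pose rho := (normf + normg + 1) / m.
have rho0 : 0 < rho by rewrite divr_gt0// ltr_wpDl// addr_ge0.
have [||||[u T] [[Xu du] YT] uT] := galerkin (rho := rho) (F := residual) sV iV fV _ _ _ rho0.
- move=> w /VXY[Xw Yw] k z z' [/VX Xz Yz] [/VX Xz' Yz'].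
  have e1 := velocity_residual_linear Xw Yw k Xz Xz'.
  have e2 := temperature_residual_linear Xw Yw k Yz Yz'.
  have alg (a b c a' b' c' : R) : a = k * b + c -> a' = k * b' + c' ->
    a + a' = k * (b + b') + (c + c') by move=> -> ->; ring.
  exact: alg e1 e2.
- move=> w z /VXY[Xw Yw] [/VX Xz Yz] /eqP.
  have [_ _ aVpos] := iX; have [_ _ aTpos] := iY.
  rewrite paddr_eq0; [|exact: aVpos|exact: aTpos] => /andP[/eqP z1 /eqP z2].
  by rewrite /residual velocity_residual0// temperature_residual0// addr0.
- by move=> n w z Vw Vz; exact: (residual_continuous (fun i => VXY _ (Vw i)) (VXY _ Vz)).
- move=> [u T] [/VX Xu YT] /= ww.
  have [gu0 gT0] := (gradv_norm_ge0 (hO := hO) (XH Xu), grad_norm_ge0 (hO := hO) (YH YT)).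
  have e1 := velocity_energy (hO := hO) s cnu num0 hnu (XB Xu) (YL YT).
  have e2 := temperature_energy (hO := hO) ckappa kappam0 hkappa u (YH YT).
  have f1 := le_trans (ler_norm _) (f_bound (hO := hO) hf (XH Xu)).
  have g1 := le_trans (ler_norm _) (g_bound (hO := hO) hg (YH YT)).
  have {ww} : gradv_norm Omega u ^+ 2 + grad_norm Omega T ^+ 2 = rho ^+ 2.
    have [_ _ aVpos] := iX; have [_ _ aTpos] := iY.
    rewrite gradv_normE ?grad_normE; [|exact: YH|exact: XH].
    by rewrite !sqr_sqrtr ?aVpos ?aTpos.
  rewrite /residual /=.
  move: (gradv_norm Omega u) (grad_norm Omega T) gu0 gT0 e1 e2 f1 g1 => a b a0 b0.
  rewrite -/normf -/normg.
  move: (velocity_form _ _ _ _ _ _) (temperature_form _ _ _ _ _) (f u) (g T) => A B fu gT.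
  move=> eA eB fa gb ab.
  have mn : m <= num by rewrite /m ge_min lexx.
  have mk : m <= kappam by rewrite /m ge_min lexx orbT.
  have ar : a <= rho by rewrite -(@ler_pXn2r _ 2)// ?nnegrE ?(ltW rho0)// -ab lerDl sqr_ge0.
  have br : b <= rho by rewrite -(@ler_pXn2r _ 2)// ?nnegrE ?(ltW rho0)// -ab lerDr sqr_ge0.
  have h1 : m * a ^+ 2 <= num * a ^+ 2 by rewrite ler_wpM2r ?sqr_ge0.
  have h2 : m * b ^+ 2 <= kappam * b ^+ 2 by rewrite ler_wpM2r ?sqr_ge0.
  have h3 : normf * a <= normf * rho by rewrite ler_wpM2l.
  have h4 : normg * b <= normg * rho by rewrite ler_wpM2l.
  have h5 : m * a ^+ 2 + m * b ^+ 2 = (normf + normg + 1) * rho.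
    by rewrite -mulrDr ab /rho; field; rewrite gt_eqF.
  by rewrite mulrDl mulrDl mul1r in h5; lra.
have T_eq S : Y S -> temperature_form Omega kappa u T S = g S.
  move=> YS; have := uT (0, S); rewrite /residual /=.
  have [V0 _] := sVh; have [X0 _] := sX.
  rewrite (linear_on0 sX (velocity_residual_linear Xu YT)) add0r => /(_ (conj V0 YS)).
  by move/eqP; rewrite subr_eq0 => /eqP.
have u_eq v : Vh v -> velocity_form Omega s nu u T v - f v = 0.
  move=> Vv; have := uT (v, 0); rewrite /residual /=.
  have [Y0 _] := sY.
  by rewrite (linear_on0 sY (temperature_residual_linear Xu YT)) addr0 => /(_ (conj Vv Y0)).
have [|||||||p Mp pP] := @lagrange_multiplier R _ _ X M (aV Omega) (ip Omega)
  (div_form Omega) (fun v => velocity_form Omega s nu u T v - f v)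
  sX iX (fin_dim_Xh fe closureE) sM (semi_inner_sub (@Mh_L2 _ _ _ _) (@semi_inner_ip R d Omega hO))
  (fin_dim_Mh closureE).
- by move=> q Mq; apply: (linear_on_sub XH); apply: div_form_lin2; exact: Mh_L2 Mq.
- by move=> v Xv; apply: (linear_on_sub (@Mh_L2 _ _ _ _)); apply: div_form_lin1; exact: XH.
- move=> q v Mq Xv v0; apply/eqP; rewrite -normr_le0.
  apply: le_trans (div_form_bound (Mh_L2 Mq) (XH Xv)) _.
  by rewrite gradv_normE ?v0 ?sqrtr0 ?mulr0//; exact: XH.
- move=> q v Mq Xv q0; apply/eqP; rewrite -normr_le0.
  apply: le_trans (div_form_bound (Mh_L2 Mq) (XH Xv)) _.
  by rewrite q0 mulr0 sqrtr0 mul0r.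
- exact: velocity_residual_linear.
- by move=> v Xv; exact: (velocity_residual0 Xu YT Xv).
- by move=> v Xv dv; apply: u_eq.
exists u, p, T; split=> // v q S Xv Mq YS; split.
- have e := pP v Xv.
  change (velocity_form Omega s nu u T v - div_form Omega p v = f v).
  by rewrite -e opprB addrC subrK.
- exact: du.
- exact: T_eq.
Qed.

Section bounds.
Variables (beta : R) (u : 'rV[R]_d -> 'rV[R]_d) (p T : 'rV[R]_d -> R).
Hypothesis CN0 : 0 < C_N.
Hypothesis beta0 : 0 < beta.
Hypothesis hinfsup : (beta%:E <= inf_sup_constant Omega fe Th)%E.
Hypothesis sol : discrete_solution Omega fe Th s nu kappa f g u p T.

Let Xu : X u. Proof. by case: sol. Qed.
Let Mp : M p. Proof. by case: sol. Qed.
Let YT : Y T. Proof. by case: sol. Qed.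

Let velocity_eq v : X v -> velocity_form Omega s nu u T v - div_form Omega p v = f v.
Proof. by move=> Xv; case: sol => _ _ _ /(_ v p T Xv Mp YT)[]. Qed.

Let div_eq : div_form Omega p u = 0.
Proof. by case: sol => _ _ _ /(_ u p T Xu Mp YT)[]. Qed.

Let temperature_eq : temperature_form Omega kappa u T T = g T.
Proof. by case: sol => _ _ _ /(_ u p T Xu Mp YT)[]. Qed.

Lemma solution_velocity_bound : gradv_norm Omega u <= num^-1 * normf.
Proof.
apply: (velocity_bound (s := s) cnu num0 hnu hf (XB Xu) (YL YT)).
by rewrite -(velocity_eq Xu) div_eq subr0.
Qed.

Lemma solution_temperature_bound : grad_norm Omega T <= kappam^-1 * normg.
Proof.
exact: (temperature_bound ckappa kappam0 hkappa hg (YH YT) temperature_eq).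
Qed.

(** The momentum equation bounds the integral of p div v by K |grad v|, so that each
quotient in the inf-sup constant is at most K / |p|. *)
Lemma solution_pressure_bound :
  L2_norm Omega p <= beta^-1 * Lambda s num nup C_N C_2 C_s normf * normf.
Proof.
pose gu := gradv_norm Omega u; pose K := velocity_constant s nup C_N C_2 C_s gu + normf.
have gu0 : 0 <= gu by exact: gradv_norm_ge0 (XH Xu).
have nf0 : 0 <= normf by exact: normf_ge0.
have K_Lambda : K <= Lambda s num nup C_N C_2 C_s normf * normf.
  apply: (velocity_constant_bound C_2 C_s hs num0 hnu hf (ltW CN0) gu0).
  exact: solution_velocity_bound.
have nup0 : 0 <= nup.
  by have /andP[a b] := hnu 0; rewrite (le_trans (ltW num0))// (le_trans a).
have K0 : 0 <= K.
  rewrite addr_ge0// /velocity_constant !addr_ge0// mulr_ge0 ?powR_ge0 ?sqr_ge0//.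
  exact: ltW.
have Kdiv v : X v -> `|div_form Omega p v| <= K * gradv_norm Omega v.
  move=> Xv.
  have -> : div_form Omega p v = velocity_form Omega s nu u T v - f v.
    by rewrite -(velocity_eq Xv) opprB addrC subrK.
  apply: le_trans (ler_normB _ _) _; rewrite mulrDl lerD//.
    exact: (velocity_form_bound hs cnu num0 hnu hC_N hC_2 hC_s (XB Xu) (YL YT) (XB Xv)).
  exact: (f_bound hf (XH Xv)).
rewrite -mulrA ler_pdivlMl//; apply: le_trans K_Lambda.
have [p0|p0] := eqVneq (L2_norm Omega p) 0; first by rewrite p0 mulr0.
have P0 : 0 < L2_norm Omega p.
  by rewrite lt_neqAle eq_sym p0 /= L2_norm_ip ?sqrtr_ge0//; exact: Mh_L2 Mp.
rewrite -ler_pdivlMr// -lee_fin; apply: le_trans hinfsup _.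
have pnz : nonzero_on (closure Omega) p.
  apply: contrapT => pz; case/negP: p0; rewrite L2_norm_ip; last exact: Mh_L2 Mp.
  rewrite /ip (@eq_Rintegral _ _ _ _ _ (fun=> 0)).
    rewrite Rintegral_cst ?mul0r ?sqrtr0//; exact: measurable_domain.
  move=> x; rewrite inE => Ox; have [->|px] := eqVneq (p x) 0; first by rewrite mul0r.
  by case: pz; exists x => //; exact: subset_closure.
apply: (@le_trans _ _ (ereal_sup [set
      ((\int[mu]_(x in Omega) (p x * divergence Omega v x)) /
       (gradv_norm Omega v * L2_norm Omega p))%:E
    | v in [set v | X v /\ nonzero_on (closure Omega) v]])).
  by apply: ereal_inf_lbound; exists p.
apply: ge_ereal_sup => _ [v [Xv _] <-]; rewrite lee_fin.
have gv0 : 0 <= gradv_norm Omega v by exact: gradv_norm_ge0 (XH Xv).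
have [gvz|gvn] := eqVneq (gradv_norm Omega v) 0.
  (* The quotient is then 0, as it has denominator 0. *)
  by rewrite gvz mul0r invr0 mulr0 divr_ge0// ltW.
have gv : 0 < gradv_norm Omega v by rewrite lt_neqAle eq_sym gvn.
rewrite ler_pdivrMr ?mulr_gt0// (le_trans (ler_norm _))// (le_trans (Kdiv v Xv))//.
have cancel (a b c : R) : 0 < c -> a / c * (b * c) = a * b.
  by move=> c0; field; rewrite gt_eqF.
by rewrite cancel.
Qed.

End bounds.

End existence.

Theorem theorem4p1 (R : realType) (d : nat) (hd : d = 2%N \/ d = 3%N)
    (Omega : set 'rV[R]_d) (hOmega : lipschitz_polytope Omega)
    (s : R) (hs : 3 <= s <= 4)
    (nu kappa : R -> R) (num nup kappam kappap : R)
    (hnu_lip : lipschitz nu) (hkappa_lip : lipschitz kappa)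
    (hnum : 0 < num) (hnup : 0 < nup)
    (hkappam : 0 < kappam) (hkappap : 0 < kappap)
    (hnu : forall r, num <= nu r <= nup)
    (hkappa : forall r, kappam <= kappa r <= kappap)
    (f : ('rV[R]_d -> 'rV[R]_d) -> R)
    (hf : dual_space (H10v Omega) (gradv_norm Omega) f)
    (g : ('rV[R]_d -> R) -> R)
    (hg : dual_space (H10 Omega) (grad_norm Omega) g)
    (T0 : mesh R d) (TT : set (mesh R d)) (hTT : mesh_family Omega T0 TT)
    (fe : fe_pair R d) (hfe : fe_pair_wf fe TT)
    (beta : R) (hbeta : 0 < beta)
    (hinfsup : forall Th, TT Th -> (beta%:E <= inf_sup_constant Omega fe Th)%E)
    (C_N C_2 C_s : R)
    (hC_N : 0 < C_N) (hC_N_bound : convection_bound Omega C_N)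
    (hC_2 : best_embedding_constant Omega 2 C_2)
    (hC_s : best_embedding_constant Omega s C_s) :
  let normf := dual_norm (H10v Omega) (gradv_norm Omega) f in
  let normg := dual_norm (H10 Omega) (grad_norm Omega) g in
  forall Th, TT Th ->
    (exists u p T, discrete_solution Omega fe Th s nu kappa f g u p T) /\
    (forall u p T, discrete_solution Omega fe Th s nu kappa f g u p T ->
      [/\ gradv_norm Omega u <= num^-1 * normf,
          L2_norm Omega p <= beta^-1 * Lambda s num nup C_N C_2 C_s normf * normf &
          grad_norm Omega T <= kappam^-1 * normg]).
Proof.
move=> normf normg Th hTh.
have d0 : (0 < d)%N by case: hd => ->.
have [oO O0 bO _ _] := hOmega.
have hO : bounded_domain Omega by exact: BoundedDomain.
have [_ /(_ Th hTh)[[_ _ closureE _] _] _] := hTT.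
have cnu := lipschitz_continuous hnu_lip.
have ckappa := lipschitz_continuous hkappa_lip.
split.
  exact: (exists_solution fe closureE hs cnu ckappa hnum hkappam hnu hkappa hf hg
    hC_N_bound hC_2 hC_s).
move=> u p T sol; split.
- exact: (solution_velocity_bound cnu hnum hnu hf sol).
- exact: (solution_pressure_bound hs cnu hnum hnu hf hC_N_bound hC_2 hC_s hC_N
    hbeta (hinfsup Th hTh) sol).
- exact: (solution_temperature_bound ckappa hkappam hkappa hg sol).
Qed.
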